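(* For any $\sigma\in\Sigma$ and any $v\in\mathcal S(\mathscr X)$ with $\|v\|_{L^2(\mathscr X)}=1$, one has on the Rieffel quantization $\mathfrak C_0(\Sigma)$ of $C_0(\Sigma)$ the equality of maps into $\mathbb B[L^2(\Xi)]$ $$(r_\sigma\rtimes T)^M_{{\sf h}(v)}=\mathbb U_v\circ\mathfrak{Op}_\sigma .$$
   Context: Phase space and measures. $\mathscr X$ is a real vector space of dimension $n$ (say $\mathbb R^n$), $\Xi=\mathscr X\times\mathscr X^*$ with points $X=(x,\xi)$, $Y=(y,\eta)$ and symplectic form $[\![X,Y]\!]=x\cdot\eta-y\cdot\xi$. Measures: $dx$ is Lebesgue measure on $\mathscr X$, $d\xi$ is $(2\pi)^{-n}$ times the dual Lebesgue measure on $\mathscr X^*$, and $dX=dx\,d\xi$. Scalar products are anti-linear in the first variable. $\kappa(X,Y):=\exp(-\frac i2[\![X,Y]\!])$. $\mathcal S(\mathscr X)$ and $\mathcal S(\Xi)$ are Schwartz spaces, and on $\mathcal S(\Xi)$ one has $({\sf h}\,\sharp\,{\sf k})(X)=2^{2n}\int_\Xi\int_\Xi e^{2i[\![Y,Z]\!]}{\sf h}(X-Y){\sf k}(X-Z)\,dYdZ$. Classical data. $\Sigma$ is a locally compact Hausdorff space with an action $\Theta$ of $\Xi$ by homeomorphisms such that $[\Theta_X(f)](\sigma):=f[\Theta_X(\sigma)]$ defines a strongly continuous action of $\Xi$ by automorphisms of $\mathcal A:=C_0(\Sigma)$. $\Theta_\sigma(X):=\Theta_X(\sigma)$. $C_0^\infty(\Sigma)$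 denotes the space of $f\in C_0(\Sigma)$ for which $X\mapsto\Theta_X(f)\in C_0(\Sigma)$ is $C^\infty$. Rieffel quantization. On $C_0^\infty(\Sigma)$ (denoted $\mathfrak C_0^\infty(\Sigma)$ with the new structure) one has the product $f\#g:=2^{2n}\int_\Xi\int_\Xi e^{2i[\![Y,Z]\!]}\Theta_Y(f)\Theta_Z(g)\,dYdZ$ (oscillatory integral) and complex conjugation as involution. Rieffel's $C^*$-norm of $f$ is the operator norm of $(L_fG)(X)=2^{2n}\int_\Xi\int_\Xi e^{2i[\![Y,Z]\!]}\Theta_{X+Y}(f)\,G(X+Z)\,dZ\,dY$ (integrate first in $Z$) on $\mathcal S(\Xi;\mathcal A)$ with the norm $\|G\|=\|\int_\Xi G(X)^*G(X)dX\|_{\mathcal A}^{1/2}$. The completion is the $C^*$-algebra $\mathfrak C_0(\Sigma)$. Twisted crossed product. $\mathcal A\rtimes_\Theta^\kappa\Xi$ is the enveloping $C^*$-algebra of the Banach $^*$-algebra $L^1(\Xi;\mathcal A)$ with $F^\diamond(X):=F(-X)^*$ and $(F_1\diamond F_2)(X):=\int_\Xi\kappa(X,Y)\Theta_{(Y-X)/2}[F_1(Y)]\Theta_{Y/2}[F_2(X-Y)]dY$. If ${\sf h}\,\sharp\,{\sf h}={\sf h}=\overline{\sf h}\in\mathcal S(\Xi)\setminus\{0\}$, the map $[M_{\sf h}(f)](X)=\int_\Xi e^{-i[\![X,Y]\!]}{\sf h}(Y)\Theta_Y(f)\,dY$, $f\in\mathfrak C_0^\infty(\Sigma)$, extends to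 an injective $C^*$-morphism $M_{\sf h}:\mathfrak C_0(\Sigma)\to\mathcal A\rtimes_\Theta^\kappa\Xi$. The representations $(r_\sigma\rtimes T)^M_{\sf h}$. For $\sigma\in\Sigma$ define on $L^2(\Xi)$: $[r_\sigma(g)\Phi](X):=g[\Theta_X(\sigma)]\Phi(X)$ for $g\in C_0(\Sigma)$ and $[T(Y)\Phi](X):=\kappa(Y,X)\Phi(X+Y)$. The representation $r_\sigma\rtimes T$ of $\mathcal A\rtimes_\Theta^\kappa\Xi$ is determined by $(r_\sigma\rtimes T)(G)=\int_\Xi r_\sigma\{\Theta_{X/2}[G(X)]\}T(X)dX$ for $G\in L^1(\Xi;\mathcal A)$, and $(r_\sigma\rtimes T)^M_{\sf h}:=(r_\sigma\rtimes T)\circ M_{\sf h}$. Weyl calculus. $[\mathfrak{Op}({\sf f})u](x):=\int_{\mathscr X}\int_{\mathscr X^*}e^{i(x-y)\cdot\xi}\,{\sf f}(\frac{x+y}2,\xi)\,u(y)\,dyd\xi$ (an oscillatory integral for smooth ${\sf f}$ with all derivatives bounded, in which case $\mathfrak{Op}({\sf f})\in\mathbb B[L^2(\mathscr X)]$). With this symplectic form $\mathfrak{Op}({\sf f}\,\sharp\,{\sf g})=\mathfrak{Op}({\sf f})\mathfrak{Op}({\sf g})$. For $f\in\mathfrak C_0^\infty(\Sigma)$ put $\mathfrak{Op}_\sigma(f):=\mathfrak{Op}(f\circ\Theta_\sigma)$; this extends by continuity to a representation $\mathfrak{Op}_\sigma:\mathfrak C_0(\Sigma)\to\mathbb B[L^2(\mathscr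 X)]$. Put $\mathfrak{op}(X):=\mathfrak{Op}({\sf e}_X)$ with ${\sf e}_X(Y):=e^{i[\![X,Y]\!]}$; these are unitary operators. Bargmann transform. For $v\in\mathcal S(\mathscr X)$ with $\|v\|=1$ put $v(Y):=\mathfrak{op}(-Y)v$ for $Y\in\Xi$, and let $\mathcal U_v:L^2(\mathscr X)\to L^2(\Xi)$ be the isometry $(\mathcal U_vu)(X):=\langle v(X),u\rangle_{L^2(\mathscr X)}$. Set $\mathbb U_v[S]:=\mathcal U_vS\,\mathcal U_v^*$ for $S\in\mathbb B[L^2(\mathscr X)]$. Window. ${\sf h}(v)\in\mathcal S(\Xi)$ is the Wigner function $[{\sf h}(v)](x,\xi)=\int_{\mathscr X}e^{iy\cdot\xi}\,\overline{v(x+\frac y2)}\,v(x-\frac y2)\,dy$. It satisfies ${\sf h}(v)\,\sharp\,{\sf h}(v)={\sf h}(v)=\overline{{\sf h}(v)}$, and $\mathfrak{Op}({\sf h}(v))$ is the rank-one projection onto $\mathbb Cv$. *)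

(* Defs.v *)
From HB Require Import structures.
From mathcomp Require Import all_boot all_order all_algebra.
From mathcomp Require Import all_classical all_reals all_analysis.
From mathcomp Require Import measurable_realfun complex ring lra.
Set Implicit Arguments. Unset Strict Implicit. Unset Printing Implicit Defensive.
Import Order.TTheory GRing.Theory Num.Theory.
Import numFieldNormedType.Exports.
Local Open Scope classical_set_scope.
Local Open Scope ring_scope.
Local Open Scope complex_scope.

Section measurable_rV.
Context (R : realType) (n : nat).

Definition rV_coord (i : 'I_n) (x : 'rV[R]_n) : measurableTypeR R := x ord0 i.

HB.instance Definition _ := @isMeasurable.Build
  (measure_tuple_display default_measure_display) 'rV[R]_n
  (g_sigma_preimage rV_coord) (@sigma_algebra0 _ _ _)
  (@sigma_algebraC _ _) (@sigma_algebra_bigcup _ _ _).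

Lemma measurable_rV_coord (i : 'I_n) :
  measurable_fun [set: 'rV[R]_n] (rV_coord i).
Proof.
move=> _ Y mY; rewrite setTI; apply: sub_sigma_algebra => /=.
rewrite -bigcup_seq/=; exists i => /=; first by rewrite mem_index_enum.
by exists Y => //; rewrite setTI.
Qed.

Lemma measurable_fun_rV d (T : measurableType d) (f : T -> 'rV[R]_n) :
  (forall i, measurable_fun [set: T] (rV_coord i \o f)) ->
  measurable_fun [set: T] f.
Proof.
move=> mf.
suff h : g_sigma_preimage (fun i => rV_coord i \o f) `<=` measurable.
  by move=> _ A mA; apply: h; rewrite g_sigma_preimage_comp; exists A.
apply: smallest_sub; first exact: sigma_algebra_measurable.
rewrite -bigcup_seq; apply: bigcup_sub => i _ A [B mB <-]; exact: mf.
Qed.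

End measurable_rV.

(* The library only lets the products of (sub)probability measures be inferred
   to be sigma-finite, so iterated products go through this alias of [\x]. *)
Section prod_measure.
Context d1 d2 (T1 : measurableType d1) (T2 : measurableType d2) (R : realType).
Variables (m1 : {sigma_finite_measure set T1 -> \bar R})
          (m2 : {sigma_finite_measure set T2 -> \bar R}).
Local Open Scope ereal_scope.

Definition prod_measure : set (T1 * T2) -> \bar R := m1 \x m2.

HB.instance Definition _ := Measure.copy prod_measure (m1 \x m2).

Let prod_measure_sigma_finite : sigma_finite setT prod_measure.
Proof.
have /sigma_finiteP[F [TF ndF Foo]] := sigma_finiteT m1.
have /sigma_finiteP[G [TG ndG Goo]] := sigma_finiteT m2.
exists (fun n => F n `*` G n).
  rewrite -setXTT TF TG predeqE => -[x y]; split.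
    move=> [/= [n _ Fnx] [k _ Gky]]; exists (maxn n k) => //; split.
    - by move: x Fnx; exact/subsetPset/ndF/leq_maxl.
    - by move: y Gky; exact/subsetPset/ndG/leq_maxr.
  by move=> [n _ []/= ? ?]; split; exists n.
move=> k; have [? ?] := Foo k; have [? ?] := Goo k.
split; first exact: measurableX.
by rewrite /prod_measure product_measure1E// lte_mul_pinfty// ge0_fin_numE.
Qed.

HB.instance Definition _ := @Measure_isSigmaFinite.Build _ _ _ prod_measure
  prod_measure_sigma_finite.

End prod_measure.

Section lebesgue_rV.
Context (R : realType).

Definition rV_cons n (p : measurableTypeR R * 'rV[R]_n) : 'rV[R]_n.+1 :=
  row_mx (const_mx p.1 : 'rV_1) p.2.

Definition rV_uncons n (x : 'rV[R]_n.+1) : measurableTypeR R * 'rV[R]_n :=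
  (x ord0 ord0, \row_i x ord0 (lift ord0 i)).

Lemma rV_consK n : cancel (@rV_cons n) (@rV_uncons n).
Proof.
case=> a x; rewrite /rV_uncons /rV_cons/=; congr pair.
  by rewrite mxE; case: splitP => // j _; rewrite mxE.
apply/rowP => i; rewrite mxE.
rewrite !mxE; case: splitP => [j|k /eqP]; first by case: j => -[].
by rewrite /bump/= eqn_add2l => /eqP/val_inj ->.
Qed.

Lemma measurable_rV_cons n : measurable_fun setT (@rV_cons n).
Proof.
apply: measurable_fun_rV => i.
have [->|i0] := eqVneq i ord0.
  rewrite (_ : _ \o _ = fst)//; apply/funext => p /=.
  exact: (congr1 fst (rV_consK p)).
have i1n : (i.-1 < n)%N by rewrite prednK ?lt0n// -ltnS.
rewrite (_ : _ \o _ = rV_coord (Ordinal i1n) \o snd).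
  by apply: measurableT_comp => //; exact: measurable_rV_coord.
apply/funext => p /=.
rewrite -[in RHS](rV_consK p) /rV_coord/= mxE; congr (rV_cons _ _ _).
by apply/val_inj => /=; rewrite /bump/= add1n prednK// lt0n.
Qed.

Lemma measurable_rV_uncons n : measurable_fun setT (@rV_uncons n).
Proof.
apply/measurable_fun_pairP; split.
  by rewrite (_ : _ \o _ = rV_coord ord0)//; exact: measurable_rV_coord.
apply: measurable_fun_rV => i.
rewrite (_ : _ \o _ = rV_coord (lift ord0 i)); first exact: measurable_rV_coord.
by apply/funext => x; rewrite /rV_coord/= mxE.
Qed.


Section step.
Context n (mu : {sigma_finite_measure set 'rV[R]_n -> \bar R}).
Local Open Scope ereal_scope.

Definition lebesgue_cons : set 'rV[R]_n.+1 -> \bar R :=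
  pushforward (prod_measure (@lebesgue_measure R) mu) (@rV_cons n).

Let lebesgue_cons_measure : {measure set 'rV[R]_n.+1 -> \bar R} :=
  measure_function_pushforward__canonical__measure_function_Measure
    (prod_measure (@lebesgue_measure R) mu) (@measurable_rV_cons n).

Let lebesgue_cons_sigma_finite : sigma_finite setT lebesgue_cons.
Proof.
have [F TF mF] := sigma_finiteT (prod_measure (@lebesgue_measure R) mu).
exists (fun k => @rV_uncons n @^-1` F k).
  by rewrite -preimage_bigcup -TF preimage_setT.
move=> k; have [mFk Fk] := mF k; split.
  by rewrite -[X in measurable X]setTI; exact: measurable_rV_uncons.
rewrite /lebesgue_cons /pushforward -comp_preimage.
by rewrite (_ : _ \o _ = id) //; apply/funext => p /=; rewrite rV_consK.
Qed.

HB.instance Definition _ := Measure.copy lebesgue_cons lebesgue_cons_measure.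
HB.instance Definition _ := @Measure_isSigmaFinite.Build _ _ _ lebesgue_cons
  lebesgue_cons_sigma_finite.

End step.

Fixpoint lebesgue_rV n : {sigma_finite_measure set 'rV[R]_n -> \bar R} :=
  if n is n'.+1 then lebesgue_cons (lebesgue_rV n') else \d_(0 : 'rV[R]_0).

End lebesgue_rV.

(* The normed module structure of [R[i]] over itself, as the library provides it
   for abstract closed fields. *)
#[export, non_forgetful_inheritance]
HB.instance Definition _ (R : realType) := NormedModule.copy R[i] (R[i]^o).

Section complex_scalars.
Context (R : realType).

(* exp(i t) *)
Definition cis (t : R) : R[i] := cos t +i* sin t.

(* Norms of complex normed modules take values in [R[i]]. *)
Definition nrm (W : normedModType R[i]) (w : W) : R := complex.Re `|w|.

Definition cintegral d (T : measurableType d) (mu : {measure set T -> \bar R})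
    (f : T -> R[i]) : R[i] :=
  Rintegral mu setT (fun x => complex.Re (f x)) +i*
  Rintegral mu setT (fun x => complex.Im (f x)).

Lemma nrm_ge0 (W : normedModType R[i]) (w : W) : 0 <= nrm w.
Proof. by have := normr_ge0 w; rewrite lecE => /andP[]. Qed.

Lemma nrmE (W : normedModType R[i]) (w : W) : `|w| = (nrm w)%:C.
Proof. by rewrite /nrm RRe_real// normr_real. Qed.

Lemma nrmD (W : normedModType R[i]) (v w : W) : nrm (v + w) <= nrm v + nrm w.
Proof. by rewrite -lecR rmorphD/= -!nrmE ler_normD. Qed.

Lemma nrmM (a b : R[i]) : nrm (a * b) = nrm a * nrm b.
Proof. by apply: complexI; rewrite rmorphM/= -!nrmE normrM. Qed.

Lemma nrmZ (W : normedModType R[i]) (a : R[i]) (w : W) :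
  nrm (a *: w) = nrm a * nrm w.
Proof. by apply: complexI; rewrite rmorphM/= -!nrmE normrZ. Qed.

Lemma nrm_conjc (a : R[i]) : nrm a^* = nrm a.
Proof. by rewrite /nrm normcJ. Qed.

Lemma continuous_nrm (W : normedModType R[i]) : continuous (@nrm W).
Proof.
move=> w; apply/cvgrPdist_lt => e e0.
near=> z.
rewrite ltr_norml.
have h : nrm (w - z) < e.
  rewrite -ltcR -nrmE; near: z.
  by apply: (@cvgr_dist_lt _ _ _ (nbhs w) _ id w) => //; rewrite ltcR.
have := nrmD (w - z) z; rewrite subrK => h1.
have := nrmD (z - w) w; rewrite subrK.
have -> : nrm (z - w) = nrm (w - z) by rewrite /nrm distrC.
by move=> h2; apply/andP; split; lra.
Unshelve. all: by end_near. Qed.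

Lemma continuous_conjc : continuous (@conjc R).
Proof.
move=> w A [e e0 sA]; exists e => // z wz; apply: sA.
by move: wz; rewrite /ball_/= -rmorphB normcJ.
Qed.

End complex_scalars.
Arguments nrm {R W} w.

Section continuous_functions_vanishing_at_infinity.
Context (R : realType) (Sigma : topologicalType).

Definition vanishes_at_infinity (f : Sigma -> R[i]) :=
  forall e : R, 0 < e ->
    exists2 K, compact K & forall s, ~ K s -> nrm (f s) < e.

Definition C0_pred : {pred Sigma -> R[i]} :=
  fun f => `[< continuous f /\ vanishes_at_infinity f >].

Lemma C0_submod : submod_closed C0_pred.
Proof.
split.
  apply/asboolP; split; first by move=> s; exact: cvg_cst.
  by move=> e e0; exists set0 => [|s _]; [exact: compact0|rewrite /nrm normr0].
move=> a f g /asboolP[cf vf] /asboolP[cg vg]; apply/asboolP; split.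
  move=> s; apply: cvgD; last exact: cg.
  by apply: cvgZr; exact: cf.
move=> e e0.
have ha : 0 < nrm a + 1 by rewrite ltr_wpDl// nrm_ge0.
have [K cK hK] := vf (e / 2 / (nrm a + 1)) ltac:(by rewrite !divr_gt0).
have [L cL hL] := vg (e / 2) ltac:(by rewrite divr_gt0).
exists (K `|` L); first exact: compactU.
move=> s /not_orP[/hK Kf /hL Lg].
apply: (le_lt_trans (nrmD _ _)); rewrite [e]splitr ler_ltD// nrmM.
move: Kf; rewrite ltr_pdivlMr// => Kf.
apply: le_trans (ltW Kf); rewrite mulrC ler_wpM2l ?nrm_ge0//.
by rewrite lerDl.
Qed.

HB.instance Definition _ := GRing.isSubmodClosed.Build _ _ C0_pred C0_submod.

Record C0 := MkC0 { C0_val :> Sigma -> R[i]; C0_valP : C0_val \in C0_pred }.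

HB.instance Definition _ := [isSub for C0_val].
HB.instance Definition _ := [Choice of C0 by <:].
HB.instance Definition _ := [SubChoice_isSubLmodule of C0 by <:].

Lemma C0_continuous (f : C0) : continuous f.
Proof. by have /asboolP[] := C0_valP f. Qed.

Lemma C0_vanishes (f : C0) : vanishes_at_infinity f.
Proof. by have /asboolP[] := C0_valP f. Qed.

Lemma C0_bounded (f : C0) : has_ubound (range (nrm \o f)).
Proof.
have [K cK hK] := @C0_vanishes f 1 ltr01.
have : compact ((nrm \o f) @` K).
  apply: continuous_compact => //; apply: continuous_subspaceT => s.
  apply: continuous_comp; [exact: C0_continuous|exact: continuous_nrm].
move=> /compact_bounded[M [_ hM]].
exists (Num.max 1 (M + 1)) => _ [s _ <-]/=.
have [Ks|/hK/ltW] := pselect (K s); last by rewrite le_max => ->.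
rewrite le_max; apply/orP; right; apply: le_trans (ler_norm _) _.
by apply: (hM (M + 1)); [rewrite ltrDl|exists s].
Qed.

Definition sup_norm (f : C0) : R := sup (range (nrm \o f)).

Lemma sup_norm_ub (f : C0) s : nrm (f s) <= sup_norm f.
Proof. by apply: ub_le_sup; [exact: C0_bounded|exists s]. Qed.

Lemma sup_norm_le (f : C0) (M : R) : 0 <= M ->
  (forall s, nrm (f s) <= M) -> sup_norm f <= M.
Proof.
move=> M0 fM; have [/eqP e|/set0P ne] := boolP (range (nrm \o f) == set0).
  by rewrite /sup_norm e sup0.
by apply: ge_sup => // _ [s _ <-]; exact: fM.
Qed.

Lemma sup_norm_ge0 (f : C0) : 0 <= sup_norm f.
Proof.
have [/eqP e|/set0P[_ [s _ _]]] := boolP (range (nrm \o f) == set0).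
  by rewrite /sup_norm e sup0.
exact: le_trans (nrm_ge0 _) (sup_norm_ub f s).
Qed.

Let C0_normD (f g : C0) :
  (sup_norm (f + g))%:C <= (sup_norm f)%:C + (sup_norm g)%:C.
Proof.
rewrite -rmorphD lecR; apply: sup_norm_le => [|s].
  by rewrite addr_ge0// sup_norm_ge0.
by apply: le_trans (nrmD _ _) _; rewrite lerD// sup_norm_ub.
Qed.

Let C0_normZ (a : R[i]) (f : C0) :
  (sup_norm (a *: f))%:C = `|a| * (sup_norm f)%:C.
Proof.
rewrite nrmE -rmorphM; congr (_%:C); apply/eqP; rewrite eq_le; apply/andP; split.
  apply: sup_norm_le => [|s]; first by rewrite mulr_ge0 ?nrm_ge0 ?sup_norm_ge0.
  by rewrite nrmM ler_wpM2l ?nrm_ge0// sup_norm_ub.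
have [->|a0] := eqVneq a 0; first by rewrite /nrm normr0 mul0r sup_norm_ge0.
have na : 0 < nrm a by rewrite -ltcR -nrmE normr_gt0.
rewrite -ler_pdivlMl//; apply: sup_norm_le => [|s].
  by rewrite mulr_ge0 ?sup_norm_ge0// invr_ge0 ltW.
rewrite ler_pdivlMl// -nrmM; exact: (sup_norm_ub (a *: f) s).
Qed.

Let C0_norm0 (f : C0) : (sup_norm f)%:C = 0 -> f = 0.
Proof.
move=> /(@complexI R _ 0) f0; apply/val_inj/funext => s /=.
apply/eqP; rewrite -normr_eq0 nrmE; apply/eqP; congr (_%:C).
by apply/eqP; rewrite eq_le nrm_ge0 andbT -f0 sup_norm_ub.
Qed.

HB.instance Definition _ := @Lmodule_isNormed.Build R[i] C0
  (fun f => (sup_norm f)%:C) C0_normD C0_normZ C0_norm0.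

Lemma C0_mul_subproof (f g : C0) : (fun s => f s * g s) \in C0_pred.
Proof.
apply/asboolP; split.
  by move=> s; apply: cvgM; exact: C0_continuous.
move=> e e0; have [K cK hK] := @C0_vanishes f e e0.
have [L cL hL] := @C0_vanishes g 1 ltr01.
exists (K `|` L); first exact: compactU.
move=> s /not_orP[/hK Kf /hL Lg]; rewrite nrmM -[e]mulr1.
by rewrite ltr_pM// nrm_ge0.
Qed.

Definition C0_mul (f g : C0) : C0 := MkC0 (C0_mul_subproof f g).

Lemma C0_conj_subproof (f : C0) : (fun s => (f s)^*) \in C0_pred.
Proof.
apply/asboolP; split.
  move=> s; apply: continuous_comp; first exact: C0_continuous.
  exact: continuous_conjc.
move=> e e0; have [K cK hK] := @C0_vanishes f e e0.
by exists K => // s /hK; rewrite nrm_conjc.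
Qed.

Definition C0_conj (f : C0) : C0 := MkC0 (C0_conj_subproof f).

End continuous_functions_vanishing_at_infinity.

Section smooth_functions.
Context (R : realType) (E : normedModType R) (W : normedModType R[i]).
Implicit Types (f : E -> W) (v x : E).

(* The library's [derive] needs domain and codomain over the same field; here
   the domain is real and the codomain complex. *)
Definition rquot f v x (t : R) : W := (t^-1)%:C *: (f (x + t *: v) - f x).

Definition rderivable f v x := cvg (rquot f v x @ (0 : R)^').

Definition rderive v f x : W := lim (rquot f v x @ (0 : R)^').

(* C^k for finite-dimensional [E]: all iterated directional derivatives up to
   order [k] exist and are continuous. *)
Fixpoint class_C k f : Prop :=
  continuous f /\
  if k is k'.+1 then
    forall v, (forall x, rderivable f v x) /\ class_C k' (rderive v f)
  else True.

Definition smooth f := forall k, class_C k f.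

Definition schwartz f :=
  smooth f /\
  forall (vs : seq E) (N : nat), exists M : R, forall x,
    (1 + `|x|) ^+ N * nrm (foldr rderive f vs x) <= M.

End smooth_functions.

Section bochner_integral.
Context d (T : measurableType d) (R : realType) (W : normedModType R[i])
  (mu : {measure set T -> \bar R}).
Implicit Types (F s : T -> W).

Definition bochner_simple s :=
  finite_set (range s) /\
  forall w, measurable (s @^-1` [set w]) /\
            (w != 0 -> (mu (s @^-1` [set w]) < +oo)%E).

Definition simple_integral s : W :=
  \sum_(w \in range s) (fine (mu (s @^-1` [set w])))%:C *: w.

Definition strongly_measurable F :=
  exists s : nat -> T -> W, (forall k, bochner_simple (s k)) /\
    {ae mu, forall x, s k x @[k --> \oo] --> F x}.

Definition is_bochner F (a : W) :=
  exists s : nat -> T -> W,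
    [/\ forall k, bochner_simple (s k),
        {ae mu, forall x, s k x @[k --> \oo] --> F x},
        (\int[mu]_x (nrm (F x - s k x))%:E)%E @[k --> \oo] --> 0%E &
        simple_integral (s k) @[k --> \oo] --> a].

Definition bochner F : W := xget 0 [set a | is_bochner F a].

Definition L1 F :=
  strongly_measurable F /\ (\int[mu]_x (nrm (F x))%:E < +oo)%E.

End bochner_integral.

(* [l] is the oscillatory integral of [K], for the integration functional [I]:
   the limit under every Schwartz regularization. *)
Definition is_oscillatory (R : realType) (E : normedModType R)
    (W : normedModType R[i]) (I : (E -> W) -> W) (K : E -> W) (l : W) :=
  forall chi : E -> R[i], schwartz chi -> chi 0 = 1 ->
    I (fun z => chi (e *: z) *: K z) @[e --> (0 : R)^'+] --> l.

Section hilbert_space_L2.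
Context (R : realType).

Section L2.
Context d (T : measurableType d) (mu : {measure set T -> \bar R}).
Implicit Types f g : T -> R[i].

Definition L2 f :=
  [/\ measurable_fun setT (fun x => complex.Re (f x)),
      measurable_fun setT (fun x => complex.Im (f x)) &
      (\int[mu]_x (nrm (f x) ^+ 2)%:E < +oo)%E].

Definition L2norm f : R := Num.sqrt (Rintegral mu setT (fun x => nrm (f x) ^+ 2)).

Definition L2dot f g : R[i] := cintegral mu (fun x => conjc (f x) * g x).

End L2.

(* An element of L2 is represented by a function, operators act on functions,
   and equality of vectors is equality almost everywhere. *)
Record bounded_linear d1 d2 (T1 : measurableType d1) (T2 : measurableType d2)
    (mu1 : {measure set T1 -> \bar R}) (mu2 : {measure set T2 -> \bar R})
    (S : (T1 -> R[i]) -> (T2 -> R[i])) : Prop := BoundedLinear {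
  bounded_linear_L2 : forall u, L2 mu1 u -> L2 mu2 (S u) ;
  bounded_linear_ae : forall u u', L2 mu1 u -> L2 mu1 u' ->
    u = u' %[ae mu1] -> S u = S u' %[ae mu2] ;
  bounded_linear_linear : forall a u u', L2 mu1 u -> L2 mu1 u' ->
    S (fun x => a * u x + u' x) = (fun y => a * S u y + S u' y) %[ae mu2] ;
  bounded_linear_bounded : exists M : R, forall u, L2 mu1 u ->
    L2norm mu2 (S u) <= M * L2norm mu1 u
}.

(* A bounded operator bundled with its (unique) adjoint. *)
Record L2op d1 d2 (T1 : measurableType d1) (T2 : measurableType d2)
    (mu1 : {measure set T1 -> \bar R}) (mu2 : {measure set T2 -> \bar R}) :=
  MkL2op {
  op_fun :> (T1 -> R[i]) -> (T2 -> R[i]) ;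
  op_adj : (T2 -> R[i]) -> (T1 -> R[i]) ;
  op_funP : bounded_linear mu1 mu2 op_fun ;
  op_adjP : bounded_linear mu2 mu1 op_adj ;
  op_adjE : forall u w, L2 mu1 u -> L2 mu2 w ->
    L2dot mu2 w (op_fun u) = L2dot mu1 (op_adj w) u
}.

Definition op_eq d1 d2 (T1 : measurableType d1) (T2 : measurableType d2)
    (mu1 : {measure set T1 -> \bar R}) (mu2 : {measure set T2 -> \bar R})
    (A B : L2op mu1 mu2) :=
  forall u, L2 mu1 u -> A u = B u %[ae mu2].

Lemma L2_linear d (T : measurableType d) (mu : {measure set T -> \bar R})
    (a : R[i]) (u w : T -> R[i]) :
  L2 mu u -> L2 mu w -> L2 mu (fun x => a * u x + w x).
Proof.
have nE (z : R[i]) : nrm z ^+ 2 = complex.Re z ^+ 2 + complex.Im z ^+ 2.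
  by apply: complexI; rewrite rmorphXn/= -nrmE add_Re2_Im2.
have mn (f : T -> R[i]) : L2 mu f -> measurable_fun setT (fun x => nrm (f x) ^+ 2).
  move=> [mr mi _]; under eq_fun do rewrite nE.
  by apply: measurable_funD; exact: measurable_funX.
move=> Lu Lw; have [mru miu iu] := Lu; have [mrw miw iw] := Lw.
have ReE (b z y : R[i]) : complex.Re (b * z + y) =
    complex.Re b * complex.Re z - complex.Im b * complex.Im z + complex.Re y.
  by case: b z y => [? ?] [? ?] [? ?].
have ImE (b z y : R[i]) : complex.Im (b * z + y) =
    complex.Re b * complex.Im z + complex.Im b * complex.Re z + complex.Im y.
  by case: b z y => [? ?] [? ?] [? ?].
have mre : measurable_fun setT (fun x => complex.Re (a * u x + w x)).
  rewrite (_ : (fun _ => _) = fun x => complex.Re a * complex.Re (u x) -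
      complex.Im a * complex.Im (u x) + complex.Re (w x)).
    apply: measurable_funD => //; apply: measurable_funB;
      by apply: measurable_funM => //; exact: measurable_cst.
  by apply/funext => x; rewrite ReE.
have mim : measurable_fun setT (fun x => complex.Im (a * u x + w x)).
  rewrite (_ : (fun _ => _) = fun x => complex.Re a * complex.Im (u x) +
      complex.Im a * complex.Re (u x) + complex.Im (w x)).
    apply: measurable_funD => //; apply: measurable_funD;
      by apply: measurable_funM => //; exact: measurable_cst.
  by apply/funext => x; rewrite ImE.
split=> //.
pose c : R := 2 * nrm a ^+ 2.
have c0 : 0 <= c by rewrite mulr_ge0// sqr_ge0.
have le_sum x : ((nrm (a * u x + w x) ^+ 2)%:E <=
    c%:E * (nrm (u x) ^+ 2)%:E + 2%:E * (nrm (w x) ^+ 2)%:E)%E.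
  rewrite -!EFinM -EFinD lee_fin /c.
  have := nrmD (a * u x) (w x); rewrite nrmM => h.
  apply: (@le_trans _ _ ((nrm a * nrm (u x) + nrm (w x)) ^+ 2)).
    by rewrite lerXn2r// nnegrE ?addr_ge0 ?mulr_ge0 ?nrm_ge0.
  have := sqr_ge0 (nrm a * nrm (u x) - nrm (w x)); lra.
have mE (f : T -> R[i]) (b : R) : L2 mu f ->
    measurable_fun setT (fun x => b%:E * (nrm (f x) ^+ 2)%:E)%E.
  by move=> Lf; apply: measurable_funeM; apply/measurable_EFinP; exact: mn.
apply: (@le_lt_trans _ _ (\int[mu]_x (c%:E * (nrm (u x) ^+ 2)%:E +
    2%:E * (nrm (w x) ^+ 2)%:E))%E).
  apply: ge0_le_integral => //.
  - by move=> x _; rewrite lee_fin sqr_ge0.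
  - apply/measurable_EFinP; under eq_fun do rewrite nE.
    by apply: measurable_funD; exact: measurable_funX.
  - by apply: emeasurable_funD; exact: mE.
have ge0 (b : R) (f : T -> R[i]) x : 0 <= b ->
    (0 <= b%:E * (nrm (f x) ^+ 2)%:E)%E.
  by move=> b0; rewrite -EFinM lee_fin mulr_ge0// sqr_ge0.
rewrite ge0_integralD//; [|by move=> x _; exact: ge0|exact: mE|
  by move=> x _; exact: ge0|exact: mE].
rewrite !ge0_integralZl//; try by [move=> x _; rewrite lee_fin sqr_ge0|
  apply/measurable_EFinP; exact: mn|rewrite lee_fin].
by rewrite lte_add_pinfty// lte_mul_pinfty ?lee_fin.
Qed.

Section composition.
Context d1 d2 d3 (T1 : measurableType d1) (T2 : measurableType d2)
  (T3 : measurableType d3) (mu1 : {measure set T1 -> \bar R})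
  (mu2 : {measure set T2 -> \bar R}) (mu3 : {measure set T3 -> \bar R}).

Lemma bounded_linear_comp S S' :
  bounded_linear mu2 mu3 S -> bounded_linear mu1 mu2 S' ->
  bounded_linear mu1 mu3 (S \o S').
Proof.
move=> [SL Sae Slin [M SM]] [S'L S'ae S'lin [M' S'M]].
split => [u /S'L/SL//|u u' Lu Lu' uu'|a u u' Lu Lu'|].
- by apply: Sae; [exact: S'L|exact: S'L|exact: S'ae].
- have S1 := Slin a _ _ (S'L _ Lu) (S'L _ Lu').
  apply: ae_eq_trans S1; apply: Sae; last exact: S'lin.
  + exact/S'L/L2_linear.
  + by apply: L2_linear; exact: S'L.
- exists (`|M| * M') => u Lu /=; apply: le_trans (SM _ (S'L _ Lu)) _.
  apply: (@le_trans _ _ (`|M| * L2norm mu2 (S' u))).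
    by rewrite ler_wpM2r ?ler_norm// sqrtr_ge0.
  by rewrite -mulrA ler_wpM2l// S'M.
Qed.

End composition.

Section operator_composition.
Context d1 d2 d3 (T1 : measurableType d1) (T2 : measurableType d2)
  (T3 : measurableType d3) (mu1 : {measure set T1 -> \bar R})
  (mu2 : {measure set T2 -> \bar R}) (mu3 : {measure set T3 -> \bar R}).

Lemma op_comp_adjE (A : L2op mu2 mu3) (B : L2op mu1 mu2) u w :
  L2 mu1 u -> L2 mu3 w ->
  L2dot mu3 w (A (B u)) = L2dot mu1 (op_adj B (op_adj A w)) u.
Proof.
move=> Lu Lw; rewrite (op_adjE A)//; last exact: (bounded_linear_L2 (op_funP B)).
rewrite (op_adjE B)//; exact: (bounded_linear_L2 (op_adjP A)).
Qed.

Definition op_comp (A : L2op mu2 mu3) (B : L2op mu1 mu2) : L2op mu1 mu3 :=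
  MkL2op (bounded_linear_comp (op_funP A) (op_funP B))
         (bounded_linear_comp (op_adjP B) (op_adjP A)) (@op_comp_adjE A B).

End operator_composition.

Lemma L2dotC d (T : measurableType d) (mu : {measure set T -> \bar R})
    (f g : T -> R[i]) : L2dot mu f g = conjc (L2dot mu g f).
Proof.
have RN (h : T -> R) :
    Rintegral mu setT (fun x => - h x) = - Rintegral mu setT h.
  rewrite /Rintegral.
  rewrite (_ : (fun x => (- h x)%:E) = (\- (EFin \o h))%E); last exact/funext.
  rewrite [in LHS]integralE [in RHS]integralE funeposN funenegN.
  have : (0 <= \int[mu]_x ((EFin \o h)^\+ x))%E by exact: integral_ge0.
  have : (0 <= \int[mu]_x ((EFin \o h)^\- x))%E by exact: integral_ge0.
  case: (integral _ _ _) => [p| |]; case: (integral _ _ _) => [q| |]//= _ _;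
    by rewrite ?oppr0// opprB.
rewrite /L2dot /cintegral /= -RN; congr (_ +i* _); congr Rintegral;
  by apply/funext => x; case: (f x) (g x) => [? ?] [? ?]/=; ring.
Qed.

Section adjoint.
Context d1 d2 (T1 : measurableType d1) (T2 : measurableType d2)
  (mu1 : {measure set T1 -> \bar R}) (mu2 : {measure set T2 -> \bar R}).

Lemma op_star_adjE (A : L2op mu1 mu2) u w : L2 mu2 u -> L2 mu1 w ->
  L2dot mu1 w (op_adj A u) = L2dot mu2 (A w) u.
Proof.
by move=> Lu Lw; rewrite L2dotC -op_adjE// [in RHS]L2dotC.
Qed.

Definition op_star (A : L2op mu1 mu2) : L2op mu2 mu1 :=
  MkL2op (op_adjP A) (op_funP A) (@op_star_adjE A).

End adjoint.
End hilbert_space_L2.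

(* Points (x, xi) of phase space; the dual of R^n is identified with R^n by the
   standard pairing [dotp]. *)
Notation phase R n := ('rV[R]_n * 'rV[R]_n)%type.

Section phase_space.
Context (R : realType) (n : nat).
Implicit Types X Y : phase R n.

Definition dotp (x xi : 'rV[R]_n) : R := \sum_i x ord0 i * xi ord0 i.

Definition sympl X Y : R := dotp X.1 Y.2 - dotp Y.1 X.2.

Definition kappa X Y : R[i] := cis (- (sympl X Y / 2)).

Definition dx : {sigma_finite_measure set 'rV[R]_n -> \bar R} := lebesgue_rV R n.

Lemma two_pi_expN_ge0 : 0 <= ((2 * pi) ^- n : R).
Proof. by rewrite invr_ge0 exprn_ge0// mulr_ge0// pi_ge0. Qed.

Definition dxi : set 'rV[R]_n -> \bar R := mscale (NngNum two_pi_expN_ge0) dx.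

HB.instance Definition _ :=
  Measure.copy dxi (mscale (NngNum two_pi_expN_ge0) dx).

Let dxi_sigma_finite : sigma_finite setT dxi.
Proof.
have [F TF mF] := sigma_finiteT dx; exists F => // k; have [mFk Fk] := mF k.
by split=> //; rewrite /dxi /mscale lte_mul_pinfty// ?ltry.
Qed.

HB.instance Definition _ :=
  @Measure_isSigmaFinite.Build _ _ _ dxi dxi_sigma_finite.

Definition dX : {sigma_finite_measure set (phase R n) -> \bar R} :=
  prod_measure dx dxi.

Definition dXdX :
    {sigma_finite_measure set (phase R n * phase R n)%type -> \bar R} :=
  prod_measure dX dX.

End phase_space.
Arguments dx {R n}.
Arguments dxi {R n}.
Arguments dX {R n}.
Arguments dXdX {R n}.

Record phase_action (R : realType) (n : nat) (Sigma : topologicalType) :=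
  PhaseAction {
  act :> phase R n -> Sigma -> Sigma ;
  act0 : forall s, act 0 s = s ;
  actD : forall X Y s, act (X + Y) s = act X (act Y s) ;
  act_continuous : forall X, continuous (act X)
}.

Section action_on_C0.
Context (R : realType) (n : nat) (Sigma : topologicalType)
  (Theta : phase_action R n Sigma).

Lemma translate_subproof X (f : C0 R Sigma) :
  (fun s => f (Theta X s)) \in @C0_pred R Sigma.
Proof.
apply/asboolP; split.
  move=> s; apply: continuous_comp; first exact: act_continuous.
  exact: C0_continuous.
move=> e e0; have [K cK hK] := @C0_vanishes _ _ f e e0.
exists (Theta (- X) @` K).
  apply: continuous_compact => //; apply: continuous_subspaceT.
  exact: act_continuous.
move=> s Ks; apply: hK => KXs; apply: Ks; exists (Theta X s) => //.
by rewrite -actD addNr act0.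
Qed.

Definition translate X (f : C0 R Sigma) : C0 R Sigma :=
  MkC0 (translate_subproof X f).

Definition strongly_continuous :=
  forall f : C0 R Sigma, continuous (fun X => translate X f).

Definition smooth_vector (f : C0 R Sigma) :=
  smooth (fun X : phase R n => translate X f).

End action_on_C0.

(* C*-algebras, not assumed to be unital. *)
Record cstar_algebra (R : realType) := CStarAlgebra {
  cs_space :> completeNormedModType R[i] ;
  cs_mul : cs_space -> cs_space -> cs_space ;
  cs_star : cs_space -> cs_space ;
  cs_mulA : associative cs_mul ;
  cs_mulDl : forall a b c, cs_mul (a + b) c = cs_mul a c + cs_mul b c ;
  cs_mulDr : forall a b c, cs_mul a (b + c) = cs_mul a b + cs_mul a c ;
  cs_mulZl : forall (z : R[i]) a b, cs_mul (z *: a) b = z *: cs_mul a b ;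
  cs_mulZr : forall (z : R[i]) a b, cs_mul a (z *: b) = z *: cs_mul a b ;
  cs_starD : forall a b, cs_star (a + b) = cs_star a + cs_star b ;
  cs_starZ : forall (z : R[i]) a, cs_star (z *: a) = conjc z *: cs_star a ;
  cs_starM : forall a b, cs_star (cs_mul a b) = cs_mul (cs_star b) (cs_star a) ;
  cs_starK : involutive cs_star ;
  cs_normM : forall a b, `|cs_mul a b| <= `|a| * `|b| ;
  cs_normE : forall a, `|cs_mul (cs_star a) a| = `|a| ^+ 2
}.

Record star_morphism (R : realType) (B D : cstar_algebra R) (psi : B -> D) :
    Prop := StarMorphism {
  star_morphism_linear : forall (z : R[i]) a b,
    psi (z *: a + b) = z *: psi a + psi b ;
  star_morphism_mul : forall a b, psi (cs_mul a b) = cs_mul (psi a) (psi b) ;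
  star_morphism_star : forall a, psi (cs_star a) = cs_star (psi a)
}.

Section rieffel_quantization.
Context (R : realType) (n : nat) (Sigma : topologicalType)
  (Theta : phase_action R n Sigma).
Let A := C0 R Sigma.

Definition is_rieffel_mul (f g h : A) :=
  exists2 l, is_oscillatory (bochner dXdX)
      (fun YZ : phase R n * phase R n => cis (2 * sympl YZ.1 YZ.2) *:
        C0_mul (translate Theta YZ.1 f) (translate Theta YZ.2 g)) l &
    h = (2 ^+ (2 * n) : R)%:C *: l.

Definition rieffel_left (f : A) (G : phase R n -> A) (X : phase R n) : A :=
  (2 ^+ (2 * n) : R)%:C *: bochner dX (fun Y =>
    C0_mul (translate Theta (X + Y) f)
      (bochner dX (fun Z => cis (2 * sympl Y Z) *: G (X + Z)))).

Definition schwartz_norm (G : phase R n -> A) : R :=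
  Num.sqrt (nrm (bochner dX (fun X => C0_mul (C0_conj (G X)) (G X)))).

Definition rieffel_norm (f : A) : \bar R :=
  ereal_sup [set (schwartz_norm (rieffel_left f G))%:E |
    G in [set G | schwartz G /\ schwartz_norm G <= 1]].

(* The C*-algebra [Q] is the completion of the smooth vectors, for Rieffel's
   product, involution and norm; only the values of [iota] on smooth vectors
   matter. *)
Record is_rieffel_quantization (Q : cstar_algebra R) (iota : A -> Q) : Prop :=
  IsRieffelQuantization {
  rieffel_linear : forall (z : R[i]) f g,
    smooth_vector Theta f -> smooth_vector Theta g ->
    iota (z *: f + g) = z *: iota f + iota g ;
  rieffel_product : forall f g, smooth_vector Theta f -> smooth_vector Theta g ->
    exists h, [/\ smooth_vector Theta h, is_rieffel_mul f g h &
      cs_mul (iota f) (iota g) = iota h] ;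
  rieffel_star : forall f, smooth_vector Theta f ->
    iota (C0_conj f) = cs_star (iota f) ;
  rieffel_isometry : forall f, smooth_vector Theta f ->
    (nrm (iota f))%:E = rieffel_norm f ;
  rieffel_dense : closure (iota @` smooth_vector Theta) = setT
}.

End rieffel_quantization.

Section twisted_crossed_product.
Context (R : realType) (n : nat) (Sigma : topologicalType)
  (Theta : phase_action R n Sigma).
Let A := C0 R Sigma.
Implicit Types F G : phase R n -> A.

Definition twisted_mul F G (X : phase R n) : A :=
  bochner dX (fun Y => kappa X Y *:
    C0_mul (translate Theta (2^-1 *: (Y - X)) (F Y))
           (translate Theta (2^-1 *: Y) (G (X - Y)))).

Definition twisted_star F (X : phase R n) : A := C0_conj (F (- X)).

(* *-morphisms out of the Banach *-algebra L1, whose elements are represented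
   by functions. *)
Record L1_morphism (D : cstar_algebra R) (phi : (phase R n -> A) -> D) : Prop :=
  L1Morphism {
  L1_morphism_ae : forall F G, L1 dX F -> L1 dX G ->
    F = G %[ae dX] -> phi F = phi G ;
  L1_morphism_linear : forall (z : R[i]) F G, L1 dX F -> L1 dX G ->
    phi (fun X => z *: F X + G X) = z *: phi F + phi G ;
  L1_morphism_mul : forall F G, L1 dX F -> L1 dX G ->
    phi (twisted_mul F G) = cs_mul (phi F) (phi G) ;
  L1_morphism_star : forall F, L1 dX F ->
    phi (twisted_star F) = cs_star (phi F)
}.

(* The enveloping C*-algebra of L1, by its universal property. *)
Record is_crossed_product (B : cstar_algebra R)
    (j : (phase R n -> A) -> B) : Prop := IsCrossedProduct {
  crossed_product_morphism : L1_morphism j ;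
  crossed_product_dense : closure (j @` [set F | L1 dX F]) = setT ;
  crossed_product_universal : forall (D : cstar_algebra R) phi,
    @L1_morphism D phi ->
    exists2 psi : B -> D, star_morphism psi &
      forall F, L1 dX F -> psi (j F) = phi F
}.

(* [M] is the extension to the quantization of the map [M_h], which sends smooth
   vectors to L1. *)
Definition extends_window (h : phase R n -> R[i]) (Q B : cstar_algebra R)
    (iota : A -> Q) (j : (phase R n -> A) -> B) (M : Q -> B) :=
  continuous M /\
  forall f, smooth_vector Theta f ->
    exists F, [/\ L1 dX F,
      forall X, is_bochner dX
        (fun Y => (cis (- sympl X Y) * h Y) *: translate Theta Y f) (F X) &
      M (iota f) = j F].

End twisted_crossed_product.

Section operators.
Context (R : realType).

(* Continuity for the operator norm. *)
Definition op_continuous (B : normedModType R[i]) d1 d2 (T1 : measurableType d1)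
    (T2 : measurableType d2) (mu1 : {measure set T1 -> \bar R})
    (mu2 : {measure set T2 -> \bar R}) (rho : B -> L2op mu1 mu2) :=
  forall (b : B) (e : R), 0 < e -> \forall b' \near b, forall u, L2 mu1 u ->
    L2norm mu2 (fun x => rho b' u x - rho b u x) <= e * L2norm mu1 u.

Context (n : nat).

Section integrated_form.
Context (Sigma : topologicalType) (Theta : phase_action R n Sigma).

Definition r_rep (s : Sigma) (g : C0 R Sigma) (Phi : phase R n -> R[i])
    (X : phase R n) : R[i] := g (Theta X s) * Phi X.

Definition T_rep (Y : phase R n) (Phi : phase R n -> R[i]) (X : phase R n) :
  R[i] := kappa Y X * Phi (X + Y).

(* The operator-valued integral is meant in the weak sense. *)
Definition is_integrated_form (s : Sigma) (B : cstar_algebra R)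
    (j : (phase R n -> C0 R Sigma) -> B)
    (rho : B -> L2op (@dX R n) (@dX R n)) :=
  op_continuous rho /\
  forall G Phi Psi, L1 dX G -> L2 dX Phi -> L2 dX Psi ->
    L2dot dX Psi (rho (j G) Phi) =
    cintegral dX (fun X => L2dot dX Psi
      (r_rep s (translate Theta (2^-1 *: X) (G X)) (T_rep X Phi))).

End integrated_form.

(* [S] is the Weyl operator of symbol [f]: the oscillatory integral determines it
   on Schwartz functions, which are dense. *)
Definition is_weyl (f : phase R n -> R[i]) (S : L2op (@dx R n) (@dx R n)) :=
  forall u : 'rV[R]_n -> R[i], schwartz u ->
    {ae dx, forall x, is_oscillatory (cintegral dX)
      (fun z : phase R n => cis (dotp (x - z.1) z.2) *
         f (2^-1 *: (x + z.1), z.2) * u z.1) (S u x)}.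

Definition extends_weyl (Sigma : topologicalType)
    (Theta : phase_action R n Sigma) (s : Sigma) (Q : cstar_algebra R)
    (iota : C0 R Sigma -> Q) (Op : Q -> L2op (@dx R n) (@dx R n)) :=
  op_continuous Op /\
  forall f, smooth_vector Theta f -> is_weyl (fun X => f (Theta X s)) (Op (iota f)).

Definition is_phase_translation
    (op : phase R n -> L2op (@dx R n) (@dx R n)) :=
  forall X, is_weyl (fun Y => cis (sympl X Y)) (op X).

Definition is_bargmann (op : phase R n -> L2op (@dx R n) (@dx R n))
    (v : 'rV[R]_n -> R[i]) (U : L2op (@dx R n) (@dX R n)) :=
  forall u, L2 dx u -> U u = (fun X => L2dot dx (op (- X) v) u) %[ae dX].

Definition op_conj (U : L2op (@dx R n) (@dX R n))
    (S : L2op (@dx R n) (@dx R n)) : L2op (@dX R n) (@dX R n) :=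
  op_comp U (op_comp S (op_star U)).

Definition wigner (v : 'rV[R]_n -> R[i]) (X : phase R n) : R[i] :=
  cintegral dx (fun y => cis (dotp y X.2) *
    conjc (v (X.1 + 2^-1 *: y)) * v (X.1 - 2^-1 *: y)).

End operators.

(* Main.v *)
(* Let v(Z) = op(-Z) v, let h be the Wigner function of v and g = f o Theta_sigma
   for a smooth f. Both sides turn out to be the integral operator on L2(Xi) with
   kernel K(Z, W) = <v(Z), Op(g) v(W)>.

   On the Weyl side, <w, Op(g) u> is the integral of g against the cross Wigner
   function of w and u, and the cross Wigner function of v(Z), v(W) at
   Y + (Z + W) / 2 is kappa(W, Z) exp(- i [[W - Z, Y]]) h(Y). Hence
     K(Z, W) = kappa(W, Z) int exp(- i [[W - Z, Y]]) h(Y) g(Y + (Z + W) / 2) dY.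
   The pairing formula is obtained from the oscillatory integral by integrating by
   parts in the configuration variable, which makes the integrand absolutely
   integrable, and by Fourier inversion.

   On the crossed product side, evaluating the Bochner integral M_h(f)(X) at
   Theta_{X/2} Theta_Z sigma gives int exp(- i [[X, Y]]) h(Y) g(X / 2 + Z + Y) dY;
   Fubini in (X, Z) followed by the substitution W = Z + X yields the same kernel.

   The general element of the quantization is reached by density of the smooth
   vectors and norm continuity of both sides. *)

From HB Require Import structures.
Require Import Defs.
From mathcomp Require Import all_boot all_order all_algebra.
From mathcomp Require Import all_classical all_reals all_analysis.
From mathcomp Require Import measurable_realfun complex ring lra.
Set Implicit Arguments. Unset Strict Implicit. Unset Printing Implicit Defensive.
Import Order.TTheory GRing.Theory Num.Theory.
Import numFieldNormedType.Exports.
Local Open Scope classical_set_scope.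
Local Open Scope ring_scope.
Local Open Scope complex_scope.

(** * Complex-valued integrals *)

(** Three obstacles shape the proof. The symbol g is bounded together with all its derivatives but
    need not decay, so decay in the momentum is bought with 2n derivatives in the configuration
    variable. The resulting bounds must be uniform in the base point and in the regularization,
    hence the parametrized families of [amp]. The weight [wt], the product of the 1 / (1 + x_i^2),
    is chosen because it is integrable, dominates a power of 1 / (1 + |x|) and is, up to the factor
    2^n, the Fourier transform of the product of the exp(- |eta_i|): Fourier inversion and the decay
    estimates can share it. Finally, decay of the Wigner function is never established:
    integrability of the window times a translated symbol is read off from the Bochner integrals
    defining M_h(f), by evaluation at a point of Sigma. The operators are compared through matrix
    elements, against a second vector Psi, because the integrated form is only given in the weak
    sense. *)

Section complex_modulus.
Context (R : realType).
Implicit Types z w : R[i].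

Lemma Re_addE z w : complex.Re (z + w) = complex.Re z + complex.Re w.
Proof. by case: z w => [? ?] [? ?]. Qed.

Lemma Im_addE z w : complex.Im (z + w) = complex.Im z + complex.Im w.
Proof. by case: z w => [? ?] [? ?]. Qed.

Lemma Re_oppE z : complex.Re (- z) = - complex.Re z.
Proof. by case: z. Qed.

Lemma Im_oppE z : complex.Im (- z) = - complex.Im z.
Proof. by case: z. Qed.

Lemma Re_mulE z w :
  complex.Re (z * w) = complex.Re z * complex.Re w - complex.Im z * complex.Im w.
Proof. by case: z w => [? ?] [? ?]. Qed.

Lemma Im_mulE z w :
  complex.Im (z * w) = complex.Re z * complex.Im w + complex.Im z * complex.Re w.
Proof. by case: z w => [? ?] [? ?]. Qed.

Lemma Re_conjE z : complex.Re z^* = complex.Re z.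
Proof. by case: z. Qed.

Lemma Im_conjE z : complex.Im z^* = - complex.Im z.
Proof. by case: z. Qed.

Lemma complex_eq z w :
  complex.Re z = complex.Re w -> complex.Im z = complex.Im w -> z = w.
Proof. by case: z w => [a b] [c d] /= -> ->. Qed.

Lemma nrm_sqr z : nrm z ^+ 2 = complex.Re z ^+ 2 + complex.Im z ^+ 2.
Proof. by apply: complexI; rewrite rmorphXn/= -nrmE add_Re2_Im2. Qed.

Lemma Re_le_nrm z : `|complex.Re z| <= nrm z.
Proof.
rewrite -ler_sqr ?nnegrE ?nrm_ge0//.
by rewrite nrm_sqr -normrX ger0_norm ?sqr_ge0// lerDl sqr_ge0.
Qed.

Lemma Im_le_nrm z : `|complex.Im z| <= nrm z.
Proof.
rewrite -ler_sqr ?nnegrE ?nrm_ge0//.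
by rewrite nrm_sqr -normrX ger0_norm ?sqr_ge0// lerDr sqr_ge0.
Qed.

Lemma nrm_le_ReIm z : nrm z <= `|complex.Re z| + `|complex.Im z|.
Proof.
rewrite -ler_sqr ?nnegrE ?nrm_ge0// ?addr_ge0//.
rewrite nrm_sqr sqrrD -!normrX !(@ger0_norm _ (_ ^+ 2)) ?sqr_ge0//.
by rewrite -addrA [X in _ <= _ + X]addrC addrA lerDl mulrn_wge0// mulr_ge0.
Qed.

Lemma nrm0 : nrm (0 : R[i]) = 0. Proof. by rewrite /nrm normr0. Qed.

Lemma nrm_eq0 (W : normedModType R[i]) (w : W) : (nrm w == 0) = (w == 0).
Proof.
by rewrite -[RHS]normr_eq0 nrmE; apply/eqP/eqP => [->//|]; exact: (@complexI R _ 0).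
Qed.

Lemma nrmN (W : normedModType R[i]) (w : W) : nrm (- w) = nrm w.
Proof. by rewrite /nrm normrN. Qed.

Lemma nrm_real (r : R) : nrm (r%:C) = `|r|.
Proof.
by apply: (@pexpIrn _ 2) => //; rewrite ?nnegrE ?nrm_ge0// nrm_sqr/= -normrX
  expr0n/= addr0 ger0_norm ?sqr_ge0.
Qed.

Lemma nrm_cis (t : R) : nrm (cis t) = 1.
Proof.
by apply: (@pexpIrn _ 2) => //; rewrite ?nnegrE ?nrm_ge0// nrm_sqr/= cos2Dsin2 expr1n.
Qed.

Lemma cisD (s t : R) : cis (s + t) = cis s * cis t.
Proof. by apply: complex_eq; rewrite ?Re_mulE ?Im_mulE/= ?cosD ?sinD; ring. Qed.

Lemma cis0 : cis 0 = 1 :> R[i].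
Proof. by rewrite /cis cos0 sin0. Qed.

Lemma continuous_cis : continuous (@cis R).
Proof.
move=> t; apply/cvgrPdist_lt => e e0.
have er : e = (complex.Re e)%:C by rewrite RRe_real// gtr0_real.
have e0' : 0 < complex.Re e / 2 by rewrite divr_gt0// -ltcR -er.
near=> x; rewrite nrmE er ltcR.
apply: (le_lt_trans (nrm_le_ReIm _)).
rewrite Re_addE Im_addE Re_oppE Im_oppE/= [ltRHS]splitr ltrD//; near: x.
- have /cvgrPdist_lt := @continuous_cos R t; exact.
- have /cvgrPdist_lt := @continuous_sin R t; exact.
Unshelve. all: by end_near. Qed.

Lemma cvg_complex (T : Type) (F : set_system T) (FF : Filter F) (f : T -> R[i]) (l : R[i]) :
  complex.Re (f x) @[x --> F] --> complex.Re l ->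
  complex.Im (f x) @[x --> F] --> complex.Im l ->
  f x @[x --> F] --> l.
Proof.
move=> /cvgrPdist_lt fr /cvgrPdist_lt fi; apply/cvgrPdist_lt => e e0.
have er : e = (complex.Re e)%:C by rewrite RRe_real// gtr0_real.
have e0' : 0 < complex.Re e / 2 by rewrite divr_gt0// -ltcR -er.
near=> x; rewrite nrmE er ltcR.
apply: (le_lt_trans (nrm_le_ReIm _)).
rewrite Re_addE Im_addE Re_oppE Im_oppE/= [ltRHS]splitr ltrD//; near: x.
- exact: fr.
- exact: fi.
Unshelve. all: by end_near. Qed.

Lemma continuous_Re : continuous (@complex.Re R).
Proof.
move=> z A [e /= e0 sA]; exists e%:C; first by rewrite /= ltcR.
move=> w; rewrite /ball_/= => zw; apply: sA; rewrite /ball_/= -Re_oppE -Re_addE.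
by apply: (le_lt_trans (Re_le_nrm _)); rewrite -ltcR -nrmE.
Qed.

Lemma continuous_Im : continuous (@complex.Im R).
Proof.
move=> z A [e /= e0 sA]; exists e%:C; first by rewrite /= ltcR.
move=> w; rewrite /ball_/= => zw; apply: sA; rewrite /ball_/= -Im_oppE -Im_addE.
by apply: (le_lt_trans (Im_le_nrm _)); rewrite -ltcR -nrmE.
Qed.

Lemma cvg_Re (T : Type) (F : set_system T) (FF : Filter F) (f : T -> R[i]) (l : R[i]) :
  f x @[x --> F] --> l -> complex.Re (f x) @[x --> F] --> complex.Re l.
Proof. by move=> fl; apply: (cvg_comp _ _ fl); exact: continuous_Re. Qed.

Lemma cvg_Im (T : Type) (F : set_system T) (FF : Filter F) (f : T -> R[i]) (l : R[i]) :
  f x @[x --> F] --> l -> complex.Im (f x) @[x --> F] --> complex.Im l.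
Proof. by move=> fl; apply: (cvg_comp _ _ fl); exact: continuous_Im. Qed.

Lemma ccvgD (T : Type) (F : set_system T) (FF : Filter F) (f g : T -> R[i]) (a b : R[i]) :
  f x @[x --> F] --> a -> g x @[x --> F] --> b -> (f x + g x) @[x --> F] --> a + b.
Proof.
move=> fa gb; apply: cvg_complex.
  under eq_fun do rewrite Re_addE.
  by rewrite Re_addE; apply: cvgD; exact: cvg_Re.
under eq_fun do rewrite Im_addE.
by rewrite Im_addE; apply: cvgD; exact: cvg_Im.
Qed.

Lemma ccvgM (T : Type) (F : set_system T) (FF : Filter F) (f g : T -> R[i]) (a b : R[i]) :
  f x @[x --> F] --> a -> g x @[x --> F] --> b -> (f x * g x) @[x --> F] --> a * b.
Proof.
move=> fa gb; apply: cvg_complex.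
  under eq_fun do rewrite Re_mulE.
  rewrite Re_mulE; apply: cvgB; apply: cvgM;
    by [exact: cvg_Re fa|exact: cvg_Re gb|exact: cvg_Im fa|exact: cvg_Im gb].
under eq_fun do rewrite Im_mulE.
rewrite Im_mulE; apply: cvgD; apply: cvgM;
  by [exact: cvg_Re fa|exact: cvg_Re gb|exact: cvg_Im fa|exact: cvg_Im gb].
Qed.

Lemma ccvgMl (T : Type) (F : set_system T) (FF : Filter F) (c : R[i]) (g : T -> R[i])
    (b : R[i]) : g x @[x --> F] --> b -> (c * g x) @[x --> F] --> c * b.
Proof.
by move=> gb; exact: (@ccvgM T F FF (fun=> c) g c b (cvg_cst c) gb).
Qed.

Lemma ccontinuousD (T : topologicalType) (f g : T -> R[i]) :
  continuous f -> continuous g -> continuous (fun x => f x + g x).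
Proof. by move=> cf cg x; exact: (ccvgD _ (cf x) (cg x)). Qed.

Lemma ccontinuousM (T : topologicalType) (f g : T -> R[i]) :
  continuous f -> continuous g -> continuous (fun x => f x * g x).
Proof. by move=> cf cg x; exact: (ccvgM _ (cf x) (cg x)). Qed.

Lemma cvg_nrm (W : normedModType R[i]) (T : Type) (F : set_system T)
    (FF : Filter F) (f : T -> W) (l : W) :
  f x @[x --> F] --> l <-> nrm (f x - l) @[x --> F] --> 0.
Proof.
split=> [/cvgrPdist_lt fl|/cvgrPdist_lt fl]; apply/cvgrPdist_lt => e e0.
  near=> x; rewrite sub0r normrN ger0_norm ?nrm_ge0// -ltcR -nrmE distrC.
  by near: x; apply: fl; rewrite ltcR.
have er : e = (complex.Re e)%:C by rewrite RRe_real// gtr0_real.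
have e0' : 0 < complex.Re e by rewrite -ltcR -er.
near=> x; rewrite distrC nrmE er ltcR.
have : `|0 - nrm (f x - l)| < complex.Re e by near: x; exact: fl.
by rewrite sub0r normrN ger0_norm ?nrm_ge0.
Unshelve. all: by end_near. Qed.

End complex_modulus.

Section complex_measurable.
Context (R : realType) d (T : measurableType d).
Implicit Types f g : T -> R[i].

Definition cmeasurable f :=
  measurable_fun setT (fun x => complex.Re (f x)) /\
  measurable_fun setT (fun x => complex.Im (f x)).

Lemma cmeasurable_cst (c : R[i]) : cmeasurable (fun=> c).
Proof. by split; exact: measurable_cst. Qed.

Lemma cmeasurableD f g : cmeasurable f -> cmeasurable g ->
  cmeasurable (fun x => f x + g x).
Proof.
move=> [fr fi] [gr gi]; split; under eq_fun do rewrite ?Re_addE ?Im_addE;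
  exact: measurable_funD.
Qed.

Lemma cmeasurableN f : cmeasurable f -> cmeasurable (fun x => - f x).
Proof.
move=> [fr fi]; split; under eq_fun do rewrite ?Re_oppE ?Im_oppE;
  exact: measurableT_comp.
Qed.

Lemma cmeasurableM f g : cmeasurable f -> cmeasurable g ->
  cmeasurable (fun x => f x * g x).
Proof.
move=> [fr fi] [gr gi]; split; under eq_fun do rewrite ?Re_mulE ?Im_mulE.
  by apply: measurable_funB; exact: measurable_funM.
by apply: measurable_funD; exact: measurable_funM.
Qed.

Lemma cmeasurable_conj f : cmeasurable f -> cmeasurable (fun x => (f x)^*).
Proof.
move=> [fr fi]; split; under eq_fun do rewrite ?Re_conjE ?Im_conjE; first by [].
exact: measurableT_comp.
Qed.

Lemma cmeasurable_real (h : T -> R) : measurable_fun setT h ->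
  cmeasurable (fun x => (h x)%:C).
Proof. by move=> mh; split => //=; exact: measurable_cst. Qed.

Lemma cmeasurable_cis (h : T -> R) : measurable_fun setT h ->
  cmeasurable (fun x => cis (h x)).
Proof.
move=> mh; split => /=.
  by apply: (measurableT_comp _ mh); apply: continuous_measurable_fun; exact: continuous_cos.
by apply: (measurableT_comp _ mh); apply: continuous_measurable_fun; exact: continuous_sin.
Qed.

Lemma measurable_nrm f : cmeasurable f -> measurable_fun setT (fun x => nrm (f x)).
Proof.
move=> [fr fi].
rewrite (_ : (fun x => nrm (f x)) =
    (fun x => Num.sqrt (complex.Re (f x) ^+ 2 + complex.Im (f x) ^+ 2))).
  apply: (measurableT_comp (f := (Num.sqrt : R -> R))); last first.
    by apply: measurable_funD; exact: measurable_funX.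
  by apply: continuous_measurable_fun; exact: sqrt_continuous.
by apply/funext => x; rewrite -nrm_sqr sqrtr_sqr ger0_norm// nrm_ge0.
Qed.

Lemma cmeasurable_cvg (F : nat -> T -> R[i]) f : (forall k, cmeasurable (F k)) ->
  (forall x, F k x @[k --> \oo] --> f x) -> cmeasurable f.
Proof.
move=> mF Ff; split.
  apply: (measurable_fun_cvg (h := fun k x => complex.Re (F k x))) => [k|x _].
    exact: (mF k).1.
  exact: cvg_Re.
apply: (measurable_fun_cvg (h := fun k x => complex.Im (F k x))) => [k|x _].
  exact: (mF k).2.
exact: cvg_Im.
Qed.

End complex_measurable.

Lemma cmeasurable_comp (R : realType) d d' (T : measurableType d)
    (T' : measurableType d') (phi : T' -> T) (f : T -> R[i]) :
  measurable_fun setT phi -> cmeasurable f ->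
  cmeasurable (fun x => f (phi x)).
Proof. by move=> mphi [fr fi]; split; [exact: (measurableT_comp fr mphi)|
  exact: (measurableT_comp fi mphi)]. Qed.

Section complex_integral.
Context (R : realType) d (T : measurableType d) (mu : {measure set T -> \bar R}).
Implicit Types f g : T -> R[i].

Definition cintegrable f :=
  cmeasurable f /\ (\int[mu]_x (nrm (f x))%:E < +oo)%E.

Lemma integrable_nrm f : cintegrable f -> mu.-integrable setT (EFin \o (fun x => nrm (f x))).
Proof.
move=> [mf foo]; apply/integrableP; split.
  by apply/measurable_EFinP; exact: measurable_nrm.
by under eq_integral do rewrite /= ger0_norm ?nrm_ge0//.
Qed.

Lemma cintegrable_le f (g : T -> R) : cmeasurable f ->
  mu.-integrable setT (EFin \o g) -> (forall x, nrm (f x) <= g x) -> cintegrable f.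
Proof.
move=> mf /integrableP[mg goo] fg; split => //; apply: le_lt_trans goo.
apply: ge0_le_integral => //=.
- by move=> x _; rewrite lee_fin nrm_ge0.
- by apply/measurable_EFinP; exact: measurable_nrm.
- by apply/measurable_EFinP; apply: measurableT_comp => //; exact/measurable_EFinP.
- by move=> x _; rewrite lee_fin; apply: (le_trans (fg x)); exact: ler_norm.
Qed.

Lemma cintegrable_Re f : cintegrable f ->
  mu.-integrable setT (EFin \o (fun x => complex.Re (f x))).
Proof.
move=> fi; apply: (le_integrable _ _ _ (integrable_nrm fi)) => //.
  by apply/measurable_EFinP; exact: fi.1.1.
by move=> x _ /=; rewrite lee_fin (ger0_norm (nrm_ge0 _)) Re_le_nrm.
Qed.

Lemma cintegrable_Im f : cintegrable f ->
  mu.-integrable setT (EFin \o (fun x => complex.Im (f x))).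
Proof.
move=> fi; apply: (le_integrable _ _ _ (integrable_nrm fi)) => //.
  by apply/measurable_EFinP; exact: fi.1.2.
by move=> x _ /=; rewrite lee_fin (ger0_norm (nrm_ge0 _)) Im_le_nrm.
Qed.

Lemma cintegrableD f g : cintegrable f -> cintegrable g ->
  cintegrable (fun x => f x + g x).
Proof.
move=> fi gi; apply: (@cintegrable_le _ (fun x => nrm (f x) + nrm (g x))).
- by apply: cmeasurableD; [exact: fi.1|exact: gi.1].
- by apply: (integrableD _ (integrable_nrm fi) (integrable_nrm gi)).
- by move=> x; exact: nrmD.
Qed.

Lemma cintegrableMb f g (C : R) : cintegrable f -> cmeasurable g ->
  (forall x, nrm (g x) <= C) -> cintegrable (fun x => g x * f x).
Proof.
move=> fi mg gC; apply: (@cintegrable_le _ (fun x => C * nrm (f x))).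
- by apply: cmeasurableM => //; exact: fi.1.
- by apply: (integrableZl _ _ (integrable_nrm fi)).
- by move=> x; rewrite nrmM ler_wpM2r// nrm_ge0.
Qed.

Lemma cintegrableZ (c : R[i]) f : cintegrable f -> cintegrable (fun x => c * f x).
Proof.
by move=> fi; apply: (@cintegrableMb _ _ (nrm c)) => //; exact: cmeasurable_cst.
Qed.

Lemma cintegrableN f : cintegrable f -> cintegrable (fun x => - f x).
Proof.
move=> /(cintegrableZ (-1)); congr cintegrable.
by apply/funext => x; rewrite mulN1r.
Qed.

Lemma cintegrableB f g : cintegrable f -> cintegrable g ->
  cintegrable (fun x => f x - g x).
Proof. by move=> fi gi; apply: cintegrableD => //; exact: cintegrableN. Qed.

Lemma cintegrable_conj f : cintegrable f -> cintegrable (fun x => (f x)^*).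
Proof.
move=> fi; apply: (@cintegrable_le _ (fun x => nrm (f x))).
- by apply: cmeasurable_conj; exact: fi.1.
- exact: integrable_nrm.
- by move=> x; rewrite nrm_conjc.
Qed.

Lemma cintegralD f g : cintegrable f -> cintegrable g ->
  cintegral mu (fun x => f x + g x) = cintegral mu f + cintegral mu g.
Proof.
move=> fi gi; apply: complex_eq; rewrite ?Re_addE ?Im_addE/=.
  under eq_Rintegral do rewrite Re_addE.
  by rewrite RintegralD//; exact: cintegrable_Re.
under eq_Rintegral do rewrite Im_addE.
by rewrite RintegralD//; exact: cintegrable_Im.
Qed.

Lemma cintegralZ (c : R[i]) f : cintegrable f ->
  cintegral mu (fun x => c * f x) = c * cintegral mu f.
Proof.
move=> fi; have rf := cintegrable_Re fi; have mf := cintegrable_Im fi.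
apply: complex_eq; rewrite ?Re_mulE ?Im_mulE/=.
  under eq_Rintegral do rewrite Re_mulE.
  rewrite RintegralB ?RintegralZl//.
  - exact: (integrableZl _ _ rf).
  - exact: (integrableZl _ _ mf).
under eq_Rintegral do rewrite Im_mulE.
rewrite RintegralD ?RintegralZl//.
- exact: (integrableZl _ _ mf).
- exact: (integrableZl _ _ rf).
Qed.

Lemma cintegralZr (c : R[i]) f : cintegrable f ->
  cintegral mu (fun x => f x * c) = cintegral mu f * c.
Proof.
by move=> fi; rewrite mulrC -cintegralZ//; congr cintegral; apply/funext => x; rewrite mulrC.
Qed.

Lemma cintegralN f : cintegrable f ->
  cintegral mu (fun x => - f x) = - cintegral mu f.
Proof.
move=> fi; rewrite -mulN1r -cintegralZ//; congr cintegral.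
by apply/funext => x; rewrite mulN1r.
Qed.

Lemma cintegralB f g : cintegrable f -> cintegrable g ->
  cintegral mu (fun x => f x - g x) = cintegral mu f - cintegral mu g.
Proof.
by move=> fi gi; rewrite cintegralD ?cintegralN//; exact: cintegrableN.
Qed.

Lemma cintegral_conj f : cintegrable f ->
  cintegral mu (fun x => (f x)^*) = (cintegral mu f)^*.
Proof.
move=> fi; apply: complex_eq; rewrite ?Re_conjE ?Im_conjE/=.
  by apply: eq_Rintegral => x _; rewrite Re_conjE.
under eq_Rintegral do rewrite Im_conjE -mulN1r.
by rewrite RintegralZl ?mulN1r//; exact: cintegrable_Im.
Qed.

Lemma cintegral_ae f g : cmeasurable f -> cmeasurable g ->
  f = g %[ae mu] -> cintegral mu f = cintegral mu g.
Proof.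
move=> [fr fi] [gr gi] fg; rewrite /cintegral; congr (_ +i* _); congr fine;
  apply: ae_eq_integral => //; try exact/measurable_EFinP;
  by apply: filterS fg => x /= -> .
Qed.

Lemma cintegrable_ae f g : cmeasurable g -> f = g %[ae mu] ->
  cintegrable f -> cintegrable g.
Proof.
move=> mg fg [mf foo]; split => //; rewrite (ae_eq_integral (fun x => (nrm (f x))%:E))//.
- by apply/measurable_EFinP; exact: measurable_nrm.
- by apply/measurable_EFinP; exact: measurable_nrm.
- by apply: filterS fg => x /= -> .
Qed.

(** The factor 2 comes from bounding real and imaginary parts separately; the later estimates
    tolerate any constant. *)
Lemma nrm_cintegral f : cintegrable f ->
  nrm (cintegral mu f) <= 2 * Rintegral mu setT (fun x => nrm (f x)).
Proof.
move=> fi; apply: (le_trans (nrm_le_ReIm _)) => /=; rewrite mulr_natl mulr2n lerD//.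
  apply: (le_trans (le_normr_Rintegral _ (cintegrable_Re fi))) => //.
  apply: le_Rintegral => //; [exact: (integrable_abse (cintegrable_Re fi))|
    exact: integrable_nrm|by move=> x _; exact: Re_le_nrm].
apply: (le_trans (le_normr_Rintegral _ (cintegrable_Im fi))) => //.
apply: le_Rintegral => //; [exact: (integrable_abse (cintegrable_Im fi))|
  exact: integrable_nrm|by move=> x _; exact: Im_le_nrm].
Qed.

Lemma nrm_cintegral_le f (g : T -> R) : cmeasurable f ->
  mu.-integrable setT (EFin \o g) -> (forall x, nrm (f x) <= g x) ->
  nrm (cintegral mu f) <= 2 * Rintegral mu setT g.
Proof.
move=> mf ig fg; have fi := cintegrable_le mf ig fg.
apply: (le_trans (nrm_cintegral fi)); rewrite ler_pM2l//.
by apply: le_Rintegral => //; exact: integrable_nrm.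
Qed.

Lemma cintegral_dominated (F : nat -> T -> R[i]) f (g : T -> R) :
  (forall k, cmeasurable (F k)) -> cmeasurable f ->
  (forall x, F k x @[k --> \oo] --> f x) ->
  mu.-integrable setT (EFin \o g) -> (forall k x, nrm (F k x) <= g x) ->
  cintegral mu (F k) @[k --> \oo] --> cintegral mu f.
Proof.
move=> mF mf Ff ig Fg; apply: cvg_complex => /=.
- have [|||||i1 _ cv] := @dominated_convergence _ T R mu setT measurableT
    (fun k x => (complex.Re (F k x))%:E) (fun x => (complex.Re (f x))%:E) (EFin \o g).
  + by move=> k; apply/measurable_EFinP; exact: (mF k).1.
  + by apply/measurable_EFinP; exact: mf.1.
  + by apply: aeW => x _; apply: cvg_EFin; [exact: nearW|exact: cvg_Re].
  + exact: ig.
  + apply: aeW => x n _ /=; rewrite lee_fin.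
    exact: le_trans (Re_le_nrm _) (Fg _ _).
  + apply: (fine_cvg (f := fun k => \int[mu]_x (complex.Re (F k x))%:E)%E).
    by rewrite /Rintegral fineK//; exact: integrable_fin_num.
- have [|||||i1 _ cv] := @dominated_convergence _ T R mu setT measurableT
    (fun k x => (complex.Im (F k x))%:E) (fun x => (complex.Im (f x))%:E) (EFin \o g).
  + by move=> k; apply/measurable_EFinP; exact: (mF k).2.
  + by apply/measurable_EFinP; exact: mf.2.
  + by apply: aeW => x _; apply: cvg_EFin; [exact: nearW|exact: cvg_Im].
  + exact: ig.
  + apply: aeW => x n _ /=; rewrite lee_fin.
    exact: le_trans (Im_le_nrm _) (Fg _ _).
  + apply: (fine_cvg (f := fun k => \int[mu]_x (complex.Im (F k x))%:E)%E).
    by rewrite /Rintegral fineK//; exact: integrable_fin_num.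
Qed.

End complex_integral.

(** * Fubini's theorem for complex integrands *)

Section complex_fubini.
Context (R : realType) d1 d2 (T1 : measurableType d1) (T2 : measurableType d2)
  (m1 : {sigma_finite_measure set T1 -> \bar R})
  (m2 : {sigma_finite_measure set T2 -> \bar R}).
Implicit Types f : T1 * T2 -> R[i].

Lemma cmeasurable_pair1 f x : cmeasurable f -> cmeasurable (fun y => f (x, y)).
Proof. exact: cmeasurable_comp. Qed.

Lemma cmeasurable_pair2 f y : cmeasurable f -> cmeasurable (fun x => f (x, y)).
Proof. exact: cmeasurable_comp. Qed.

(** Tonelli applies to the positive and negative parts separately, so sections with an infinite
    integral do no harm. *)
Lemma measurable_fun_integral_section (h : T1 * T2 -> R) : measurable_fun setT h ->
  measurable_fun setT (fun x => \int[m2]_y (h (x, y))%:E)%E.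
Proof.
move=> /measurable_EFinP mh.
rewrite (_ : (fun _ => _) = (fubini_F m2 (EFin \o h)^\+ \- fubini_F m2 (EFin \o h)^\-)%E).
  apply: emeasurable_funB; apply: measurable_fun_fubini_tonelli_F => //.
    exact: measurable_funepos.
  exact: measurable_funeneg.
apply/funext => x; rewrite integralE/= /fubini_F; congr (_ - _)%E; apply: eq_integral => y _.
  by rewrite funepos.unlock.
by rewrite funeneg.unlock.
Qed.

Lemma cmeasurable_cintegral f : cmeasurable f ->
  cmeasurable (fun x => cintegral m2 (fun y => f (x, y))).
Proof.
move=> [fr fi]; split => /=.
  apply: (measurableT_comp (f := fine)) => //.
  exact: (measurable_fun_integral_section fr).
apply: (measurableT_comp (f := fine)) => //.
exact: (measurable_fun_integral_section fi).
Qed.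

Lemma cintegrable_prod f : cmeasurable f ->
  (\int[m1]_x \int[m2]_y (nrm (f (x, y)))%:E < +oo)%E ->
  cintegrable (prod_measure m1 m2) f.
Proof.
move=> mf foo; split => //.
rewrite [ltLHS](fubini_tonelli1 (fun z => (nrm (f z))%:E))//.
  by apply/measurable_EFinP; exact: measurable_nrm.
by move=> z; rewrite lee_fin nrm_ge0.
Qed.

(** The inner complex integral is the [fine] of an extended-real one; the two agree only where the
    section integral is finite, that is, almost everywhere. *)
Lemma cfubini1 f : cintegrable (prod_measure m1 m2) f ->
  cintegral m1 (fun x => cintegral m2 (fun y => f (x, y))) =
  cintegral (prod_measure m1 m2) f.
Proof.
move=> fi; apply: complex_eq => /=.
- have ri : (m1 \x m2)%E.-integrable setT (EFin \o (fun x => complex.Re (f x))) :=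
    cintegrable_Re fi.
  congr fine; rewrite [RHS](_ : _ = \int[m1 \x m2]_z (complex.Re (f z))%:E)%E//.
  rewrite -integral12_prod_meas1//; apply: ae_eq_integral => //.
  + apply/measurable_EFinP; apply: (measurableT_comp (f := fine)) => //.
    exact: (measurable_fubini_F ri).
  + exact: (measurable_fubini_F ri).
  + have := integrable_ae _ (integrable_fubini_F ri).
    by move=> /(_ measurableT); apply: filterS => x /= /(_ I) h _; rewrite fineK.
- have ri : (m1 \x m2)%E.-integrable setT (EFin \o (fun x => complex.Im (f x))) :=
    cintegrable_Im fi.
  congr fine; rewrite [RHS](_ : _ = \int[m1 \x m2]_z (complex.Im (f z))%:E)%E//.
  rewrite -integral12_prod_meas1//; apply: ae_eq_integral => //.
  + apply/measurable_EFinP; apply: (measurableT_comp (f := fine)) => //.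
    exact: (measurable_fubini_F ri).
  + exact: (measurable_fubini_F ri).
  + have := integrable_ae _ (integrable_fubini_F ri).
    by move=> /(_ measurableT); apply: filterS => x /= /(_ I) h _; rewrite fineK.
Qed.

End complex_fubini.

Section complex_fubini_swap.
Context (R : realType) d1 d2 (T1 : measurableType d1) (T2 : measurableType d2)
  (m1 : {sigma_finite_measure set T1 -> \bar R})
  (m2 : {sigma_finite_measure set T2 -> \bar R}).
Implicit Types f : T1 * T2 -> R[i].

Lemma cintegrable_swap f : cintegrable (prod_measure m1 m2) f ->
  cintegrable (prod_measure m2 m1) (fun z => f (z.2, z.1)).
Proof.
move=> [mf foo]; have mf' : cmeasurable (fun z : T2 * T1 => f (z.2, z.1)).
  by apply: cmeasurable_comp mf; exact: measurable_swap.
apply: cintegrable_prod => //=.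
rewrite -(fubini_tonelli (fun z => (nrm (f z))%:E))//.
- rewrite -(fubini_tonelli1 (fun z => (nrm (f z))%:E))//.
  + by apply/measurable_EFinP; exact: measurable_nrm.
  + by move=> z; rewrite lee_fin nrm_ge0.
- by apply/measurable_EFinP; exact: measurable_nrm.
- by move=> z; rewrite lee_fin nrm_ge0.
Qed.

Lemma cfubini f : cintegrable (prod_measure m1 m2) f ->
  cintegral m1 (fun x => cintegral m2 (fun y => f (x, y))) =
  cintegral m2 (fun y => cintegral m1 (fun x => f (x, y))).
Proof.
move=> fi; rewrite cfubini1//.
have /= -> := cfubini1 (cintegrable_swap fi).
have ri := cintegrable_Re fi; have ii := cintegrable_Im fi.
have ri' := cintegrable_Re (cintegrable_swap fi).
have ii' := cintegrable_Im (cintegrable_swap fi).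
apply: complex_eq; rewrite /cintegral/= /Rintegral.
- transitivity (fine (\int[m1 \x m2]_z (complex.Re (f z))%:E)%E) => //.
  transitivity (fine (\int[m2 \x m1]_z (complex.Re (f (z.2, z.1)))%:E)%E) => //.
  by rewrite -integral12_prod_meas1// -[in RHS]integral21_prod_meas1.
- transitivity (fine (\int[m1 \x m2]_z (complex.Im (f z))%:E)%E) => //.
  transitivity (fine (\int[m2 \x m1]_z (complex.Im (f (z.2, z.1)))%:E)%E) => //.
  by rewrite -integral12_prod_meas1// -[in RHS]integral21_prod_meas1.
Qed.

Lemma cintegrable_section f : cintegrable (prod_measure m1 m2) f ->
  {ae m1, forall x, cintegrable m2 (fun y => f (x, y))}.
Proof.
move=> fi.
have := integrable_ae measurableT (integrable_fubini_F (integrable_nrm fi)).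
apply: filterS => x /= /(_ I) foo; split.
  by apply: cmeasurable_pair1; exact: fi.1.
by move: foo; rewrite /fubini_F/= ge0_fin_numE// integral_ge0// => y _;
  rewrite lee_fin nrm_ge0.
Qed.

End complex_fubini_swap.

(** * Affine changes of variables in Lebesgue integrals *)

Section lebesgue_rV_integral.
Context (R : realType).
Local Notation lam := (@lebesgue_measure R).

Lemma ge0_integral_lebesgue_rVS n (f : 'rV[R]_n.+1 -> \bar R) :
  measurable_fun setT f -> (forall x, (0 <= f x)%E) ->
  (\int[lebesgue_rV R n.+1]_x f x =
   \int[lam]_a \int[lebesgue_rV R n]_x f (rV_cons (a, x)))%E.
Proof.
move=> mf f0.
rewrite [LHS](_ : _ = \int[pushforward (prod_measure lam (lebesgue_rV R n)) (@rV_cons R n)]_x f x)%E//.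
rewrite ge0_integral_pushforward//; last exact: measurable_rV_cons.
rewrite preimage_setT.
rewrite [LHS](_ : _ = \int[lam \x lebesgue_rV R n]_z (f \o @rV_cons R n) z)%E//.
rewrite fubini_tonelli1//=.
by apply: (measurableT_comp mf); exact: measurable_rV_cons.
Qed.

Lemma ge0_integral_lebesgue_rV0 (f : 'rV[R]_0 -> \bar R) :
  measurable_fun setT f -> (forall x, (0 <= f x)%E) ->
  (\int[lebesgue_rV R 0]_x f x = f 0%R)%E.
Proof.
move=> mf f0; rewrite [LHS](_ : _ = \int[\d_(0%R : 'rV[R]_0)]_x f x)%E//.
by rewrite integral_dirac// diracT mul1e.
Qed.

(** The coordinate maps are indexed by [nat] rather than ['I_n], so that an induction on the
    dimension can pass to [t \o S]. *)
Definition rV_map n (t : nat -> R -> R) (x : 'rV[R]_n) : 'rV[R]_n :=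
  \row_i t i (x ord0 i).

Lemma measurable_rV_map n t : (forall i, measurable_fun setT (t i)) ->
  measurable_fun setT (@rV_map n t).
Proof.
move=> mt; apply: measurable_fun_rV => i.
rewrite (_ : _ \o _ = t i \o @rV_coord R n i).
  exact: (measurableT_comp (mt i) (measurable_rV_coord i)).
by apply/funext => x; rewrite /rV_coord /= mxE.
Qed.

Lemma rV_map_cons n t (a : R) (x : 'rV[R]_n) :
  rV_map t (rV_cons (a, x)) = rV_cons (t 0%N a, rV_map (t \o S) x).
Proof.
apply/rowP => i; rewrite !mxE; case: splitP => j ij; rewrite !mxE ij//.
by rewrite (ord1 j).
Qed.

(** Translations, dilations and reflections act coordinatewise, so iterating a one-dimensional
    change of variables replaces a general Jacobian formula. *)
Lemma ge0_integral_rV_map n (t : nat -> R -> R) (k : R) (f : 'rV[R]_n -> \bar R) :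
  0 <= k -> (forall i, measurable_fun setT (t i)) ->
  (forall i (h : R -> \bar R), measurable_fun setT h -> (forall r, (0 <= h r)%E) ->
    (\int[lam]_r h (t i r) = k%:E * \int[lam]_r h r)%E) ->
  measurable_fun setT f -> (forall x, (0 <= f x)%E) ->
  (\int[lebesgue_rV R n]_x f (rV_map t x) =
   (k ^+ n)%:E * \int[lebesgue_rV R n]_x f x)%E.
Proof.
move=> k0; elim: n t f => [|n IH] t f mt it mf f0.
  rewrite !ge0_integral_lebesgue_rV0//; last first.
    by apply: (measurableT_comp mf); exact: measurable_rV_map.
  by rewrite expr0 mul1e; congr f; apply/rowP => -[].
rewrite !ge0_integral_lebesgue_rVS//; last first.
  by apply: (measurableT_comp mf); exact: measurable_rV_map.
have mfc a : measurable_fun setT (fun x => f (rV_cons (a, x))).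
  apply: (measurableT_comp mf); apply: (measurableT_comp (@measurable_rV_cons R n)).
  exact: measurable_pair1.
have mF : measurable_fun setT (fun a => \int[lebesgue_rV R n]_x f (rV_cons (a, x)))%E.
  apply: (measurable_fun_fubini_tonelli_F (f \o @rV_cons R n)) => //=.
  by apply: (measurableT_comp mf); exact: measurable_rV_cons.
under eq_integral => a _.
  under eq_integral do rewrite rV_map_cons.
  rewrite (IH (t \o S) (fun x => f (rV_cons (t 0%N a, x))))//=; last first.
    by move=> i; exact: it.
  over.
rewrite ge0_integralZl; first last.
- by rewrite lee_fin exprn_ge0.
- by move=> a _; exact: integral_ge0.
- exact: (measurableT_comp mF (mt 0%N)).
- by [].
- rewrite (it 0%N (fun a => \int[lebesgue_rV R n]_x f (rV_cons (a, x))))%E//.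
    by rewrite muleA -EFinM exprSr.
  by move=> r; exact: integral_ge0.
Qed.

Lemma ge0_integral_lebesgue_pushforward (t : R -> R) (k : R) :
  0 <= k -> measurable_fun setT t ->
  (forall A, measurable A -> (lam (t @^-1` A) = k%:E * lam A)%E) ->
  forall h : R -> \bar R, measurable_fun setT h -> (forall r, (0 <= h r)%E) ->
  (\int[lam]_r h (t r) = k%:E * \int[lam]_r h r)%E.
Proof.
move=> k0 mt tA h mh h0.
have -> : (\int[lam]_r h (t r) = \int[pushforward lam (t : R -> measurableTypeR R)]_r h r)%E.
  by rewrite ge0_integral_pushforward// preimage_setT.
rewrite -(@ge0_integral_mscale _ _ R lam _ measurableT (NngNum k0))//.
by apply: eq_measure_integral => A mA _; exact: tA.
Qed.

(** The image measure multiplied by [c] agrees with Lebesgue measure on half-open intervals, and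
    uniqueness of Lebesgue measure concludes. *)
Lemma lebesgue_measure_affine (a c : R) (A : set R) : 0 < c -> measurable A ->
  (lam ((fun r : R => a + c * r)%R @^-1` A) = c^-1%:E * lam A)%E.
Proof.
move=> c0 mA.
have mt : measurable_fun setT ((fun r => a + c * r) : R -> measurableTypeR R).
  apply: measurable_funD; first exact: measurable_cst.
  by apply: measurable_funM => //; exact: measurable_cst.
have H := @lebesgue_measure_unique R
  (mscale (NngNum (ltW c0)) (pushforward lam ((fun r => a + c * r) : R -> measurableTypeR R))).
rewrite [in RHS]H//.
  by rewrite /mscale/= /pushforward muleA -EFinM mulVf ?gt_eqF// mul1e.
move=> _ [[x y] _ <-].
change (lam `]x, y]%classic = (c%:E * lam ((fun r : R => a + c * r)%R @^-1` `]x, y]%classic)))%E.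
rewrite (_ : _ @^-1` _ = `](x - a) / c, (y - a) / c]%classic); last first.
  apply/seteqP; split => r /=; rewrite !in_itv/= ltr_pdivrMr// ler_pdivlMr// => /andP[h1 h2];
    apply/andP; split; lra.
rewrite !lebesgue_measure_itv/= !lte_fin ltr_pM2r ?invr_gt0// ltrD2r.
case: ifPn => _; last by rewrite mule0.
by rewrite -!EFinD -EFinM; congr (_%:E); field; rewrite gt_eqF.
Qed.

Lemma ge0_integral_rV_affine n (a : 'rV[R]_n) (c : R) (f : 'rV[R]_n -> \bar R) :
  0 < c -> measurable_fun setT f -> (forall x, (0 <= f x)%E) ->
  (\int[lebesgue_rV R n]_x f (a + c *: x)%R =
   (c^-1 ^+ n)%:E * \int[lebesgue_rV R n]_x f x)%E.
Proof.
move=> c0 mf f0.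
(* The translation vector is extended by 0 to indices beyond [n], as [rV_map] wants coordinate maps
   indexed by [nat]. *)
pose t (i : nat) (r : R) := (if insub i is Some j then a ord0 j else 0) + c * r.
have mt i : measurable_fun setT (t i).
  apply: measurable_funD; first exact: measurable_cst.
  by apply: measurable_funM => //; exact: measurable_cst.
rewrite -(@ge0_integral_rV_map n t)//.
- apply: eq_integral => x _; congr f; apply/rowP => i; rewrite !mxE /t.
  by rewrite insubT//= => ?; congr (a _ _ + _); exact/val_inj.
- by rewrite invr_ge0 ltW.
- move=> i h mh h0; apply: ge0_integral_lebesgue_pushforward => //.
    by rewrite invr_ge0 ltW.
  by move=> A mA; exact: lebesgue_measure_affine.
Qed.

Lemma ge0_integral_rVN n (f : 'rV[R]_n -> \bar R) :
  measurable_fun setT f -> (forall x, (0 <= f x)%E) ->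
  (\int[lebesgue_rV R n]_x f (- x)%R = \int[lebesgue_rV R n]_x f x)%E.
Proof.
move=> mf f0; rewrite -[RHS]mul1e -(expr1n _ n) -(@ge0_integral_rV_map n (fun=> -%R))//.
- by apply: eq_integral => x _; congr f; apply/rowP => i; rewrite !mxE.
- move=> i h mh h0; apply: ge0_integral_lebesgue_pushforward => //.
  by move=> A mA; rewrite mul1e -[RHS]lebesgue_measureN.
Qed.

End lebesgue_rV_integral.

Section complex_change_of_variables.
Context (R : realType) d (T : measurableType d) (mu : {measure set T -> \bar R})
  (phi : T -> T) (k : R).
Hypotheses (k0 : 0 <= k) (mphi : measurable_fun setT phi)
  (phiE : forall h : T -> \bar R, measurable_fun setT h -> (forall x, (0 <= h x)%E) ->
    (\int[mu]_x h (phi x) = k%:E * \int[mu]_x h x)%E).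

Lemma cintegrable_comp_scale f : cintegrable mu f -> cintegrable mu (fun x => f (phi x)).
Proof.
move=> [mf foo]; split; first exact: cmeasurable_comp.
rewrite (phiE (h := fun x => (nrm (f x))%:E)).
- by rewrite lte_mul_pinfty.
- by apply/measurable_EFinP; exact: measurable_nrm.
- by move=> x; rewrite lee_fin nrm_ge0.
Qed.

Let Rintegral_comp_scale (h : T -> R) : mu.-integrable setT (EFin \o h) ->
  Rintegral mu setT (fun x => h (phi x)) = k * Rintegral mu setT h.
Proof.
move=> ih; have mh := measurable_int _ ih; rewrite /Rintegral.
rewrite [in LHS]integralE [in RHS]integralE.
have -> : (\int[mu]_x (fun x => (h (phi x))%:E)^\+ x = k%:E * \int[mu]_x (EFin \o h)^\+ x)%E.
  rewrite -phiE; [|exact: measurable_funepos|by move=> x; exact: funepos_ge0].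
  by apply: eq_integral => x _; rewrite !funeposE.
have -> : (\int[mu]_x (fun x => (h (phi x))%:E)^\- x = k%:E * \int[mu]_x (EFin \o h)^\- x)%E.
  rewrite -phiE; [|exact: measurable_funeneg|by move=> x; exact: funeneg_ge0].
  by apply: eq_integral => x _; rewrite !funenegE.
have fp := integrable_fin_num measurableT (integrable_funepos measurableT ih).
have fn := integrable_fin_num measurableT (integrable_funeneg measurableT ih).
rewrite -muleBr//; last by rewrite fin_num_adde_defr.
by rewrite fineM// fin_numB fp fn.
Qed.

Lemma cintegral_comp_scale f : cintegrable mu f ->
  cintegral mu (fun x => f (phi x)) = k%:C * cintegral mu f.
Proof.
move=> fi; apply: complex_eq; rewrite ?Re_mulE ?Im_mulE/= mul0r ?subr0 ?addr0.
  by rewrite (Rintegral_comp_scale (cintegrable_Re fi)).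
by rewrite (Rintegral_comp_scale (cintegrable_Im fi)).
Qed.

End complex_change_of_variables.

Section complex_rV.
Context (R : realType) (n : nat).
Implicit Types (f : 'rV[R]_n -> R[i]) (a : 'rV[R]_n).
Local Notation mu := (lebesgue_rV R n).

Lemma measurable_rV_affine a (c : R) : measurable_fun setT (fun x : 'rV[R]_n => a + c *: x).
Proof.
apply: measurable_fun_rV => i.
rewrite (_ : _ \o _ = (fun x => a ord0 i + c * rV_coord i x)); last first.
  by apply/funext => x; rewrite /rV_coord /= !mxE.
apply: measurable_funD; first exact: measurable_cst.
apply: measurable_funM; first exact: measurable_cst.
exact: measurable_rV_coord.
Qed.

Lemma measurable_rVN : measurable_fun setT (fun x : 'rV[R]_n => - x).
Proof.
apply: measurable_fun_rV => i.
rewrite (_ : _ \o _ = (fun x => -1 * rV_coord i x)); last first.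
  by apply/funext => x; rewrite /rV_coord /= !mxE mulN1r.
by apply: measurable_funM; [exact: measurable_cst|exact: measurable_rV_coord].
Qed.

Lemma cintegrable_affine f a (c : R) : 0 < c -> cintegrable mu f ->
  cintegrable mu (fun x => f (a + c *: x)).
Proof.
move=> c0; apply: (cintegrable_comp_scale (k := c^-1 ^+ n)).
- by rewrite exprn_ge0// invr_ge0 ltW.
- exact: measurable_rV_affine.
- by move=> h mh h0; exact: ge0_integral_rV_affine.
Qed.

Lemma cintegral_affine f a (c : R) : 0 < c -> cintegrable mu f ->
  cintegral mu (fun x => f (a + c *: x)) = (c^-1 ^+ n)%:C * cintegral mu f.
Proof.
move=> c0; apply: cintegral_comp_scale.
by move=> h mh h0; exact: ge0_integral_rV_affine.
Qed.

Lemma cintegrable_shift f a : cintegrable mu f -> cintegrable mu (fun x => f (a + x)).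
Proof.
move=> /(cintegrable_affine a ltr01); congr cintegrable.
by apply/funext => x; rewrite scale1r.
Qed.

Lemma cintegral_shift f a : cintegrable mu f ->
  cintegral mu (fun x => f (a + x)) = cintegral mu f.
Proof.
move=> /(cintegral_affine a ltr01); rewrite invr1 expr1n mul1r => <-.
by congr cintegral; apply/funext => x; rewrite scale1r.
Qed.

End complex_rV.

(** * Measurability of continuous functions *)

(* Row vectors carry the product sigma-algebra, which is not known to be the Borel
   one: a continuous function is instead the limit of its compositions with the
   rounding of coordinates, which take countably many values. *)
Section countable_rounding.
Context d (T : measurableType d).

(** Factoring through a countable type makes every further composition measurable, whatever the
    function composed with it, so no Borel structure on [T'] enters. *)
Definition countably_valued (T' : Type) (r : T -> T') :=
  exists (C : countType) (g : T -> C) (h : C -> T'),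
    (forall c, measurable (g @^-1` [set c])) /\ r = h \o g.

Lemma countably_valued_comp (T' T'' : Type) (r : T -> T') (f : T' -> T'') :
  countably_valued r -> countably_valued (f \o r).
Proof. by move=> [C [g [h [mg ->]]]]; exists C, g, (f \o h). Qed.

Lemma countably_valued_measurable d' (T' : measurableType d') (r : T -> T') :
  countably_valued r -> measurable_fun setT r.
Proof.
move=> [C [g [h [mg ->]]]] _ Y mY; rewrite setTI.
rewrite (_ : _ @^-1` Y = \bigcup_k (if unpickle k is Some c then
    (if h c \in Y then g @^-1` [set c] else set0) else set0)).
  by apply: bigcup_measurable => k _; case: unpickle => // c; case: ifP.
apply/seteqP; split => [x /= hY|x [k _]].
  by exists (pickle (g x)) => //; rewrite pickleK mem_set.
by case: unpickle => // c; case: ifPn => // /set_mem hY /= ->.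
Qed.

End countable_rounding.

Lemma countably_valued_pair d1 d2 (T1 : measurableType d1) (T2 : measurableType d2)
    T1' T2' (r1 : T1 -> T1') (r2 : T2 -> T2') :
  countably_valued r1 -> countably_valued r2 ->
  countably_valued (fun z : T1 * T2 => (r1 z.1, r2 z.2)).
Proof.
move=> [C1 [g1 [h1 [mg1 ->]]]] [C2 [g2 [h2 [mg2 ->]]]].
exists (C1 * C2)%type, (fun z => (g1 z.1, g2 z.2)), (fun c => (h1 c.1, h2 c.2)).
split => // -[c1 c2].
rewrite (_ : _ @^-1` _ = (g1 @^-1` [set c1]) `*` (g2 @^-1` [set c2])).
  exact: measurableX.
by apply/seteqP; split => [[x y] /= [<- <-]|[x y] /= [-> ->]].
Qed.

Section continuous_measurable.
Context (R : realType).

Definition round (k : nat) (t : R) : R := (Num.floor (t * k.+1%:R))%:~R / k.+1%:R.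

Lemma round_dist k (t : R) : `|t - round k t| <= k.+1%:R^-1.
Proof.
have k0 : 0 < k.+1%:R :> R by rewrite ltr0n.
rewrite /round; set m := Num.floor _.
have /andP[h1 h2] := mem_rg1_floor (t * k.+1%:R).
rewrite ler_norml; apply/andP; split.
  apply: (@le_trans _ _ 0); first by rewrite oppr_le0 invr_ge0 ltW.
  by rewrite subr_ge0 ler_pdivrMr// ge_floor.
rewrite lerBlDr -[X in X + _]div1r -mulrDl ler_pdivlMr//.
by rewrite addrC ltW.
Qed.

Context (n : nat).

Definition rround (k : nat) (x : 'rV[R]_n) : 'rV[R]_n := \row_i round k (x ord0 i).

Lemma countably_valued_rround k : countably_valued (rround k).
Proof.
exists 'rV[int]_n, (fun x : 'rV[R]_n => \row_i Num.floor (x ord0 i * k.+1%:R)),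
  (fun c : 'rV[int]_n => \row_i ((c ord0 i)%:~R / k.+1%:R)); split; last first.
  by apply/funext => x; apply/rowP => i; rewrite !mxE.
move=> c.
rewrite (_ : _ @^-1` _ = \big[setI/setT]_(i : 'I_n)
    (@rV_coord R n i @^-1` [set t | Num.floor (t * k.+1%:R) = c ord0 i])).
  apply: bigsetI_measurable => i _; rewrite -[X in measurable X]setTI.
  apply: measurable_rV_coord => //.
  rewrite (_ : [set t | _] = `[(c ord0 i)%:~R / k.+1%:R, ((c ord0 i) + 1)%:~R / k.+1%:R[%classic).
    exact: measurable_itv.
  have k0 : 0 < k.+1%:R :> R by rewrite ltr0n.
  apply/seteqP; split => t /=; rewrite in_itv/= ler_pdivrMr// ltr_pdivlMr//.
    by move=> <-; rewrite ge_floor floorD1_gt.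
  by move=> h; apply: floor_def.
apply/seteqP; split => [x /= <-|x].
  by rewrite -bigcap_seq => i _ /=; rewrite mxE.
rewrite -bigcap_seq => h; apply/rowP => i; rewrite mxE.
by apply: (h i); rewrite /= mem_index_enum.
Qed.

Lemma cvg_rround (x : 'rV[R]_n) : rround k x @[k --> \oo] --> x.
Proof.
apply/cvgrPdist_le => e e0; near=> k.
rewrite [leLHS]mx_normrE; apply: bigmax_le => [|i _]; first exact: ltW.
rewrite !mxE (ord1 i.1); apply: (le_trans (round_dist _ _)).
near: k; have /cvgrPdist_le /(_ e e0) := @cvg_harmonic R.
by apply: filterS => k; rewrite sub0r normrN ger0_norm// harmonic_ge0.
Unshelve. all: by end_near. Qed.

End continuous_measurable.

Lemma continuous_cmeasurable_rV (R : realType) n (f : 'rV[R]_n -> R[i]) :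
  continuous f -> cmeasurable f.
Proof.
move=> cf; apply: (@cmeasurable_cvg _ _ _ (fun k x => f (rround k x))) => [k|x].
  by split; apply: countably_valued_measurable;
    apply: (@countably_valued_comp _ _ _ _ (rround k) (fun x => _ (f x)));
    exact: countably_valued_rround.
exact: (cvg_comp (fun k => rround k x) f (@cvg_rround R n x) (cf x)).
Qed.

Lemma continuous_cmeasurable_phase (R : realType) n (f : phase R n -> R[i]) :
  continuous f -> cmeasurable f.
Proof.
move=> cf; apply: (@cmeasurable_cvg _ _ _ (fun k x => f (rround k x.1, rround k x.2))) => [k|x].
  by split; apply: countably_valued_measurable;
    apply: (@countably_valued_comp _ _ _ _ (fun x => (rround k x.1, rround k x.2)) (fun x => _ (f x)));
    apply: countably_valued_pair; exact: countably_valued_rround.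
apply: (cvg_comp (fun k => (rround k x.1, rround k x.2)) f); last exact: cf.
by case: x => x y; exact: (cvg_pair (@cvg_rround R n x) (@cvg_rround R n y)).
Qed.

(** * Fourier inversion *)

Section laplace_kernel_1d.
Context (R : realType).
Local Notation lam := (@lebesgue_measure R).

Lemma integral_oneDsqrV : (\int[lam]_a ((1 + a ^+ 2)^-1)%:E = pi%:E)%E.
Proof.
rewrite (@ge0_symfun_integralT R (fun a => (1 + a ^+ 2)^-1)).
- rewrite -set_itvcy [X in (_ * X)%E](_ : _ = (pi / 2)%:E).
    by rewrite -EFinM mulrC divfK.
  by rewrite -integral0y_oneDsqr.
- by move=> a; rewrite invr_ge0 addr_ge0// sqr_ge0.
- exact: (@continuous_oneDsqrV R).
- by move=> a /=; rewrite sqrrN.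
Qed.

(** The antiderivative of exp(- a) (1 + cos(s a)) that vanishes at infinity. *)
Let F (s a : R) := expR (- a) * (- 1 + (s * sin (s * a) - cos (s * a)) / (1 + s ^+ 2)).

Let is_derive_F (s a : R) : is_derive a 1 (F s) (expR (- a) * (1 + cos (s * a))).
Proof.
have s0 : 1 + s ^+ 2 != 0 by rewrite gt_eqF// ltr_wpDr// sqr_ge0.
rewrite /F; apply: is_derive_eq.
rewrite /GRing.scale/=; field; exact: s0.
Qed.

Let cvg_F (s : R) : F s a @[a --> +oo] --> (0 : R).
Proof.
have bd a : `|F s a| <= expR (- a) * (2 + `|s|).
  rewrite normrM ger0_norm ?expR_ge0// ler_wpM2l ?expR_ge0//.
  apply: (le_trans (ler_normD _ _)); rewrite normrN1.
  have -> : 2 + `|s| = 1 + (`|s| + 1) by ring.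
  rewrite lerD2l normrM.
  apply: (@le_trans _ _ (`|s * sin (s * a) - cos (s * a)| * 1)).
    rewrite ler_wpM2l// ger0_norm ?invr_ge0 ?addr_ge0 ?sqr_ge0//.
    by rewrite invf_le1 ?ltr_wpDr ?sqr_ge0// lerDl sqr_ge0.
  rewrite mulr1; apply: (le_trans (ler_normB _ _)); rewrite lerD//.
    rewrite normrM -[leRHS]mulr1 ler_wpM2l// ler_norml sin_geN1 sin_le1//.
  by rewrite ler_norml cos_geN1 cos_le1.
apply: (@squeeze_cvgr _ _ _ _ (fun a => - (expR (- a) * (2 + `|s|)))
  (fun a => expR (- a) * (2 + `|s|))).
- by apply: nearW => a; rewrite -ler_norml.
- rewrite -[X in _ --> X]oppr0 -(mul0r (2 + `|s|)).
  by apply: cvgN; apply: cvgMl; exact: cvgr_expR.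
- by rewrite -(mul0r (2 + `|s|)); apply: cvgMl; exact: cvgr_expR.
Qed.

(** The summand 1 makes the integrand nonnegative, as the half-line fundamental theorem of calculus
    demands. The case s = 0 gives the mass of [laplace], and subtracting it isolates the cosine
    transform. *)
Lemma integral_expRN_cos (s : R) :
  (\int[lam]_a (expR (- `|a|) * (1 + cos (s * a)))%:E = (2 + 2 / (1 + s ^+ 2))%:E)%E.
Proof.
have c0 (x : R) : 0 <= 1 + cos x by rewrite -lerBlDl sub0r cos_geN1.
have ccos : continuous (fun a : R => 1 + cos (s * a)).
  move=> a; apply: cvgD; first exact: cvg_cst.
  apply: (cvg_comp ( *%R s) (@cos R)); last exact: continuous_cos.
  exact: mulrl_continuous.
rewrite (@ge0_symfun_integralT R (fun a => expR (- `|a|) * (1 + cos (s * a)))).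
- rewrite -set_itvcy.
  under eq_integral => a.
    rewrite inE/= in_itv/= andbT => a0; rewrite (ger0_norm a0); over.
  rewrite (@ge0_continuous_FTC2y R _ (F s) 0 0).
  + rewrite -EFinB -EFinM; congr (_%:E).
    rewrite /F oppr0 expR0 mulr0 sin0 cos0 mulr0; field.
    by rewrite gt_eqF// ltr_wpDr// sqr_ge0.
  + by move=> a _; rewrite mulr_ge0 ?expR_ge0.
  + apply: continuous_subspaceT => a; apply: cvgM; last exact: ccos.
    apply: (cvg_comp -%R (@expR R)); last exact: continuous_expR.
    exact: opp_continuous.
  + exact: cvg_F.
  + by move=> a _; have [] := is_derive_F s a.
  + apply: cvg_at_right_filter; apply: differentiable_continuous.
    by apply/derivable1_diffP; have [] := is_derive_F s 0.
  + by move=> a _; rewrite derive1E; have [_ ->] := is_derive_F s a.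
- by move=> a; rewrite mulr_ge0 ?expR_ge0.
- move=> a; apply: cvgM; last exact: ccos.
  apply: (cvg_comp (fun a : R => - `|a|) (@expR R)); last exact: continuous_expR.
  by apply: cvgN; exact: norm_continuous.
- by move=> a /=; rewrite normrN mulrN cosN.
Qed.

(** This damping is preferred to a gaussian because its transform, 2 / (1 + s^2), is twice the
    one-dimensional factor of [wt]. *)
Definition laplace (a : R) : R := expR (- `|a|).

Lemma laplace_gt0 a : 0 < laplace a. Proof. exact: expR_gt0. Qed.

Lemma laplace_le1 a : laplace a <= 1.
Proof. by rewrite /laplace expR_le1 oppr_le0. Qed.

Lemma continuous_laplace : continuous laplace.
Proof.
move=> a.
apply: (cvg_comp (fun a : R => - `|a|) (@expR R)); last exact: continuous_expR.
by apply: cvgN; exact: norm_continuous.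
Qed.

Lemma measurable_laplace : measurable_fun setT laplace.
Proof. exact: (continuous_measurable_fun continuous_laplace). Qed.

Lemma integral_laplace : (\int[lam]_a (laplace a)%:E = 2%:E)%E.
Proof.
have := integral_expRN_cos 0.
under eq_integral do rewrite mul0r cos0 mulrC EFinM.
rewrite ge0_integralZl; first last.
- by rewrite lee_fin.
- by move=> a _; rewrite lee_fin expR_ge0.
- by apply/measurable_EFinP; exact: measurable_laplace.
- by [].
move=> /(congr1 (fun x => (2^-1)%:E * x)%E).
rewrite muleA -!EFinM (_ : 2^-1 * (1 + 1) = 1) ?mul1e; last by field.
by move=> ->; congr (_%:E); rewrite expr0n/=; field.
Qed.

Lemma integrable_laplace : lam.-integrable setT (EFin \o laplace).
Proof.
apply/integrableP; split; first by apply/measurable_EFinP; exact: measurable_laplace.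
under eq_integral do rewrite /= ger0_norm ?(ltW (laplace_gt0 _))//.
by rewrite integral_laplace ltry.
Qed.

Lemma cintegrable_laplace_cis (s : R) :
  cintegrable lam (fun a => (laplace a)%:C * cis (- (s * a))).
Proof.
apply: (cintegrable_le _ integrable_laplace) => [|a].
  apply: cmeasurableM.
    by apply: cmeasurable_real; exact: measurable_laplace.
  apply: cmeasurable_cis; apply: continuous_measurable_fun => a.
  by apply: cvgN; exact: mulrl_continuous.
by rewrite nrmM nrm_cis mulr1 nrm_real ger0_norm// ltW// laplace_gt0.
Qed.

Lemma fourier_laplace (s : R) :
  cintegral lam (fun a => (laplace a)%:C * cis (- (s * a))) = (2 / (1 + s ^+ 2))%:C.
Proof.
apply: complex_eq => /=.
- have : Rintegral lam setT (fun a => laplace a * (1 + cos (s * a))) = 2 + 2 / (1 + s ^+ 2).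
    by rewrite /Rintegral integral_expRN_cos.
  have ic : lam.-integrable setT (EFin \o (fun a => laplace a * cos (s * a))).
    have := cintegrable_Re (cintegrable_laplace_cis s); congr (_.-integrable _ _).
    by apply/funext => a /=; rewrite cosN mul0r subr0.
  under eq_Rintegral do rewrite mulrDr mulr1.
  rewrite RintegralD//; last exact: integrable_laplace.
  rewrite [X in X + _](_ : _ = 2); last by rewrite /Rintegral integral_laplace.
  move=> /addrI <-; apply: eq_Rintegral => a _.
  by rewrite mul0r subr0 cosN.
- set I := Rintegral _ _ _.
  (* Reflection of the line turns the integrand into its conjugate, so the imaginary part equals its
     opposite. *)
  have IN : I = - I; last by lra.
  have li := cintegrable_laplace_cis s.
  have h : cintegral lam (fun a => (laplace (- a))%:C * cis (- (s * - a))) =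
      cintegral lam (fun a => (laplace a)%:C * cis (- (s * a))).
    rewrite (@cintegral_comp_scale _ _ _ lam -%R 1 _ _ li) ?mul1r//.
    move=> h mh h0; apply: ge0_integral_lebesgue_pushforward => //.
    by move=> A mA; rewrite mul1e -[RHS]lebesgue_measureN.
  have hI : complex.Im (cintegral lam (fun a => (laplace (- a))%:C * cis (- (s * - a)))) = I.
    by rewrite h.
  rewrite -{1}hI.
  have -> : (fun a => (laplace (- a))%:C * cis (- (s * - a))) =
      (fun a => ((laplace a)%:C * cis (- (s * a)))^*).
    apply/funext => a; apply: complex_eq; rewrite ?Re_conjE ?Im_conjE /laplace normrN/= mulrN.
      by rewrite cosN opprK; ring.
    by rewrite !sinN opprK; ring.
  by rewrite cintegral_conj// Im_conjE.
Qed.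

End laplace_kernel_1d.

Section iterated_lebesgue.
Context (R : realType) (n : nat).
Local Notation lam := (@lebesgue_measure R).
Local Notation mu := (lebesgue_rV R n.+1).

Lemma cintegrable_lebesgue_rVS (f : 'rV[R]_n.+1 -> R[i]) : cintegrable mu f <->
  cmeasurable f /\ cintegrable (prod_measure lam (lebesgue_rV R n)) (f \o @rV_cons R n).
Proof.
have mc := @measurable_rV_cons R n.
have E : cmeasurable f -> (\int[mu]_x (nrm (f x))%:E =
    \int[prod_measure lam (lebesgue_rV R n)]_x (nrm ((f \o @rV_cons R n) x))%:E)%E.
  move=> mf; transitivity (\int[pushforward (prod_measure lam (lebesgue_rV R n)) (@rV_cons R n)]_x
    (nrm (f x))%:E)%E => //.
  rewrite ge0_integral_pushforward//.
  - by apply/measurable_EFinP; exact: measurable_nrm.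
  - by move=> z _; rewrite lee_fin nrm_ge0.
split=> [[mf foo]|[mf [_ foo]]].
  by split => //; split; [exact: cmeasurable_comp|rewrite -E].
by split => //; rewrite E.
Qed.

Lemma cintegral_lebesgue_rVS (f : 'rV[R]_n.+1 -> R[i]) : cintegrable mu f ->
  cintegral mu f =
  cintegral lam (fun a => cintegral (lebesgue_rV R n) (fun x => f (rV_cons (a, x)))).
Proof.
move=> fi; have [_ fi'] := (cintegrable_lebesgue_rVS f).1 fi.
have := cfubini1 fi' => /= ->.
have mc := @measurable_rV_cons R n.
apply: complex_eq; rewrite /cintegral/=; congr fine.
- transitivity (\int[pushforward (prod_measure lam (lebesgue_rV R n)) (@rV_cons R n)]_x
    (complex.Re (f x))%:E)%E => //.
  rewrite integral_pushforward//.
  + by apply/measurable_EFinP; exact: fi.1.1.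
  + exact: (cintegrable_Re fi').
- transitivity (\int[pushforward (prod_measure lam (lebesgue_rV R n)) (@rV_cons R n)]_x
    (complex.Im (f x))%:E)%E => //.
  rewrite integral_pushforward//.
  + by apply/measurable_EFinP; exact: fi.1.2.
  + exact: (cintegrable_Im fi').
Qed.

End iterated_lebesgue.

Section product_functions.
Context (R : realType).

Definition rV_prod (f : R -> R) n (x : 'rV[R]_n) : R := \prod_i f (x ord0 i).

Lemma rV_prodS f n a (x : 'rV[R]_n) : rV_prod f (rV_cons (a, x)) = f a * rV_prod f x.
Proof.
rewrite /rV_prod big_ord_recl; congr (f _ * _).
  by rewrite mxE; case: splitP => // j _; rewrite mxE.
apply: eq_bigr => i _; congr f; rewrite mxE.
case: splitP => [j|k /eqP]; first by case: j => -[].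
by rewrite /bump/= eqn_add2l => /eqP/val_inj ->.
Qed.

Lemma measurable_rV_prod f n : measurable_fun setT f -> measurable_fun setT (@rV_prod f n).
Proof.
move=> mf; apply: measurable_prod => i _.
exact: (measurableT_comp mf (measurable_rV_coord i)).
Qed.

Lemma integral_rV_prod (f : R -> R) (c : R) n : measurable_fun setT f ->
  (forall a, 0 <= f a) -> (\int[lebesgue_measure]_a (f a)%:E = c%:E)%E ->
  (\int[lebesgue_rV R n]_x (rV_prod f x)%:E = (c ^+ n)%:E)%E.
Proof.
move=> mf f0 fc; have pf0 m (x : 'rV[R]_m) : 0 <= rV_prod f x by apply: prodr_ge0.
have mp m : measurable_fun setT (fun x : 'rV[R]_m => (rV_prod f x)%:E).
  by apply/measurable_EFinP; exact: measurable_rV_prod.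
elim: n => [|n IH].
  rewrite ge0_integral_lebesgue_rV0; first by rewrite /rV_prod big_ord0 expr0.
    exact: mp.
  by move=> x; rewrite lee_fin.
rewrite ge0_integral_lebesgue_rVS//.
have c0 : 0 <= c by rewrite -lee_fin -fc; apply: integral_ge0 => a _; rewrite lee_fin.
under eq_integral => a _.
  under eq_integral do rewrite rV_prodS EFinM.
  rewrite ge0_integralZl; first last.
  - by rewrite lee_fin.
  - by move=> x _; rewrite lee_fin.
  - exact: mp.
  - by [].
  rewrite IH muleC; over.
rewrite ge0_integralZl; first last.
- by rewrite lee_fin exprn_ge0.
- by move=> a _; rewrite lee_fin.
- exact/measurable_EFinP.
- by [].
- by rewrite fc -EFinM exprSr.
by move=> x; rewrite lee_fin.
Qed.

Lemma integrable_rV_prod (f : R -> R) (c : R) n : measurable_fun setT f ->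
  (forall a, 0 <= f a) -> (\int[lebesgue_measure]_a (f a)%:E = c%:E)%E ->
  (lebesgue_rV R n).-integrable setT (EFin \o @rV_prod f n).
Proof.
move=> mf f0 fc; apply/integrableP; split.
  by apply/measurable_EFinP; exact: measurable_rV_prod.
under eq_integral do rewrite /= ger0_norm ?prodr_ge0//.
by rewrite (integral_rV_prod n mf f0 fc) ltry.
Qed.

End product_functions.

Section dot_product.
Context (R : realType) (n : nat).
Implicit Types x y z : 'rV[R]_n.

Lemma dotpC x y : dotp x y = dotp y x.
Proof. by apply: eq_bigr => i _; rewrite mulrC. Qed.

Lemma dotpDr x y z : dotp x (y + z) = dotp x y + dotp x z.
Proof. by rewrite /dotp -big_split/=; apply: eq_bigr => i _; rewrite mxE mulrDr. Qed.

Lemma dotpDl x y z : dotp (x + y) z = dotp x z + dotp y z.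
Proof. by rewrite dotpC dotpDr !(dotpC z). Qed.

Lemma dotpZr (c : R) x y : dotp x (c *: y) = c * dotp x y.
Proof. by rewrite /dotp mulr_sumr; apply: eq_bigr => i _; rewrite mxE mulrCA. Qed.

Lemma dotpZl (c : R) x y : dotp (c *: x) y = c * dotp x y.
Proof. by rewrite dotpC dotpZr dotpC. Qed.

Lemma dotpNr x y : dotp x (- y) = - dotp x y.
Proof. by rewrite -scaleN1r dotpZr mulN1r. Qed.

Lemma dotpNl x y : dotp (- x) y = - dotp x y.
Proof. by rewrite dotpC dotpNr dotpC. Qed.

Lemma dotpBl x y z : dotp (x - y) z = dotp x z - dotp y z.
Proof. by rewrite dotpDl dotpNl. Qed.

Lemma dotp0r x : dotp x 0 = 0.
Proof. by rewrite -(scale0r 0) dotpZr mul0r. Qed.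

Lemma dotp0l x : dotp 0 x = 0.
Proof. by rewrite dotpC dotp0r. Qed.

Lemma measurable_dotp d (T : measurableType d) (f g : T -> 'rV[R]_n) :
  measurable_fun setT f -> measurable_fun setT g ->
  measurable_fun setT (fun w => dotp (f w) (g w)).
Proof.
move=> mf mg; apply: measurable_sum => i; apply: measurable_funM.
  exact: (measurableT_comp (measurable_rV_coord i) mf).
exact: (measurableT_comp (measurable_rV_coord i) mg).
Qed.

Lemma measurable_rVD d (T : measurableType d) (f g : T -> 'rV[R]_n) :
  measurable_fun setT f -> measurable_fun setT g ->
  measurable_fun setT (fun w => f w + g w).
Proof.
move=> mf mg; apply: measurable_fun_rV => i.
rewrite (_ : _ \o _ = (fun w => rV_coord i (f w) + rV_coord i (g w))); last first.
  by apply/funext => x; rewrite /rV_coord /= !mxE.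
apply: measurable_funD.
  exact: (measurableT_comp (measurable_rV_coord i) mf).
exact: (measurableT_comp (measurable_rV_coord i) mg).
Qed.

Lemma measurable_rVZ d (T : measurableType d) (c : R) (f : T -> 'rV[R]_n) :
  measurable_fun setT f -> measurable_fun setT (fun w => c *: f w).
Proof.
move=> mf; apply: (measurableT_comp (f := fun x : 'rV[R]_n => c *: x)) mf.
under eq_fun do rewrite -[c *: _]add0r.
exact: measurable_rV_affine.
Qed.

Lemma measurable_rV_opp d (T : measurableType d) (f : T -> 'rV[R]_n) :
  measurable_fun setT f -> measurable_fun setT (fun w => - f w).
Proof. by move=> mf; exact: (measurableT_comp (@measurable_rVN R n) mf). Qed.

Lemma measurable_rVB d (T : measurableType d) (f g : T -> 'rV[R]_n) :
  measurable_fun setT f -> measurable_fun setT g ->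
  measurable_fun setT (fun w => f w - g w).
Proof. by move=> mf mg; apply: measurable_rVD => //; exact: measurable_rV_opp. Qed.

End dot_product.

Lemma dotp_cons (R : realType) n (a b : R) (x y : 'rV[R]_n) :
  dotp (rV_cons (a, x)) (rV_cons (b, y)) = a * b + dotp x y.
Proof.
rewrite /dotp big_ord_recl; congr (_ + _).
  by congr (_ * _); rewrite mxE; case: splitP => // j _; rewrite mxE.
have E (c : R) (z : 'rV[R]_n) i : rV_cons (c, z) ord0 (lift ord0 i) = z ord0 i.
  rewrite mxE; case: splitP => [j|k /eqP]; first by case: j => -[].
  by rewrite /bump/= eqn_add2l => /eqP/val_inj ->.
by apply: eq_bigr => i _; rewrite !E.
Qed.

Lemma rV_unconsK (R : realType) n (x : 'rV[R]_n.+1) : rV_cons (rV_uncons x) = x.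
Proof.
apply/rowP => i; rewrite mxE; case: splitP => j ij; rewrite !mxE; congr (x _ _).
  by apply/val_inj => /=; rewrite ij (ord1 j).
by apply/val_inj => /=; rewrite ij.
Qed.

(** * An integrable product weight *)

Section weight.
Context (R : realType).

(** The product form lets integrals and Fourier transforms reduce to one dimension, while [wt_norm]
    keeps the weight above a power of 1 / (1 + |x|), so that Schwartz functions are dominated by
    it. *)
Definition wt n : 'rV[R]_n -> R := @rV_prod R (fun a => (1 + a ^+ 2)^-1) n.

Let onesqr_gt0 (a : R) : 0 < 1 + a ^+ 2.
Proof. by rewrite ltr_wpDr// sqr_ge0. Qed.

Lemma wt_gt0 n (x : 'rV[R]_n) : 0 < wt x.
Proof. by apply: prodr_gt0 => i _; rewrite invr_gt0. Qed.

Lemma wt_le1 n (x : 'rV[R]_n) : wt x <= 1.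
Proof.
rewrite /wt /rV_prod; apply: prodr_ile1 => i _; rewrite invr_ge0 ltW//=.
by rewrite invf_le1// lerDl sqr_ge0.
Qed.

Let measurable_onesqrV : measurable_fun setT (fun a : R => (1 + a ^+ 2)^-1).
Proof. by apply: continuous_measurable_fun; exact: (@continuous_oneDsqrV R). Qed.

Lemma measurable_wt n : measurable_fun setT (@wt n).
Proof. exact: measurable_rV_prod. Qed.

Lemma integral_wt n : (\int[lebesgue_rV R n]_x (wt x)%:E = (pi ^+ n)%:E)%E.
Proof.
apply: integral_rV_prod => //; last exact: integral_oneDsqrV.
by move=> a; rewrite invr_ge0 ltW.
Qed.

Lemma integrable_wt n : (lebesgue_rV R n).-integrable setT (EFin \o @wt n).
Proof.
apply: (@integrable_rV_prod R _ pi) => //; last exact: integral_oneDsqrV.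
by move=> a; rewrite invr_ge0 ltW.
Qed.

(** Peetre's inequality, one coordinate at a time: 1 + s^2 <= 2 (1 + t^2) (1 + (t + s)^2). *)
Lemma wt_shift n (t s : 'rV[R]_n) : wt (t + s) <= 2 ^+ n / wt t * wt s.
Proof.
have -> : 2 ^+ n / wt t * wt s = \prod_(i < n) (2 * (1 + t ord0 i ^+ 2) * (1 + s ord0 i ^+ 2)^-1).
  rewrite !big_split/= prodr_const card_ord; congr (_ * _ * _).
  by rewrite /wt /rV_prod -prodfV; apply: eq_bigr => i _; rewrite invrK.
apply: ler_prod => i _; rewrite mxE invr_ge0 ltW//=.
rewrite -[leLHS]mul1r ler_pdivrMr// mulrAC ler_pdivlMr// mul1r.
(* The difference of the two sides is 1 + (2 t + s)^2 + 2 (t (t + s))^2. *)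
have := sqr_ge0 (t ord0 i * (t ord0 i + s ord0 i)).
have := sqr_ge0 (2 * t ord0 i + s ord0 i); nra.
Qed.

Lemma wt_norm n (x : 'rV[R]_n) : 1 <= (1 + `|x|) ^+ (2 * n) * wt x.
Proof.
rewrite exprM /wt /rV_prod -[X in _ ^+ X]card_ord -prodr_const -big_split/=.
apply: (big_ind (fun r : R => 1 <= r)) => // [r r'|i _]; first exact: mulr_ege1.
rewrite ler_pdivlMr// mul1r sqrrD expr1n -addrA lerD2l.
have xi : `|x ord0 i| <= `|x|.
  rewrite [leRHS]mx_normrE.
  exact: (le_bigmax _ (fun ij => `|x ij.1 ij.2|) (ord0, i)).
rewrite -(real_normK (num_real (x ord0 i))).
have := normr_ge0 x; have := normr_ge0 (x ord0 i); nra.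
Qed.

End weight.

Lemma continuous_addl (K : numFieldType) (E : normedModType K) (t : E) :
  continuous (fun s : E => t + s).
Proof. by move=> s; apply: cvgD; [exact: cvg_cst|exact: cvg_id]. Qed.

Section fourier.
Context (R : realType).

Lemma cintegral_lebesgue_rV0 (f : 'rV[R]_0 -> R[i]) : cmeasurable f ->
  cintegral (lebesgue_rV R 0) f = f 0.
Proof.
move=> [mr mi]; apply: complex_eq => /=.
  transitivity (fine (\int[\d_(0%R : 'rV[R]_0)]_x (complex.Re (f x))%:E)%E) => //.
  by rewrite integral_dirac ?diracT ?mul1e//; exact/measurable_EFinP.
transitivity (fine (\int[\d_(0%R : 'rV[R]_0)]_x (complex.Im (f x))%:E)%E) => //.
by rewrite integral_dirac ?diracT ?mul1e//; exact/measurable_EFinP.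
Qed.

Lemma cintegrable_laplace_rV n (s : 'rV[R]_n) :
  cintegrable (lebesgue_rV R n)
    (fun eta => (rV_prod (@laplace R) eta)%:C * cis (- dotp s eta)).
Proof.
apply: (cintegrable_le (g := @rV_prod R (@laplace R) n)) => [||x].
- apply: cmeasurableM.
    by apply: cmeasurable_real; apply: measurable_rV_prod; exact: measurable_laplace.
  apply: cmeasurable_cis; apply: measurable_funN.
  by apply: measurable_dotp => //; exact: measurable_cst.
- apply: (@integrable_rV_prod R _ 2); [exact: measurable_laplace|
    by move=> a; exact/ltW/laplace_gt0|exact: integral_laplace].
- rewrite nrmM nrm_cis mulr1 nrm_real ger0_norm//.
  by apply: prodr_ge0 => i _; exact/ltW/laplace_gt0.
Qed.

Lemma fourier_laplace_rV n (s : 'rV[R]_n) :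
  cintegral (lebesgue_rV R n)
    (fun eta => (rV_prod (@laplace R) eta)%:C * cis (- dotp s eta)) = (2 ^+ n * wt s)%:C.
Proof.
elim: n s => [|n IH] s.
  rewrite cintegral_lebesgue_rV0; last by have [] := cintegrable_laplace_rV s.
  by rewrite dotp0r oppr0 cis0 /wt /rV_prod !big_ord0 expr0 !mulr1.
rewrite cintegral_lebesgue_rVS; last exact: cintegrable_laplace_rV.
rewrite -(rV_unconsK s); case: (rV_uncons s) => b t.
under [X in cintegral _ X]eq_fun => a.
  under eq_fun => x.
    rewrite rV_prodS dotp_cons opprD cisD rmorphM/= mulrACA.
    over.
  rewrite cintegralZ; last exact: cintegrable_laplace_rV.
  rewrite IH.
  over.
rewrite cintegralZr; last exact: cintegrable_laplace_cis.
rewrite fourier_laplace -rmorphM/=; congr (_%:C).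
by rewrite [X in _ = _ * X]rV_prodS (exprS _ n) [LHS]mulrACA.
Qed.

Context (n : nat).
Local Notation mu := (lebesgue_rV R n).
Implicit Types phi : 'rV[R]_n -> R[i].

Definition fourier phi (eta : 'rV[R]_n) : R[i] :=
  cintegral mu (fun s => cis (- dotp s eta) * phi s).

Lemma integrable_cwt (C : R) : mu.-integrable setT (EFin \o (fun x => C * wt x)).
Proof. rewrite (_ : EFin \o _ = (fun x => C%:E * (EFin \o @wt R n) x)%E); last exact/funext.
by apply: integrableZl => //; exact: integrable_wt. Qed.

Lemma cintegrable_wt phi (C : R) : cmeasurable phi ->
  (forall s, nrm (phi s) <= C * wt s) -> cintegrable mu phi.
Proof. by move=> mphi; apply: cintegrable_le => //; exact: integrable_cwt. Qed.

Lemma cmeasurable_fourier phi : cmeasurable phi -> cmeasurable (fourier phi).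
Proof.
move=> mphi; apply: (@cmeasurable_cintegral R _ _ _ _ mu
  (fun z : 'rV[R]_n * 'rV[R]_n => cis (- dotp z.2 z.1) * phi z.2)).
apply: cmeasurableM; last by apply: cmeasurable_comp mphi; exact: measurable_snd.
apply: cmeasurable_cis; apply: measurable_funN.
by apply: measurable_dotp; [exact: measurable_snd|exact: measurable_fst].
Qed.

Lemma cintegrable_tensor d1 d2 (T1 : measurableType d1) (T2 : measurableType d2)
    (m1 : {sigma_finite_measure set T1 -> \bar R})
    (m2 : {sigma_finite_measure set T2 -> \bar R})
    (F : T1 * T2 -> R[i]) (a : T1 -> R[i]) (b : T2 -> R[i]) :
  cmeasurable F -> cintegrable m1 a -> cintegrable m2 b ->
  (forall x y, nrm (F (x, y)) <= nrm (a x) * nrm (b y)) ->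
  cintegrable (prod_measure m1 m2) F.
Proof.
move=> mF ia ib Fab; apply: cintegrable_prod => //.
have [ma ioa] := ia; have [mb iob] := ib.
have fb : (\int[m2]_y (nrm (b y))%:E)%E \is a fin_num.
  by rewrite ge0_fin_numE//; apply: integral_ge0 => y _; rewrite lee_fin nrm_ge0.
have mnF : measurable_fun setT (fun z => (nrm (F z))%:E).
  by apply/measurable_EFinP; exact: measurable_nrm.
apply: (@le_lt_trans _ _ (\int[m1]_x ((nrm (a x))%:E * \int[m2]_y (nrm (b y))%:E)))%E.
  apply: ge0_le_integral => //.
  - by move=> x _; apply: integral_ge0 => y _; rewrite lee_fin nrm_ge0.
  - apply: (measurable_fun_fubini_tonelli_F (fun z => (nrm (F z))%:E)) => //.
    by move=> z; rewrite lee_fin nrm_ge0.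
  - apply: emeasurable_funM; last exact: measurable_cst.
    by apply/measurable_EFinP; exact: measurable_nrm.
  - move=> x _; rewrite -ge0_integralZl//; first last.
    + by rewrite lee_fin nrm_ge0.
    + by move=> y _; rewrite lee_fin nrm_ge0.
    + by apply/measurable_EFinP; exact: measurable_nrm.
    apply: ge0_le_integral => //.
    + by move=> y _; rewrite lee_fin nrm_ge0.
    + exact: (measurableT_comp mnF (measurable_pair1 x)).
    + apply: emeasurable_funM; first exact: measurable_cst.
      by apply/measurable_EFinP; exact: measurable_nrm.
    + by move=> y _; rewrite -EFinM lee_fin.
under eq_integral do rewrite muleC.
rewrite -(fineK fb) ge0_integralZl; first last.
- by rewrite lee_fin fine_ge0//; apply: integral_ge0 => y _; rewrite lee_fin nrm_ge0.
- by move=> x _; rewrite lee_fin nrm_ge0.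
- by apply/measurable_EFinP; exact: measurable_nrm.
- by [].
apply: lte_mul_pinfty => //.
by rewrite lee_fin fine_ge0//; apply: integral_ge0 => y _; rewrite lee_fin nrm_ge0.
Qed.

Lemma cvg_harmonicZ (s : 'rV[R]_n) : harmonic k *: s @[k --> \oo] --> (0 : 'rV[R]_n).
Proof. by rewrite -[X in _ --> X](scale0r s); apply: cvgZl; exact: cvg_harmonic. Qed.

(* Abel summation: damping by the product of the exp(- e |eta_i|) has an explicit
   Fourier transform, an approximate identity built from [wt]. *)
Lemma fourier_inversion0 phi (C C' : R) : continuous phi ->
  (forall s, nrm (phi s) <= C * wt s) ->
  (forall eta, nrm (fourier phi eta) <= C' * wt eta) ->
  cintegral mu (fourier phi) = ((2 * pi) ^+ n)%:C * phi 0.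
Proof.
move=> cphi phiC fphiC.
have mphi := continuous_cmeasurable_rV cphi.
have mfphi := cmeasurable_fourier mphi.
have C0 : 0 <= C.
  have := le_trans (nrm_ge0 _) (phiC 0); rewrite pmulr_lge0//; exact: wt_gt0.
pose E (eta : 'rV[R]_n) : R := rV_prod (@laplace R) eta.
have E0 eta : 0 <= E eta by apply: prodr_ge0 => i _; exact/ltW/laplace_gt0.
have E1 eta : E eta <= 1.
  by apply: prodr_ile1 => i _; rewrite laplace_le1 ltW// laplace_gt0.
have mE : measurable_fun setT E by apply: measurable_rV_prod; exact: measurable_laplace.
have cE : continuous E.
  have -> : E = fun x : 'rV[R]_n => \prod_(i < n) laplace (x ord0 i).
    by apply/funext.
  apply: continuous_big => [|i _ x]; first exact: mul_continuous.
 apply: (cvg_comp (fun x : 'rV[R]_n => x ord0 i) (@laplace R)).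
    exact: coord_continuous.
  exact: continuous_laplace.
pose A k := cintegral mu (fun eta => (E (harmonic k *: eta))%:C * fourier phi eta).
have mEk k : measurable_fun setT (fun eta : 'rV[R]_n => E (harmonic k *: eta)).
  by apply: (measurableT_comp mE); exact: measurable_rVZ.
have lim1 : A k @[k --> \oo] --> cintegral mu (fourier phi).
  apply: (@cintegral_dominated R _ _ mu _ _ (fun eta => C' * wt eta)).
  - by move=> k; apply: cmeasurableM => //; exact: cmeasurable_real.
  - exact: mfphi.
  - move=> eta; rewrite -[X in _ --> X]mul1r.
    apply: cvgM; last exact: cvg_cst.
    apply: cvg_complex => /=; last exact: cvg_cst.
    have E01 : E 0 = 1.
      by rewrite /E /rV_prod big1// => i _; rewrite mxE /laplace normr0 oppr0 expR0.
    have := cvg_comp (fun k => harmonic k *: eta) E (cvg_harmonicZ eta) (cE 0).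
    by rewrite E01.
  - exact: integrable_cwt.
  - move=> k eta; rewrite nrmM nrm_real ger0_norm//.
    by rewrite -[leRHS]mul1r ler_pM// nrm_ge0.
(* Fubini moves the damping into the inner integral, where its transform is e^-n 2^n wt(s / e);
   replacing s by e s then absorbs the factor e^-n. *)
have AE k : A k = cintegral mu (fun s => phi (harmonic k *: s) * (2 ^+ n * wt s)%:C).
  have h0 : 0 < harmonic k :> R by exact: harmonic_gt0.
  set e : R := harmonic k in h0 *.
  have iE : cintegrable mu (fun eta => (E (e *: eta))%:C).
    have := @cintegrable_affine _ _ _ 0 e h0 (cintegrable_laplace_rV (0 : 'rV[R]_n)).
    congr cintegrable; apply/funext => x.
    by rewrite dotp0l oppr0 cis0 mulr1 add0r.
  have iphi : cintegrable mu phi by exact: (cintegrable_wt mphi phiC).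
  transitivity (cintegral mu (fun eta => cintegral mu
      (fun s => (E (e *: eta))%:C * (cis (- dotp s eta) * phi s)))).
    congr cintegral; apply/funext => eta; rewrite cintegralZ//.
    apply: (cintegrableMb (C := 1)) => //; last by move=> x; rewrite nrm_cis.
    apply: cmeasurable_cis; apply: measurable_funN.
    by apply: measurable_dotp => //; exact: measurable_cst.
  have mK : cmeasurable (fun z : 'rV[R]_n * 'rV[R]_n =>
      (E (e *: z.1))%:C * (cis (- dotp z.2 z.1) * phi z.2)).
    apply: cmeasurableM.
      apply: cmeasurable_real; apply: (measurableT_comp mE).
      by apply: measurable_rVZ; exact: measurable_fst.
    apply: cmeasurableM; last by apply: cmeasurable_comp mphi; exact: measurable_snd.
    apply: cmeasurable_cis; apply: measurable_funN.
    by apply: measurable_dotp; [exact: measurable_snd|exact: measurable_fst].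
  rewrite (@cfubini _ _ _ _ _ mu mu (fun z => (E (e *: z.1))%:C *
      (cis (- dotp z.2 z.1) * phi z.2))); last first.
    apply: (cintegrable_tensor mK iE iphi) => x y /=.
    by rewrite !nrmM nrm_cis mul1r.
  pose F (s : 'rV[R]_n) := phi s * ((e^-1 ^+ n)%:C * (2 ^+ n * wt (e^-1 *: s))%:C).
  transitivity (cintegral mu F).
    congr cintegral; apply/funext => s /=; rewrite /F.
    have -> : (fun x => (E (e *: x))%:C * (cis (- dotp s x) * phi s)) =
        (fun x => phi s * ((E (e *: x))%:C * cis (- dotp s x))).
      by apply/funext => x; ring.
    have := cintegral_affine 0 h0 (cintegrable_laplace_rV (e^-1 *: s)).
    rewrite fourier_laplace_rV => <-.
    have HE : (fun x => (rV_prod (laplace (R:=R)) (0 + e *: x))%:C *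
        cis (- dotp (e^-1 *: s) (0 + e *: x))) =
        (fun x => (E (e *: x))%:C * cis (- dotp s x)).
      apply/funext => x; rewrite add0r; congr (_ * cis (- _)).
      by rewrite dotpZl dotpZr mulKf// gt_eqF.
    rewrite HE cintegralZ// -HE.
    exact: (cintegrable_affine 0 h0 (cintegrable_laplace_rV (e^-1 *: s))).
  have iF : cintegrable mu F.
    apply: (cintegrableMb (C := C)).
    - apply: cintegrableZ.
      have H := fun a b => cintegrable_affine (f := fun x => (2 ^+ n * wt x)%:C) 0 (a : 0 < e^-1) b.
      have -> : (fun x : 'rV[R]_n => (2 ^+ n * wt (e^-1 *: x))%:C) =
         (fun x => (2 ^+ n * wt (0 + e^-1 *: x))%:C).
        by apply/funext => x; rewrite add0r.
      apply: H; first by rewrite invr_gt0.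
      apply: (@cintegrable_wt _ (2 ^+ n)).
        apply: cmeasurable_real; apply: measurable_funM; first exact: measurable_cst.
        exact: measurable_wt.
      move=> s; rewrite nrm_real ger0_norm// mulr_ge0 ?exprn_ge0//.
      exact/ltW/wt_gt0.
    - exact: mphi.
    - move=> x; apply: (le_trans (phiC x)).
      by rewrite -[leRHS]mulr1 ler_wpM2l// wt_le1.
  have := cintegral_affine 0 h0 iF.
  move=> /(congr1 (fun z => (e ^+ n)%:C * z)).
  rewrite mulrA -rmorphM/= -exprMn mulfV ?gt_eqF// expr1n mul1r => <-.
  rewrite -cintegralZ; last exact: cintegrable_affine.
  congr cintegral; apply/funext => s; rewrite /F add0r scalerA mulVf ?gt_eqF// scale1r.
  rewrite mulrCA; congr (_ * _); rewrite mulrA -rmorphM/= -exprMn.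
  by rewrite mulfV ?gt_eqF// expr1n mul1r.
(* Here phi(e s) tends to phi(0), and the mass (2 pi)^n of [2 ^+ n * wt] is the constant of the
   inversion formula. *)
have lim2 : A k @[k --> \oo] --> cintegral mu (fun s => phi 0 * (2 ^+ n * wt s)%:C).
  under eq_fun do rewrite AE.
  have m2 : cmeasurable (fun s : 'rV[R]_n => (2 ^+ n * wt s)%:C).
    apply: cmeasurable_real; apply: measurable_funM; first exact: measurable_cst.
    exact: measurable_wt.
  apply: (@cintegral_dominated R _ _ mu _ _ (fun eta => (C * 2 ^+ n) * wt eta)).
  - move=> k; apply: cmeasurableM => //; apply: cmeasurable_comp mphi.
    exact: measurable_rVZ.
  - by apply: cmeasurableM => //; exact: cmeasurable_cst.
  - move=> s; apply: cvgM; last exact: cvg_cst.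
    exact: (cvg_comp (fun k => harmonic k *: s) phi (cvg_harmonicZ s) (cphi 0)).
  - exact: integrable_cwt.
  - move=> k s; rewrite nrmM nrm_real ger0_norm; last first.
      by rewrite mulr_ge0 ?exprn_ge0//; exact/ltW/wt_gt0.
    rewrite -mulrA ler_wpM2r//.
      by rewrite mulr_ge0 ?exprn_ge0//; exact/ltW/wt_gt0.
    by apply: (le_trans (phiC _)); rewrite -[leRHS]mulr1 ler_wpM2l// wt_le1.
rewrite (cvg_unique (@norm_hausdorff _ R[i]) lim1 lim2) mulrC cintegralZ; last first.
  apply: (@cintegrable_wt _ (2 ^+ n)).
    apply: cmeasurable_real; apply: measurable_funM; first exact: measurable_cst.
    exact: measurable_wt.
  move=> s; rewrite nrm_real ger0_norm// mulr_ge0 ?exprn_ge0//.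
  exact/ltW/wt_gt0.
congr (_ * _); apply: complex_eq => /=; last first.
  by rewrite /Rintegral integral0.
rewrite RintegralZl//; last exact: integrable_wt.
by rewrite /Rintegral integral_wt/= exprMn.
Qed.

Lemma fourier_shift phi (t eta : 'rV[R]_n) : cintegrable mu phi ->
  fourier (fun s => phi (t + s)) eta = cis (dotp t eta) * fourier phi eta.
Proof.
move=> iphi; rewrite /fourier.
have iG : cintegrable mu (fun s => cis (- dotp s eta) * phi s).
  apply: (cintegrableMb (C := 1)) => //; last by move=> x; rewrite nrm_cis.
  apply: cmeasurable_cis; apply: measurable_funN.
  by apply: measurable_dotp => //; exact: measurable_cst.
rewrite -cintegralZ// -[RHS](cintegral_shift t (cintegrableZ _ iG)).
congr cintegral; apply/funext => s; rewrite mulrA -cisD dotpDl.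
by congr (cis _ * _); ring.
Qed.

(** Translation reduces this to the value at 0: [wt_shift] preserves the bound on [phi], and the
    transform only acquires a phase. *)
Lemma fourier_inversion phi (C C' : R) (t : 'rV[R]_n) : continuous phi ->
  (forall s, nrm (phi s) <= C * wt s) ->
  (forall eta, nrm (fourier phi eta) <= C' * wt eta) ->
  cintegral mu (fun eta => cis (dotp t eta) * fourier phi eta) =
  ((2 * pi) ^+ n)%:C * phi t.
Proof.
move=> cphi phiC fphiC.
have C0 : 0 <= C.
  have := le_trans (nrm_ge0 _) (phiC 0); rewrite pmulr_lge0//; exact: wt_gt0.
have iphi : cintegrable mu phi.
  exact: (cintegrable_wt (continuous_cmeasurable_rV cphi) phiC).
have := @fourier_inversion0 (fun s => phi (t + s)) (C * (2 ^+ n / wt t)) C'.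
rewrite addr0 => <-.
- by congr cintegral; apply/funext => eta; rewrite fourier_shift.
- move=> s; apply: (cvg_comp (fun s => t + s) phi); last exact: cphi.
  exact: continuous_addl.
- by move=> s; apply: (le_trans (phiC _)); rewrite -mulrA ler_wpM2l// wt_shift.
- by move=> eta; rewrite fourier_shift// nrmM nrm_cis mul1r.
Qed.

End fourier.

(** * Families of amplitudes and integration by parts *)

Section difference_quotient.
Context (R : realType) (E : normedModType R).
Implicit Types (a b : E -> R[i]) (d x : E).

Lemma cvg_line d x : x + t *: d @[t --> (0 : R)] --> x.
Proof.
rewrite -[X in _ --> X]addr0 -(scale0r d); apply: cvgD; first exact: cvg_cst.
by apply: cvgZl; exact: cvg_id.
Qed.

Lemma cvg_line_dnbhs d x : x + t *: d @[t --> (0 : R)^'] --> x.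
Proof. apply: (cvg_trans _ (@cvg_line d x)); apply: cvg_app; exact: cvg_within. Qed.

Lemma rquotD a b d x (la lb : R[i]) :
  rquot a d x t @[t --> (0 : R)^'] --> la -> rquot b d x t @[t --> (0 : R)^'] --> lb ->
  rquot (fun x => a x + b x) d x t @[t --> (0 : R)^'] --> la + lb.
Proof.
move=> al bl; rewrite (_ : rquot _ d x = fun t => rquot a d x t + rquot b d x t).
  exact: (ccvgD _ al bl).
by apply/funext => t; rewrite /rquot -scalerDr opprD addrACA.
Qed.

Lemma rquotZ (c : R[i]) a d x (la : R[i]) :
  rquot a d x t @[t --> (0 : R)^'] --> la ->
  rquot (fun x => c * a x) d x t @[t --> (0 : R)^'] --> c * la.
Proof.
move=> al; rewrite (_ : rquot _ d x = fun t => c * rquot a d x t).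
  exact: (ccvgMl _ al).
by apply/funext => t; rewrite /rquot /GRing.scale/=; ring.
Qed.

Lemma rquotM a b d x (la lb : R[i]) : continuous b ->
  rquot a d x t @[t --> (0 : R)^'] --> la -> rquot b d x t @[t --> (0 : R)^'] --> lb ->
  rquot (fun x => a x * b x) d x t @[t --> (0 : R)^'] --> la * b x + a x * lb.
Proof.
move=> cb al bl.
rewrite (_ : rquot _ d x = fun t => rquot a d x t * b (x + t *: d) + a x * rquot b d x t).
  have cbl := cvg_comp (fun t => x + t *: d) b (@cvg_line_dnbhs d x) (cb x).
  exact: (ccvgD _ (ccvgM _ al cbl) (ccvgMl _ bl)).
by apply/funext => t; rewrite /rquot /GRing.scale/=; ring.
Qed.

End difference_quotient.

Section amplitude.
Context (R : realType).

(* [amp k w a] : the directional derivatives of order at most [k] of the family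
   [a] exist, are continuous, and are bounded by the weight [w], uniformly in the
   parameter. *)
Fixpoint amp (E : normedModType R) (P : Type) (w : P -> E -> R) (k : nat)
    (a : P -> E -> R[i]) : Prop :=
  [/\ forall p, continuous (a p),
      exists C : R, forall p x, nrm (a p x) <= C * w p x &
  if k is k'.+1 then
    forall d, exists2 b : P -> E -> R[i], (forall p x, rquot (a p) d x t @[t --> (0 : R)^'] --> b p x) &
      amp w k' b
  else True].

Context (E : normedModType R) (P : Type).
Implicit Types (w : P -> E -> R) (a b : P -> E -> R[i]).

Lemma amp_continuous w k a : amp w k a -> forall p, continuous (a p).
Proof. by case: k => [|k] []. Qed.

Lemma amp_bounded w k a : amp w k a -> exists C : R, forall p x, nrm (a p x) <= C * w p x.
Proof. by case: k => [|k] []. Qed.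

Lemma ampS w k a : amp w k.+1 a -> amp w k a.
Proof.
elim: k a => [|k IH] a; first by case.
move=> [ca ba da]; split => // d; have [b ab ampb] := da d.
by exists b => //; exact: IH.
Qed.

Lemma amp_weight w w' k a (C : R) : (forall p x, 0 <= w p x) ->
  (forall p x, w p x <= C * w' p x) -> amp w k a -> amp w' k a.
Proof.
move=> w0 ww'; have bd b : (exists C : R, forall p x, nrm (b p x) <= C * w p x) ->
    exists C : R, forall p x, nrm (b p x) <= C * w' p x.
  move=> [D bD]; exists (`|D| * C) => p x; apply: (le_trans (bD p x)).
  rewrite -mulrA; apply: (@le_trans _ _ (`|D| * w p x)).
    by rewrite ler_wpM2r// ler_norm.
  by rewrite ler_wpM2l.
elim: k a => [|k IH] a [ca ba da]; split => //; try exact: bd.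
by move=> d; have [b ab ampb] := da d; exists b => //; exact: IH.
Qed.

Lemma amp_add w k a b : amp w k a -> amp w k b -> amp w k (fun p x => a p x + b p x).
Proof.
have bd a' b' : (exists C : R, forall p x, nrm (a' p x) <= C * w p x) ->
    (exists C : R, forall p x, nrm (b' p x) <= C * w p x) ->
    exists C : R, forall p x, nrm (a' p x + b' p x) <= C * w p x.
  move=> [C aC] [D bD]; exists (C + D) => p x; rewrite mulrDl.
  by apply: (le_trans (nrmD _ _)); rewrite lerD.
have cn a' b' : (forall p, continuous (a' p)) -> (forall p, continuous (b' p)) ->
    forall p, continuous (fun x : E => a' p x + b' p x : R[i]).
  by move=> ca cb p; exact: ccontinuousD.
elim: k a b => [|k IH] a b [ca ba da] [cb bb db]; split; try exact: bd; try exact: cn.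
  by [].
move=> d; have [a' aa' ampa] := da d; have [b' bb' ampb] := db d.
exists (fun p x => a' p x + b' p x); last exact: IH.
by move=> p x; exact: rquotD.
Qed.

Lemma amp_scale w k a (c : P -> R[i]) (M : R) : (forall p x, 0 <= w p x) ->
  (forall p, nrm (c p) <= M) -> amp w k a -> amp w k (fun p x => c p * a p x).
Proof.
move=> w0 cM.
have bd a' : (exists C : R, forall p x, nrm (a' p x) <= C * w p x) ->
    exists C : R, forall p x, nrm (c p * a' p x) <= C * w p x.
  move=> [C aC]; exists (M * `|C|) => p x; rewrite nrmM -mulrA.
  rewrite ler_pM ?nrm_ge0//; apply: (le_trans (aC p x)).
  by rewrite ler_wpM2r// ler_norm.
have cn a' : (forall p, continuous (a' p)) ->
    forall p, continuous (fun x : E => c p * a' p x : R[i]).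
  by move=> ca p x; exact: (ccvgMl _ (ca p x)).
elim: k a => [|k IH] a [ca ba da]; split; try exact: bd; try exact: cn; first by [].
move=> d; have [a' aa' ampa] := da d.
exists (fun p x => c p * a' p x); last exact: IH.
by move=> p x; exact: rquotZ.
Qed.

Lemma amp_mul w w' k a b : (forall p x, 0 <= w p x) ->
  amp w k a -> amp w' k b -> amp (fun p x => w p x * w' p x) k (fun p x => a p x * b p x).
Proof.
move=> w0.
have bd a' b' : (exists C : R, forall p x, nrm (a' p x) <= C * w p x) ->
    (exists C : R, forall p x, nrm (b' p x) <= C * w' p x) ->
    exists C : R, forall p x, nrm (a' p x * b' p x) <= C * (w p x * w' p x).
  move=> [C aC] [D bD]; exists (`|C| * D) => p x; rewrite nrmM mulrACA.
  rewrite ler_pM ?nrm_ge0//; apply: (le_trans (aC p x)).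
  by rewrite ler_wpM2r// ler_norm.
have cn a' b' : (forall p, continuous (a' p)) -> (forall p, continuous (b' p)) ->
    forall p, continuous (fun x : E => a' p x * b' p x : R[i]).
  by move=> ca cb p; exact: ccontinuousM.
elim: k a b => [|k IH] a b ampa0 ampb0; have [ca ba da] := ampa0; have [cb bb db] := ampb0.
  by split; [exact: cn|exact: bd|].
split; [exact: cn|exact: bd|].
move=> d; have [a' aa' ampa] := da d; have [b' bb' ampb] := db d.
exists (fun p x => a' p x * b p x + a p x * b' p x).
  by move=> p x; apply: rquotM.
by apply: amp_add; apply: IH => //; exact: ampS.
Qed.

End amplitude.

Section amplitude_pullback.
Context (R : realType) (E E' : normedModType R) (P P' : Type).

(** Each derivative produces a factor [e p], harmless because [e p] stays in (0, 1]; the translation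
    [c p] does not affect derivatives and may be unbounded. Dilations by a regularization parameter
    and midpoint maps are both of this form. *)
Lemma amp_pullback (w : P -> E -> R) k a (L : {linear E' -> E}) (c : P' -> E)
    (e : P' -> R) (q : P' -> P) : continuous L -> (forall p x, 0 <= w p x) ->
  (forall p, 0 < e p <= 1) -> amp w k a ->
  amp (fun p x => w (q p) (c p + e p *: L x)) k (fun p x => a (q p) (c p + e p *: L x)).
Proof.
move=> cL w0 e01.
have cA p : continuous (fun x => c p + e p *: L x).
  move=> x; apply: cvgD; first exact: cvg_cst.
  by apply: cvgZr; exact: cL.
elim: k a => [|k IH] a [ca [C aC] da]; split => //; try (by exists C);
  try by move=> p x; apply: (cvg_comp (fun x => c p + e p *: L x) (a (q p)) (cA p x)); exact: ca.
move=> d; have [b ab ampb] := da (L d).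
exists (fun p x => (e p)%:C * b (q p) (c p + e p *: L x)); last first.
  apply: (@amp_scale _ _ _ _ _ _ (fun p => (e p)%:C) 1) => //; last exact: IH.
  by move=> p; rewrite nrm_real; have /andP[? ?] := e01 p; rewrite ger0_norm// ltW.
move=> p x; have /andP[ep0 ep1] := e01 p; set y := c p + e p *: L x.
have ep : e p != 0 by rewrite gt_eqF.
rewrite (_ : rquot _ d x = fun t => (e p)%:C * rquot (a (q p)) (L d) y (e p * t)).
  apply: ccvgMl.
  apply: (cvg_comp (fun t => e p * t) (rquot (a (q p)) (L d) y) _ (ab (q p) y)).
  move=> A [r /= r0 rA]; exists (r / e p); first by rewrite /= divr_gt0.
  move=> t /=; rewrite sub0r normrN => tr t0; apply: rA => /=.
    by rewrite sub0r normrN normrM gtr0_norm// -ltr_pdivlMl// mulrC.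
  by rewrite mulf_neq0.
apply/funext => t.
have yL : c p + e p *: L (x + t *: d) = y + (e p * t) *: L d.
  have LD : L (x + t *: d) = L x + t *: L d by rewrite addrC linearP addrC.
  by rewrite LD scalerDr scalerA addrA.
rewrite /rquot yL /GRing.scale/= mulrA -rmorphM/= invfM.
by rewrite mulrA mulfV// mul1r.
Qed.

End amplitude_pullback.

Section schwartz_amplitude.
Context (R : realType) (E : normedModType R).
Implicit Types u : E -> R[i].

Definition decay (N : nat) (x : E) : R := (1 + `|x|) ^- N.

Lemma decay_ge0 N x : 0 <= decay N x.
Proof. by rewrite invr_ge0 exprn_ge0// addr_ge0. Qed.

Lemma schwartz_rderive u d : schwartz u -> schwartz (rderive d u).
Proof.
move=> [su bu]; split.
  by move=> k; have [_ /(_ d)[]] := su k.+1.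
move=> vs N; have [M hM] := bu (rcons vs d) N; exists M => x.
by have := hM x; rewrite foldr_rcons.
Qed.

Lemma schwartz_amp u k N : schwartz u -> amp (fun _ : unit => decay N) k (fun=> u).
Proof.
elim: k u => [|k IH] u Su; have [su bu] := Su.
  split => //; first by move=> _; have [] := su 0%N.
  have [M hM] := bu [::] N; exists M => _ x.
  rewrite /decay ler_pdivlMr ?exprn_gt0 ?ltr_pwDl//.
  by rewrite mulrC; exact: hM.
split.
- by move=> _; have [] := su 0%N.
- have [M hM] := bu [::] N; exists M => _ x.
  rewrite /decay ler_pdivlMr ?exprn_gt0 ?ltr_pwDl//.
  by rewrite mulrC; exact: hM.
- move=> d; exists (fun=> rderive d u); last by apply: IH; exact: schwartz_rderive.
  by move=> _ x; have [_ /(_ d)[/(_ x)]] := su 1%N.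
Qed.

Lemma rderiveE u d (b : E -> R[i]) :
  (forall x, rquot u d x t @[t --> (0 : R)^'] --> b x) -> rderive d u = b.
Proof. by move=> ub; apply/funext => x; apply: cvg_lim => //; exact: ub. Qed.

Lemma amp_class_C (w : unit -> E -> R) k u : amp w k (fun=> u) -> class_C k u.
Proof.
elim: k u => [|k IH] u [cu bu du]; split => //; try exact: (cu tt).
move=> d; have [b ub ampb] := du d; split.
  by move=> x; apply/cvg_ex; exists (b tt x); exact: (ub tt).
rewrite (rderiveE (ub tt)); apply: IH.
by rewrite (_ : (fun=> b tt) = b)//; apply/funext => -[].
Qed.

(** This converse of [schwartz_amp] transfers the stability of [amp] under products and affine maps
    to the Schwartz class, avoiding formulas for iterated derivatives. *)
Lemma amp_schwartz u : (forall k N, amp (fun _ : unit => decay N) k (fun=> u)) ->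
  schwartz u.
Proof.
move=> ampu; split; first by move=> k; exact: (amp_class_C (ampu k 0%N)).
move=> vs N.
have H : forall k, amp (fun _ : unit => decay N) k (fun=> foldr (@rderive _ _ _) u vs).
  elim: vs => [|d vs IH] k /=; first exact: ampu.
  have [_ _ /(_ d)[b ub ampb]] := IH k.+1.
  rewrite (rderiveE (ub tt)).
  by rewrite (_ : (fun=> b tt) = b)//; apply/funext => -[].
have [M hM] := amp_bounded (H 0%N); exists M => x.
have := hM tt x; rewrite /decay ler_pdivlMr ?exprn_gt0 ?ltr_pwDl//.
by rewrite mulrC.
Qed.

End schwartz_amplitude.

Lemma cvg_eqfun (T : Type) (U : topologicalType) (F : set_system T) (f g : T -> U) (l : U) :
  f =1 g -> f x @[x --> F] --> l -> g x @[x --> F] --> l.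
Proof. by move=> /funext ->. Qed.

Section wave.
Context (R : realType).

(** The addition formula factors out the wave at [x]; what remains are the derivatives at t = 0 of
    cos(t l(d)) and sin(t l(d)). *)
Lemma rquot_cis (E : normedModType R) (l : {linear E -> R}) (d x : E) (c : R) :
  rquot (fun x => cis (c + l x)) d x t @[t --> (0 : R)^'] -->
  (0 +i* l d) * cis (c + l x).
Proof.
have lD t : l (x + t *: d) = l x + t * l d by rewrite addrC linearP addrC.
pose g := cis (c + l x).
have dcos := @is_derive_cos R 0; have dsin := @is_derive_sin R 0.
have cosd : t^-1 * (cos (t * l d) - 1) @[t --> (0 : R)^'] --> (0 : R).
  have : is_derive (0 : R) (1 : R) (fun t : R => cos (t * l d)) 0.
    apply: is_derive_eq; rewrite /GRing.scale/= mul0r sin0; ring.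
  move=> [dr dv]; have := dr; rewrite /derivable => /cvg_ex[y hy].
  have yE : y = 0 by rewrite -dv /derive; apply/esym/cvg_lim.
  rewrite yE in hy; apply: cvg_eqfun hy => t /=.
  by rewrite addr0 mul0r cos0 /GRing.scale/= mulr1.
have sind : t^-1 * (sin (t * l d)) @[t --> (0 : R)^'] --> l d.
  have : is_derive (0 : R) (1 : R) (fun t : R => sin (t * l d)) (l d).
    apply: is_derive_eq; rewrite /GRing.scale/= mul0r cos0; ring.
  move=> [dr dv]; have := dr; rewrite /derivable => /cvg_ex[y hy].
  have yE : y = l d by rewrite -dv /derive; apply/esym/cvg_lim.
  rewrite yE in hy; apply: cvg_eqfun hy => t /=.
  by rewrite addr0 mul0r sin0 subr0 /GRing.scale/= mulr1.
rewrite (_ : rquot _ d x = fun t =>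
    ((t^-1 * (cos (t * l d) - 1)) +i* (t^-1 * sin (t * l d))) * g).
  apply: ccvgM; last exact: cvg_cst.
  by apply: cvg_complex.
apply/funext => t; rewrite /rquot lD addrA (cisD (c + l x)) -/g.
rewrite -[X in _ *: (_ - X)]mulr1 -mulrBr /GRing.scale/= mulrCA [RHS]mulrC; congr (_ * _).
by apply: complex_eq; rewrite ?Re_mulE ?Im_mulE ?Re_addE ?Im_addE/= ?mul0r ?subr0 ?addr0.
Qed.

Lemma continuous_cis_linear (E : normedModType R) (l : {linear E -> R}) (c : R) :
  continuous l -> continuous (fun x => cis (c + l x)).
Proof.
move=> cl x; apply: (cvg_comp (fun x => c + l x) (@cis R)); last exact: continuous_cis.
by apply: cvgD; [exact: cvg_cst|exact: cl].
Qed.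

(** The offset [c p] is free because it only contributes a factor of modulus one; the linear form is
    the same for all parameters, which bounds the derivatives uniformly. *)
Lemma amp_cis (E : normedModType R) (P : Type) (l : {linear E -> R}) (c : P -> R) k :
  continuous l -> amp (fun _ _ => 1) k (fun p x => cis (c p + l x)).
Proof.
move=> cl; elim: k => [|k IH]; split => //.
- by move=> p; exact: continuous_cis_linear.
- by exists 1 => p x; rewrite nrm_cis mul1r.
- by move=> p; exact: continuous_cis_linear.
- by exists 1 => p x; rewrite nrm_cis mul1r.
- move=> d; exists (fun p x => (0 +i* l d) * cis (c p + l x)).
    by move=> p x; exact: rquot_cis.
  by apply: (@amp_scale _ _ _ _ _ _ (fun=> 0 +i* l d) (nrm (0 +i* l d))).
Qed.

End wave.

Section mean_value.
Context (R : realType) (E : normedModType R) (b b' : E -> R[i]) (d : E).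
Hypothesis bb' : forall x, rquot b d x t @[t --> (0 : R)^'] --> b' x.

Let line x (r : R) := b (x + r *: d).

Let is_derive_part (pr : R[i] -> R) (x : E) (r : R) : continuous pr ->
  (forall z w, pr (z - w) = pr z - pr w) -> (forall (t : R) z, pr (t%:C * z) = t * pr z) ->
  is_derive r (1 : R) (fun r => pr (line x r)) (pr (b' (x + r *: d))).
Proof.
move=> cpr prB prZ.
have H : (fun h : R => h^-1 *: (((fun r => pr (line x r)) \o shift r) (h *: (1 : R)) -
    pr (line x r))) @ (0 : R)^' --> pr (b' (x + r *: d)).
  have H := cvg_comp (rquot b d (x + r *: d)) pr (@bb' (x + r *: d)) (cpr _).
  apply: cvg_eqfun H => h /=.
  rewrite /rquot /GRing.scale/= prZ prB mulr1 /line; congr (_ * (pr (b _) - _)).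
  by rewrite scalerDl addrA addrAC.
by split; [apply/cvg_ex; eexists; exact: H|apply: cvg_lim => //; exact: H].
Qed.

(** The mean value theorem is applied to the real and imaginary parts along the segment, whence the
    factor 2. *)
Lemma difference_bound (x : E) (h M : R) : 0 < h ->
  (forall r, 0 <= r <= h -> nrm (b' (x + r *: d)) <= M) ->
  nrm (b (x + h *: d) - b x) <= 2 * (M * h).
Proof.
move=> h0 bM.
have part (pr : R[i] -> R) : continuous pr ->
    (forall z w, pr (z - w) = pr z - pr w) -> (forall (t : R) z, pr (t%:C * z) = t * pr z) ->
    (forall z, `|pr z| <= nrm z) -> `|pr (b (x + h *: d) - b x)| <= M * h.
  move=> cpr prB prZ prn.
  have dr := fun r => is_derive_part x r cpr prB prZ.
  have cf : {within `[0, h], continuous (fun r => pr (line x r))}.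
    apply: continuous_subspaceT => r; apply: differentiable_continuous.
    by apply/derivable1_diffP; have [] := dr r.
  have [c c0h] := MVT h0 (fun r _ => dr r) cf.
  rewrite /line scale0r addr0 subr0 prB => ->.
  rewrite normrM (gtr0_norm h0) ler_wpM2r ?(ltW h0)//.
  apply: (le_trans (prn _)); apply: bM.
  by move: c0h; rewrite in_itv/= => /andP[/ltW -> /ltW ->].
apply: (le_trans (nrm_le_ReIm _)); rewrite mulr_natl mulr2n lerD//.
  apply: part => [||t z|z].
  - exact: continuous_Re.
  - by move=> z w; rewrite Re_addE Re_oppE.
  - by rewrite Re_mulE/= mul0r subr0.
  - exact: Re_le_nrm.
apply: part => [||t z|z].
- exact: continuous_Im.
- by move=> z w; rewrite Im_addE Im_oppE.
- by rewrite Im_mulE/= mul0r addr0.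
- exact: Im_le_nrm.
Qed.

End mean_value.

(** * Integration by parts from translation invariance *)

Section integration_by_parts.
Context (R : realType) (n : nat).
Local Notation mu := (lebesgue_rV R n).
Implicit Types (b : 'rV[R]_n -> R[i]).

Lemma wt_scale_ge (d : 'rV[R]_n) (r : R) : 0 <= r <= 1 -> wt d <= wt (r *: d).
Proof.
move=> /andP[r0 r1]; apply: ler_prod => i _.
have p0 (a : R) : 0 < 1 + a ^+ 2 by rewrite ltr_wpDr// sqr_ge0.
rewrite mxE invr_ge0 ltW//= lef_pV2 ?posrE// lerD2l exprMn -[leRHS]mul1r.
by rewrite ler_wpM2r ?sqr_ge0// expr_le1.
Qed.

(** By translation invariance every difference quotient has integral 0, and dominated convergence
    passes to the derivative; no boundary terms appear. *)
Lemma cintegral_derivative b b' (d : 'rV[R]_n) (C C' : R) : continuous b -> continuous b' ->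
  (forall x, rquot b d x t @[t --> (0 : R)^'] --> b' x) ->
  (forall x, nrm (b x) <= C * wt x) -> (forall x, nrm (b' x) <= C' * wt x) ->
  cintegral mu b' = 0.
Proof.
move=> cb cb' bb' bC b'C.
have mb := continuous_cmeasurable_rV cb; have mb' := continuous_cmeasurable_rV cb'.
have ib : cintegrable mu b := cintegrable_wt mb bC.
have C'0 : 0 <= C'.
  have := le_trans (nrm_ge0 _) (b'C 0); rewrite pmulr_lge0//; exact: wt_gt0.
have ishift (h : R) : cintegrable mu (fun x => b (h *: d + x)) := cintegrable_shift _ ib.
pose q (k : nat) x := ((harmonic k)^-1)%:C * (b (harmonic k *: d + x) - b x).
have mq k : cmeasurable (q k).
  apply: cmeasurableM; first exact: cmeasurable_cst.
  by apply: cmeasurableD; [exact: (ishift _).1|exact: cmeasurableN].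
have q0 k : cintegral mu (q k) = 0.
  rewrite cintegralZ; last exact: cintegrableB.
  by rewrite cintegralB// cintegral_shift// subrr mulr0.
have qlim : cintegral mu (q k) @[k --> \oo] --> cintegral mu b'.
  (* The 2 is that of [difference_bound]; for 0 <= r <= 1, [wt_shift] and [wt_scale_ge] bound wt(x +
     r d) by (2^n / wt d) wt(x). *)
  apply: (@cintegral_dominated R _ _ mu _ _ (fun x => (2 * (C' * (2 ^+ n / wt d))) * wt x)).
  - exact: mq.
  - exact: mb'.
  - move=> x.
    have h0 : harmonic k @[k --> \oo] --> (0 : R)^'.
      move=> A [r /= r0 rA].
      have /cvgrPdist_lt/(_ r r0) := @cvg_harmonic R.
      by apply: filterS => k hk; apply: rA => //=; rewrite gt_eqF// harmonic_gt0.
    have H := cvg_comp (@harmonic R) (rquot b d x) h0 (bb' x).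
    by apply: cvg_eqfun H => k /=; rewrite /q /rquot (addrC x).
  - exact: integrable_cwt.
  - move=> k x; rewrite /q nrmM nrm_real.
    have hk0 : 0 < harmonic k :> R by exact: harmonic_gt0.
    rewrite gtr0_norm ?invr_gt0// ler_pdivrMl// (addrC (_ *: d)).
    have hk1 : harmonic k <= 1 :> R by rewrite invf_le1// ler1n.
    have := @difference_bound R _ b b' d bb' x (harmonic k) (C' * (2 ^+ n / wt d * wt x)) hk0.
    have -> : 2 * (C' * (2 ^+ n / wt d * wt x) * harmonic k) =
      harmonic k * (2 * (C' * (2 ^+ n / wt d)) * wt x) by ring.
    apply=> r /andP[r0 rh]; apply: (le_trans (b'C _)); rewrite ler_wpM2l//.
    rewrite addrC; apply: (le_trans (wt_shift _ _)); rewrite ler_wpM2r ?(ltW (wt_gt0 _))//.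
    rewrite ler_wpM2l ?exprn_ge0// lef_pV2 ?posrE ?wt_gt0//.
    by apply: wt_scale_ge; rewrite r0 (le_trans rh).
move: qlim; under eq_fun do rewrite q0.
by move=> qlim; apply: (cvg_unique (@norm_hausdorff _ R[i]) qlim); exact: cvg_cst.
Qed.

End integration_by_parts.

Section dot_linear.
Context (R : realType) (n : nat).

Definition dotr (eta s : 'rV[R]_n) : R := dotp s eta.

Lemma dotr_is_linear eta : linear (dotr eta).
Proof. by move=> c s t; rewrite /dotr dotpDl dotpZl. Qed.

HB.instance Definition _ eta :=
  GRing.isLinear.Build R 'rV[R]_n R _ (dotr eta) (dotr_is_linear eta).

Lemma continuous_dotr eta : continuous (dotr eta).
Proof.
apply: continuous_big => [|i _ x]; first exact: add_continuous.
apply: (cvg_comp (fun x : 'rV[R]_n => x ord0 i) ( *%R^~ (eta ord0 i))).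
  exact: coord_continuous.
exact: mulrr_continuous.
Qed.

End dot_linear.

(** * Decay of Fourier transforms from derivatives of the amplitude *)

Section fourier_decay.
Context (R : realType) (n : nat).
Local Notation mu := (lebesgue_rV R n).

Lemma dotr_delta (eta : 'rV[R]_n) j : dotr eta (delta_mx ord0 j) = eta ord0 j.
Proof.
rewrite /dotr /dotp (bigD1 j)//= mxE !eqxx mul1r big1 ?addr0// => i ij.
by rewrite mxE (negbTE ij) andbF mul0r.
Qed.

Lemma cintegrable_fourier (phi : 'rV[R]_n -> R[i]) eta : cintegrable mu phi ->
  cintegrable mu (fun s => cis (- dotp s eta) * phi s).
Proof.
move=> iphi; apply: (cintegrableMb (C := 1)) => //; last by move=> x; rewrite nrm_cis.
apply: cmeasurable_cis; apply: measurable_funN.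
by apply: measurable_dotp => //; exact: measurable_cst.
Qed.

Lemma fourierD (phi psi : 'rV[R]_n -> R[i]) eta :
  cintegrable mu phi -> cintegrable mu psi ->
  fourier (fun s => phi s + psi s) eta = fourier phi eta + fourier psi eta.
Proof.
move=> iphi ipsi; rewrite /fourier -cintegralD; last 2 first.
- exact: cintegrable_fourier.
- exact: cintegrable_fourier.
by congr cintegral; apply/funext => s; rewrite mulrDr.
Qed.

(** The derivative along [d] of the wave times [a] has integral 0, and the product rule splits it
    into the two transforms. *)
Lemma fourier_derivative (a b : 'rV[R]_n -> R[i]) (d : 'rV[R]_n) (C C' : R) eta :
  continuous a -> continuous b ->
  (forall x, rquot a d x t @[t --> (0 : R)^'] --> b x) ->
  (forall x, nrm (a x) <= C * wt x) -> (forall x, nrm (b x) <= C' * wt x) ->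
  fourier b eta = (0 +i* dotp d eta) * fourier a eta.
Proof.
move=> ca cb ab aC bC'.
have ma := continuous_cmeasurable_rV ca; have mb := continuous_cmeasurable_rV cb.
pose e (s : 'rV[R]_n) := cis (0 + dotr (- eta) s).
have eE s : cis (- dotp s eta) = e s by rewrite /e add0r /dotr dotpNr.
have ce : continuous e by apply: continuous_cis_linear; exact: continuous_dotr.
have ne s : nrm (e s) = 1 by rewrite nrm_cis.
have ia : cintegrable mu (fun s => e s * a s).
  under eq_fun do rewrite -eE.
  by apply: cintegrable_fourier; exact: cintegrable_wt aC.
have ib : cintegrable mu (fun s => e s * b s).
  under eq_fun do rewrite -eE.
  by apply: cintegrable_fourier; exact: cintegrable_wt bC'.
pose b' s := (0 +i* dotr (- eta) d) * e s * a s + e s * b s.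
have h : cintegral mu b' = 0.
  apply: (@cintegral_derivative R n (fun s => e s * a s) b' d C
    (`|dotr (- eta) d| * C + C')).
  - exact: (ccontinuousM ce ca).
  - have ce' : continuous (fun s => (0 +i* dotr (- eta) d) * e s).
      by move=> s; exact: (ccvgMl _ (ce s)).
    exact: (ccontinuousD (ccontinuousM ce' ca) (ccontinuousM ce cb)).
  - move=> x.
    have H := @rquot_cis R _ (dotr (- eta)) d x 0.
    exact: (rquotM ca H (ab x)).
  - by move=> x; rewrite nrmM ne mul1r.
  - move=> x; apply: (le_trans (nrmD _ _)); rewrite !nrmM ne mul1r mulr1 mulrDl lerD//.
    rewrite -mulrA ler_pM ?nrm_ge0//.
    by apply: (le_trans (nrm_le_ReIm _)); rewrite /= normr0 add0r.
move: h; rewrite /b'.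
under eq_fun do rewrite -mulrA.
rewrite cintegralD//; last exact: cintegrableZ.
rewrite cintegralZ// => /eqP; rewrite addrC addr_eq0 => /eqP h.
rewrite /fourier; under [in LHS]eq_fun do rewrite eE.
under [in RHS]eq_fun do rewrite eE.
rewrite h -mulNr /dotr dotpNr; congr (_ * _).
by apply: complex_eq; rewrite ?Re_oppE ?Im_oppE/= ?oppr0 ?opprK.
Qed.

(* Multiplying the transform by 1 + i d.eta amounts to replacing the amplitude by
   its sum with its derivative along [d]. *)
Lemma amp_fourier_bound (P : Type) (a : P -> 'rV[R]_n -> R[i]) (js : seq 'rV[R]_n) :
  amp (fun _ x => wt x) (size js) a ->
  exists C : R, forall p (eta : 'rV[R]_n),
    nrm ((\prod_(d <- js) (1 +i* dotp d eta)) * fourier (a p) eta) <= C.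
Proof.
elim: js a => [|d js IH] a /=.
  move=> [ca [C aC] _]; exists (2 * Rintegral mu setT (fun x => C * wt x)) => p eta.
  rewrite big_nil mul1r; apply: nrm_cintegral_le.
  - apply: cmeasurableM; last exact: continuous_cmeasurable_rV.
    apply: cmeasurable_cis; apply: measurable_funN.
    by apply: measurable_dotp => //; exact: measurable_cst.
  - exact: integrable_cwt.
  - by move=> x; rewrite nrmM nrm_cis mul1r.
move=> ampa; have [ca [C aC] /(_ d)[b ab ampb]] := ampa.
have [C' bC'] := amp_bounded ampb.
have [D hD] := IH _ (amp_add (ampS ampa) ampb).
exists D => p eta; have := hD p eta; congr (nrm _ <= _).
have cb : continuous (b p) by exact: (amp_continuous ampb).
have ia := cintegrable_wt (continuous_cmeasurable_rV (ca p)) (aC p).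
have ib := cintegrable_wt (continuous_cmeasurable_rV cb) (bC' p).
rewrite big_cons [X in _ = X * _]mulrC -mulrA; congr (_ * _).
rewrite (fourierD eta ia ib) (fourier_derivative eta (ca p) cb (ab p) (aC p) (bC' p)).
rewrite -[X in X + _]mul1r -mulrDl; congr (_ * _).
by apply: complex_eq; rewrite ?Re_addE ?Im_addE/= ?addr0 ?add0r.
Qed.

(** Each coordinate direction is used twice because |1 + i eta_j|^2 = 1 + eta_j^2: the product over
    [js ++ js] then has modulus exactly 1 / wt(eta). This is the origin of the order 2n. *)
Lemma amp_fourier_decay (P : Type) (a : P -> 'rV[R]_n -> R[i]) :
  amp (fun _ x => wt x) (2 * n) a ->
  exists C : R, forall p eta, nrm (fourier (a p) eta) <= C * wt eta.
Proof.
move=> ampa.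
pose js := [seq delta_mx ord0 j | j : 'I_n] : seq 'rV[R]_n.
have := @amp_fourier_bound P a (js ++ js).
rewrite size_cat size_map size_enum_ord addnn -mul2n => /(_ ampa)[C hC]; exists C => p eta.
have := hC p eta; rewrite nrmM.
have -> : nrm (\prod_(d <- js ++ js) (1 +i* dotp d eta)) = (wt eta)^-1.
  rewrite big_cat/= big_image/= -big_split/=.
  rewrite (big_morph _ (@nrmM R) (_ : nrm (1 : R[i]) = 1)); last first.
    by rewrite /nrm normr1.
  rewrite /wt /rV_prod -prodfV; apply: eq_bigr => i _.
  by rewrite nrmM -expr2 nrm_sqr/= expr1n invrK -/(dotr _ _) dotr_delta.
by rewrite ler_pdivrMl ?wt_gt0// mulrC.
Qed.

End fourier_decay.

(** * The Weyl calculus as an absolutely convergent integral *)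

Section product_change_of_variables.
Context (R : realType) d1 d2 (T1 : measurableType d1) (T2 : measurableType d2)
  (m1 : {sigma_finite_measure set T1 -> \bar R})
  (m2 : {sigma_finite_measure set T2 -> \bar R}) (phi : T1 * T2 -> T2).
Hypotheses (mphi : measurable_fun setT phi)
  (phiE : forall x (h : T2 -> \bar R), measurable_fun setT h -> (forall y, (0 <= h y)%E) ->
    (\int[m2]_y h (phi (x, y)) = \int[m2]_y h y)%E).
Implicit Types f : T1 * T2 -> R[i].

Let sh (z : T1 * T2) : T1 * T2 := (z.1, phi z).

Let measurable_sh : measurable_fun setT sh.
Proof. by apply: measurable_fun_pair => //; exact: measurable_fst. Qed.

(** The map [phi] may depend on the first variable as long as each fibre map preserves [m2], so
    shears are covered. *)
Lemma cintegrable_fiber f : cintegrable (prod_measure m1 m2) f ->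
  cintegrable (prod_measure m1 m2) (fun z => f (z.1, phi z)).
Proof.
move=> [mf foo].
have mnf : measurable_fun setT (fun z => (nrm (f z))%:E).
  by apply/measurable_EFinP; exact: measurable_nrm.
apply: cintegrable_prod; first exact: (cmeasurable_comp measurable_sh mf).
under eq_integral => x _.
  rewrite (phiE x (h := fun y => (nrm (f (x, y)))%:E)); first over.
    exact: (measurableT_comp mnf (measurable_pair1 x)).
  by move=> y; rewrite lee_fin nrm_ge0.
rewrite -(fubini_tonelli1 (fun z => (nrm (f z))%:E))// => z.
by rewrite lee_fin nrm_ge0.
Qed.

Lemma cintegral_fiber f : cintegrable (prod_measure m1 m2) f ->
  cintegral (prod_measure m1 m2) (fun z => f (z.1, phi z)) =
  cintegral (prod_measure m1 m2) f.
Proof.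
move=> fi; have fi' := cintegrable_fiber fi.
rewrite -(cfubini1 fi) -(cfubini1 fi').
apply: cintegral_ae.
- exact: (cmeasurable_cintegral m2 fi'.1).
- exact: (cmeasurable_cintegral m2 fi.1).
- have := cintegrable_section fi; apply: filterS => x /= fx _.
  have := @cintegral_comp_scale _ _ _ m2 (fun y => phi (x, y)) 1 _ _ fx.
  rewrite mul1r; apply=> h mh h0; rewrite mul1e; exact: phiE.
Qed.

End product_change_of_variables.

Section lebesgue_scaling.
Context (R : realType) (n : nat).
Local Notation mu := (@dx R n).
Let c : R := (2 * pi) ^- n.

Lemma integral_dxi (h : 'rV[R]_n -> \bar R) : measurable_fun setT h ->
  (forall x, (0 <= h x)%E) -> (\int[@dxi R n]_x h x = c%:E * \int[mu]_x h x)%E.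
Proof.
move=> mh h0.
exact: (@ge0_integral_mscale _ _ R mu _ measurableT (NngNum (two_pi_expN_ge0 R n)) h mh).
Qed.

Lemma two_pi_expN_gt0 : 0 < c.
Proof. by rewrite invr_gt0 exprn_gt0// mulr_gt0// pi_gt0. Qed.

Lemma cintegrable_dxi (f : 'rV[R]_n -> R[i]) : cintegrable (@dxi R n) f <-> cintegrable mu f.
Proof.
have E : cmeasurable f ->
    (\int[@dxi R n]_x (nrm (f x))%:E = c%:E * \int[mu]_x (nrm (f x))%:E)%E.
  move=> mf; apply: integral_dxi.
    by apply/measurable_EFinP; exact: measurable_nrm.
  by move=> x; rewrite lee_fin nrm_ge0.
have I0 : (0 <= \int[mu]_x (nrm (f x))%:E)%E.
  by apply: integral_ge0 => x _; rewrite lee_fin nrm_ge0.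
split=> -[mf foo]; split => //.
  move: foo; rewrite E//; move: I0; case: (integral _ _ _) => [r||]//=.
    by move=> _ _; exact: ltry.
  by rewrite gt0_muley ?lte_fin ?two_pi_expN_gt0.
by rewrite E// lte_mul_pinfty// lee_fin ltW// two_pi_expN_gt0.
Qed.

Let Rintegral_dxi (h : 'rV[R]_n -> R) : mu.-integrable setT (EFin \o h) ->
  Rintegral (@dxi R n) setT h = c * Rintegral mu setT h.
Proof.
move=> ih; have mh := measurable_int _ ih; rewrite /Rintegral.
rewrite [in LHS]integralE [in RHS]integralE.
rewrite integral_dxi; [|exact: measurable_funepos|by move=> x; exact: funepos_ge0].
rewrite integral_dxi; [|exact: measurable_funeneg|by move=> x; exact: funeneg_ge0].
have fp := integrable_fin_num measurableT (integrable_funepos measurableT ih).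
have fn := integrable_fin_num measurableT (integrable_funeneg measurableT ih).
rewrite -muleBr//; last by rewrite fin_num_adde_defr.
by rewrite fineM// fin_numB fp fn.
Qed.

Lemma cintegral_dxi (f : 'rV[R]_n -> R[i]) : cintegrable mu f ->
  cintegral (@dxi R n) f = c%:C * cintegral mu f.
Proof.
move=> fi; apply: complex_eq; rewrite ?Re_mulE ?Im_mulE/= mul0r ?subr0 ?addr0.
  by rewrite (Rintegral_dxi (cintegrable_Re fi)).
by rewrite (Rintegral_dxi (cintegrable_Im fi)).
Qed.

Lemma integral_dx_shift (a : 'rV[R]_n) (h : 'rV[R]_n -> \bar R) : measurable_fun setT h ->
  (forall x, (0 <= h x)%E) -> (\int[mu]_x h (a + x)%R = \int[mu]_x h x)%E.
Proof.
move=> mh h0; have := ge0_integral_rV_affine a ltr01 mh h0.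
rewrite invr1 expr1n mul1e => <-.
by apply: eq_integral => x _; rewrite scale1r.
Qed.

Lemma integral_dxi_shift (a : 'rV[R]_n) (h : 'rV[R]_n -> \bar R) : measurable_fun setT h ->
  (forall x, (0 <= h x)%E) -> (\int[@dxi R n]_x h (a + x)%R = \int[@dxi R n]_x h x)%E.
Proof.
move=> mh h0; rewrite !integral_dxi//; last first.
  by apply: (measurableT_comp mh); apply: measurable_rVD => //; exact: measurable_cst.
by rewrite integral_dx_shift.
Qed.

End lebesgue_scaling.

Section prod_swap.
Context (R : realType) d1 d2 (T1 : measurableType d1) (T2 : measurableType d2)
  (m1 : {sigma_finite_measure set T1 -> \bar R})
  (m2 : {sigma_finite_measure set T2 -> \bar R}).
Implicit Types f : T1 * T2 -> R[i].

Lemma cintegral_swap f : cintegrable (prod_measure m1 m2) f ->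
  cintegral (prod_measure m2 m1) (fun z => f (z.2, z.1)) =
  cintegral (prod_measure m1 m2) f.
Proof.
move=> fi; rewrite -(cfubini1 fi) (cfubini fi).
by rewrite -(cfubini1 (cintegrable_swap fi)).
Qed.

End prod_swap.

Section phase_shift.
Context (R : realType) (n : nat).
Local Notation mu := (@dX R n).
Implicit Types f : phase R n -> R[i].

(** The components are translated one at a time, the factors being exchanged in between so that the
    second factor is always the one acted on. *)
Lemma cintegrable_phase_shift f (A : phase R n) : cintegrable mu f ->
  cintegrable mu (fun X => f (A + X)).
Proof.
move=> fi.
pose phi2 (z : 'rV[R]_n * 'rV[R]_n) := A.2 + z.2.
have m2 : measurable_fun setT phi2.
  by apply: measurable_rVD; [exact: measurable_cst|exact: measurable_snd].
have h1 := cintegrable_fiber m2 (fun x => @integral_dxi_shift R n A.2) fi.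
pose phi1 (z : 'rV[R]_n * 'rV[R]_n) := A.1 + z.2.
have m1 : measurable_fun setT phi1.
  by apply: measurable_rVD; [exact: measurable_cst|exact: measurable_snd].
have h2 := cintegrable_fiber m1 (fun x => @integral_dx_shift R n A.1) (cintegrable_swap h1).
exact: (cintegrable_swap h2).
Qed.

Lemma cintegral_phase_shift f (A : phase R n) : cintegrable mu f ->
  cintegral mu (fun X => f (A + X)) = cintegral mu f.
Proof.
move=> fi.
pose phi2 (z : 'rV[R]_n * 'rV[R]_n) := A.2 + z.2.
have m2 : measurable_fun setT phi2.
  by apply: measurable_rVD; [exact: measurable_cst|exact: measurable_snd].
have h1 := cintegrable_fiber m2 (fun x => @integral_dxi_shift R n A.2) fi.
rewrite -(cintegral_fiber m2 (fun x => @integral_dxi_shift R n A.2) fi).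
pose phi1 (z : 'rV[R]_n * 'rV[R]_n) := A.1 + z.2.
have m1 : measurable_fun setT phi1.
  by apply: measurable_rVD; [exact: measurable_cst|exact: measurable_snd].
have h2 := cintegrable_fiber m1 (fun x => @integral_dx_shift R n A.1) (cintegrable_swap h1).
rewrite -(cintegral_swap h1).
rewrite -(cintegral_fiber m1 (fun x => @integral_dx_shift R n A.1) (cintegrable_swap h1)).
exact: (cintegral_swap h2).
Qed.

(* Unit Jacobian of (x, s) = (m + y/2, m - y/2). *)
Lemma cintegral_midpoint (f : 'rV[R]_n * 'rV[R]_n -> R[i]) :
  cintegrable (prod_measure (@dx R n) dx) f ->
  cintegral dx (fun x => cintegral dx (fun s => f (x, s))) =
  cintegral dx (fun m => cintegral dx (fun y => f (m + 2^-1 *: y, m - 2^-1 *: y))).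
Proof.
move=> fi.
(* The substitution is a composite of two measure-preserving shears: s = x - y at fixed x, then x =
   m + y / 2 at fixed y. *)
pose phi1 (z : 'rV[R]_n * 'rV[R]_n) := z.1 - z.2.
have m1 : measurable_fun setT phi1.
  by apply: measurable_rVB; [exact: measurable_fst|exact: measurable_snd].
have e1 x (h : 'rV[R]_n -> \bar R) : measurable_fun setT h -> (forall y, (0 <= h y)%E) ->
    (\int[dx]_y h (phi1 (x, y)) = \int[dx]_y h y)%E.
  move=> mh h0; rewrite -(integral_dx_shift x mh h0) -(ge0_integral_rVN (f := fun y => h (x + y)))//.
  by apply: (measurableT_comp mh); apply: measurable_rVD => //; exact: measurable_cst.
have h1 := cintegrable_fiber m1 e1 fi.
rewrite (cfubini1 fi) -(cintegral_fiber m1 e1 fi) -(cintegral_swap h1).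
pose phi2 (z : 'rV[R]_n * 'rV[R]_n) := 2^-1 *: z.1 + z.2.
have m2 : measurable_fun setT phi2.
  by apply: measurable_rVD; [apply: measurable_rVZ; exact: measurable_fst|exact: measurable_snd].
have e2 x := @integral_dx_shift R n (2^-1 *: x).
have h2 := cintegrable_fiber m2 e2 (cintegrable_swap h1).
rewrite -(cintegral_fiber m2 e2 (cintegrable_swap h1)) -(cintegral_swap h2).
rewrite -(cfubini1 (cintegrable_swap h2)).
congr cintegral; apply/funext => m; congr cintegral; apply/funext => y /=.
rewrite /phi2 /phi1 /=; congr (f (_, _)); first by rewrite addrC.
rewrite [2^-1 *: y + m]addrC -addrA; congr (_ + _).
rewrite -[X in _ - X]scale1r -scalerBl -scaleNr; congr (_ *: _); by field.
Qed.

End phase_shift.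

(** * Stability properties of Schwartz functions *)

Section schwartz_facts.
Context (R : realType).

Let le_add_mul1D (a b : R) : 0 <= a -> 0 <= b -> a + b <= (1 + a) * (1 + b) - 1.
Proof. nra. Qed.

Let le_mul1D (a b : R) : 0 <= a -> 0 <= b -> a <= (1 + a) * (1 + b) - 1.
Proof. nra. Qed.

Lemma amp_ext (E : normedModType R) P (w : P -> E -> R) k (a b : P -> E -> R[i]) :
  (forall p x, a p x = b p x) -> amp w k a -> amp w k b.
Proof. by move=> ab; rewrite (_ : a = b)//; apply/funext => p; apply/funext => x. Qed.

Lemma schwartz_continuous (E : normedModType R) (u : E -> R[i]) : schwartz u -> continuous u.
Proof. by move=> [/(_ 0%N)[]]. Qed.

Lemma schwartz_amp1 (E : normedModType R) (u : E -> R[i]) k : schwartz u ->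
  amp (fun (_ : unit) _ => 1) k (fun=> u).
Proof.
move=> Su; apply: (@amp_weight _ _ _ (fun _ => decay 0) _ _ _ 1); last exact: schwartz_amp.
- by move=> _ x; exact: decay_ge0.
- by move=> _ x; rewrite /decay expr0 invr1 mul1r.
Qed.

Lemma decay_wt n (x : 'rV[R]_n) : decay (2 * n) x <= wt x.
Proof.
rewrite /decay -[leLHS]mul1r ler_pdivrMr ?exprn_gt0 ?ltr_pwDl// mulrC.
exact: wt_norm.
Qed.

Lemma schwartz_amp_wt n (u : 'rV[R]_n -> R[i]) k : schwartz u ->
  amp (fun (_ : unit) x => wt x) k (fun=> u).
Proof.
move=> Su; apply: (@amp_weight _ _ _ (fun _ => decay (2 * n)) _ _ _ 1).
- by move=> _ x; exact: decay_ge0.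
- by move=> _ x; rewrite mul1r decay_wt.
- exact: schwartz_amp.
Qed.

Lemma schwartz_wt n (u : 'rV[R]_n -> R[i]) : schwartz u ->
  exists C : R, forall x, nrm (u x) <= C * wt x.
Proof.
by move=> /(schwartz_amp_wt 0)/amp_bounded[C hC]; exists C => x; exact: hC tt x.
Qed.

Lemma schwartz_bounded (E : normedModType R) (u : E -> R[i]) : schwartz u ->
  exists C : R, forall x, nrm (u x) <= C.
Proof.
move=> /(schwartz_amp1 0)/amp_bounded[C hC]; exists C => x.
by have := hC tt x; rewrite mulr1.
Qed.

Lemma schwartz_cmeasurable n (u : 'rV[R]_n -> R[i]) : schwartz u -> cmeasurable u.
Proof. by move=> /schwartz_continuous; exact: continuous_cmeasurable_rV. Qed.

Lemma schwartz_cintegrable n (u : 'rV[R]_n -> R[i]) : schwartz u -> cintegrable dx u.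
Proof.
move=> Su; have [C uC] := schwartz_wt Su.
exact: (cintegrable_wt (schwartz_cmeasurable Su) uC).
Qed.

Lemma schwartz_tensor (E1 E2 : normedModType R) (u1 : E1 -> R[i]) (u2 : E2 -> R[i]) :
  schwartz u1 -> schwartz u2 -> schwartz (fun z : E1 * E2 => u1 z.1 * u2 z.2).
Proof.
move=> S1 S2; apply: amp_schwartz => k N.
have c1 : continuous (fst : E1 * E2 -> E1) by move=> z; exact: cvg_fst.
have c2 : continuous (snd : E1 * E2 -> E2) by move=> z; exact: cvg_snd.
have D0 (E : normedModType R) (p : unit) (x : E) : 0 <= decay N x by exact: decay_ge0.
have e01 (p : unit) : 0 < (1 : R) <= 1 by rewrite ltr01 lexx.
have A1 := @amp_pullback R E1 (E1 * E2)%type unit unit (fun _ => decay N) k (fun=> u1)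
  fst (fun=> 0) (fun=> 1) id c1 (D0 E1) e01 (schwartz_amp k N S1).
have A2 := @amp_pullback R E2 (E1 * E2)%type unit unit (fun _ => decay N) k (fun=> u2)
  snd (fun=> 0) (fun=> 1) id c2 (D0 E2) e01 (schwartz_amp k N S2).
have A12 := amp_mul (fun p x => D0 _ p _) A1 A2.
apply: (amp_ext _ (amp_weight (C := 1) _ _ A12)).
- by move=> p [x1 x2] /=; rewrite !add0r !scale1r.
- by move=> p x; apply: mulr_ge0; exact: decay_ge0.
(* The norm of a pair is the maximum, and 1 + max(a, b) <= (1 + a) (1 + b). *)
- move=> p [x1 x2] /=; rewrite !add0r !scale1r mul1r /decay -invfM -exprMn.
  rewrite lef_pV2 ?posrE ?exprn_gt0 ?mulr_gt0 ?ltr_pwDl//.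
  rewrite lerXn2r ?nnegrE ?addr_ge0 ?mulr_ge0 ?addr_ge0//.
  rewrite prod_normE/= -lerBrDl ge_max; apply/andP.
  by split; [|rewrite mulrC]; exact: le_mul1D.
Qed.

Lemma schwartz_shift (E : normedModType R) (u : E -> R[i]) (c : E) :
  schwartz u -> schwartz (fun x => u (c + x)).
Proof.
move=> Su; apply: amp_schwartz => k N.
have e01 (p : unit) : 0 < (1 : R) <= 1 by rewrite ltr01 lexx.
have ci : continuous (idfun : E -> E) by move=> z; exact: cvg_id.
have A1 := @amp_pullback R E E unit unit (fun _ => decay N) k (fun=> u)
  idfun (fun=> c) (fun=> 1) id ci (fun _ x => decay_ge0 N x) e01 (schwartz_amp k N Su).
(* The constant comes from 1 + |x| <= (1 + |c|) (1 + |c + x|). *)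
apply: (amp_ext _ (amp_weight (C := (1 + `|c|) ^+ N) _ _ A1)).
- by move=> p x /=; rewrite scale1r.
- by move=> p x; exact: decay_ge0.
- move=> p x /=; rewrite scale1r /decay.
  rewrite ler_pdivlMr ?exprn_gt0 ?ltr_pwDl// mulrC -ler_pdivlMr ?invr_gt0 ?exprn_gt0 ?ltr_pwDl//.
  rewrite invrK -exprMn lerXn2r ?nnegrE ?addr_ge0 ?mulr_ge0 ?addr_ge0//.
  have := ler_normB (c + x) c; rewrite addrC addKr => h.
  apply: (@le_trans _ _ (1 + (`|c + x| + `|c|))); first by rewrite lerD2l.
  by rewrite addrC -lerBrDr addrC; exact: le_add_mul1D.
Qed.

Lemma schwartz_cis_mul (E : normedModType R) (l : {linear E -> R}) (c : R) (u : E -> R[i]) :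
  continuous l -> schwartz u -> schwartz (fun x => cis (c + l x) * u x).
Proof.
move=> cl Su; apply: amp_schwartz => k N.
have A1 := @amp_cis R E unit l (fun=> c) k cl.
have A12 := amp_mul (fun p x => ler01) A1 (schwartz_amp k N Su).
apply: (amp_weight _ _ A12 (C := 1)).
- by move=> p x; rewrite mul1r decay_ge0.
- by move=> p x.
Qed.

Lemma schwartz_scale (E : normedModType R) (c : R[i]) (u : E -> R[i]) :
  schwartz u -> schwartz (fun x => c * u x).
Proof.
move=> Su; apply: amp_schwartz => k N.
by apply: (@amp_scale _ _ _ _ _ _ (fun=> c) (nrm c)) => [p x|//|];
  [exact: decay_ge0|exact: schwartz_amp].
Qed.

End schwartz_facts.

Lemma continuous_inlZ (R : realType) (E : normedModType R) (c : R) :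
  continuous (fun s : E => (c *: s, 0 : E)).
Proof.
move=> s; apply: (@cvg_pair _ _ _ _ (nbhs (c *: s)) (nbhs (0 : E))); last exact: cvg_cst.
by apply: cvgZr; exact: cvg_id.
Qed.

Section half_inclusion.
Context (R : realType) (n : nat).

(** The linear part of the map sending s to ((x + s) / 2, eta), along which a Weyl symbol is pulled
    back. *)
Definition half_inl (s : 'rV[R]_n) : phase R n := (2^-1 *: s, 0).

Lemma half_inl_is_linear : linear half_inl.
Proof.
move=> c s t; apply: injective_projections => /=; last by rewrite scaler0 addr0.
by rewrite scalerDr !scalerA mulrC.
Qed.

HB.instance Definition _ :=
  GRing.isLinear.Build R 'rV[R]_n (phase R n) _ half_inl half_inl_is_linear.

Lemma continuous_half_inl : continuous half_inl.
Proof.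
exact: continuous_inlZ.
Qed.

End half_inclusion.

(** * Weyl operators acting on Schwartz functions *)

Section weyl.
Context (R : realType) (n : nat).
Variables (g : phase R n -> R[i]) (u : 'rV[R]_n -> R[i]).
Hypotheses (gA : forall k, amp (fun (_ : unit) _ => 1) k (fun=> g)) (Su : schwartz u).

Definition weyl_amp (x eta s : 'rV[R]_n) : R[i] := g (2^-1 *: (x + s), eta) * u s.

(** The Weyl integrand after integration over the configuration variable, as a function of the
    remaining momentum. *)
Definition weyl_fiber (x eta : 'rV[R]_n) : R[i] :=
  cis (dotp x eta) * fourier (weyl_amp x eta) eta.

Let symbol_amp k : amp (fun _ _ => 1) k
  (fun (p : phase R n) s => g (2^-1 *: (p.1 + s), p.2)).
Proof.
have e01 (p : phase R n) : 0 < (1 : R) <= 1 by rewrite ltr01 lexx.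
have A1 := @amp_pullback R (phase R n) 'rV[R]_n unit (phase R n) (fun _ _ => 1) k (fun=> g)
  (@half_inl R n) (fun p => (2^-1 *: p.1, p.2)) (fun=> 1) (fun=> tt)
  (@continuous_half_inl R n) (fun _ _ => ler01) e01 (gA k).
apply: (amp_ext _ A1) => p s /=; congr g.
by rewrite scale1r /half_inl scalerDr; congr pair; rewrite /= addr0.
Qed.

Lemma symbol_bounded : exists C : R, forall X, nrm (g X) <= C.
Proof.
have [C hC] := amp_bounded (gA 0); exists C => X.
by have := hC tt X; rewrite mulr1.
Qed.

Lemma symbol_continuous : continuous g.
Proof. exact: (@amp_continuous _ _ _ _ _ _ (gA 0) tt). Qed.

Let u_amp (P : Type) k : amp (fun (_ : P) x => wt x) k (fun=> u).
Proof.
have e01 (p : P) : 0 < (1 : R) <= 1 by rewrite ltr01 lexx.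
have ci : continuous (idfun : 'rV[R]_n -> 'rV[R]_n) by move=> z; exact: cvg_id.
have A1 := @amp_pullback R 'rV[R]_n 'rV[R]_n unit P (fun _ x => wt x) k (fun=> u)
  idfun (fun=> 0) (fun=> 1) (fun=> tt) ci (fun _ x => ltW (wt_gt0 x)) e01
  (schwartz_amp_wt k Su).
apply: (amp_ext _ (amp_weight (C := 1) _ _ A1)).
- by move=> p x; rewrite add0r scale1r.
- by move=> p x; exact/ltW/wt_gt0.
- by move=> p x; rewrite add0r scale1r mul1r.
Qed.

(** Derivatives are taken in the integration variable only, with (x, eta) as parameter: [u] provides
    the decay, and [g] contributes bounded derivatives uniformly in the parameter. *)
Lemma weyl_amp_amp k : amp (fun _ x => wt x) k (fun (p : phase R n) => weyl_amp p.1 p.2).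
Proof.
apply: (amp_weight (C := 1) _ _ (amp_mul (fun _ _ => ler01) (symbol_amp k) (@u_amp _ k))).
- by move=> p x; rewrite mul1r; exact/ltW/wt_gt0.
- by move=> p x.
Qed.

Lemma weyl_amp_wt : exists C : R, forall x eta s, nrm (weyl_amp x eta s) <= C * wt s.
Proof.
have [C hC] := amp_bounded (weyl_amp_amp 0); exists C => x eta s.
exact: (hC (x, eta)).
Qed.

(** The symbol has no decay in eta; the weight is obtained by trading 2n derivatives in the
    configuration variable. *)
Lemma weyl_fiber_wt : exists C : R, forall x eta, nrm (weyl_fiber x eta) <= C * wt eta.
Proof.
have [C hC] := amp_fourier_decay (weyl_amp_amp (2 * n)); exists C => x eta.
by rewrite nrmM nrm_cis mul1r; exact: (hC (x, eta)).
Qed.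

Lemma cmeasurable_symbol_pair d (T : measurableType d) (a b : T -> 'rV[R]_n) :
  measurable_fun setT a -> measurable_fun setT b -> cmeasurable (fun t => g (a t, b t)).
Proof.
move=> ma mb; apply: (cmeasurable_comp (phi := fun t => (a t, b t))).
  exact: measurable_fun_pair.
exact: (continuous_cmeasurable_phase symbol_continuous).
Qed.

Lemma cmeasurable_weyl_amp d (T : measurableType d) (a b c : T -> 'rV[R]_n) :
  measurable_fun setT a -> measurable_fun setT b -> measurable_fun setT c ->
  cmeasurable (fun t => weyl_amp (a t) (b t) (c t)).
Proof.
move=> ma mb mc; apply: cmeasurableM.
  apply: cmeasurable_symbol_pair => //.
  by apply: measurable_rVZ; exact: measurable_rVD.
exact: (cmeasurable_comp mc (schwartz_cmeasurable Su)).
Qed.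

Lemma cmeasurable_weyl_fiber : cmeasurable (fun z : 'rV[R]_n * 'rV[R]_n => weyl_fiber z.1 z.2).
Proof.
apply: cmeasurableM.
  apply: cmeasurable_cis; apply: measurable_dotp; [exact: measurable_fst|exact: measurable_snd].
apply: (@cmeasurable_cintegral R _ _ _ _ (@dx R n)
  (fun z : (phase R n) * 'rV[R]_n => cis (- dotp z.2 z.1.2) * weyl_amp z.1.1 z.1.2 z.2)).
have m1 : measurable_fun setT (fun z : (phase R n) * 'rV[R]_n => z.1.1).
  by apply: (measurableT_comp measurable_fst measurable_fst).
have m2 : measurable_fun setT (fun z : (phase R n) * 'rV[R]_n => z.1.2).
  by apply: (measurableT_comp measurable_snd measurable_fst).
have m3 : measurable_fun setT (fun z : (phase R n) * 'rV[R]_n => z.2) by exact: measurable_snd.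
apply: cmeasurableM; last exact: cmeasurable_weyl_amp.
by apply: cmeasurable_cis; apply: measurable_funN; exact: measurable_dotp.
Qed.

(* The oscillatory integral converges for every regularization, so one of product
   form is enough to compute it. *)
Section oscillatory.
Variable chi1 : 'rV[R]_n -> R[i].
Hypotheses (Schi : schwartz chi1) (chi0 : chi1 0 = 1).

(** Uniformity in the regularization index, here part of the parameter, provides the dominating
    function needed to remove the regularization. *)
Lemma scaled_amp (x : 'rV[R]_n) k : amp (fun _ s => wt s) k
  (fun (p : nat * 'rV[R]_n) s => chi1 (harmonic p.1 *: s) * weyl_amp x p.2 s).
Proof.
have e01 (p : nat * 'rV[R]_n) : 0 < (harmonic p.1 : R) <= 1.
  by rewrite harmonic_gt0/= invf_le1// ler1n.
have e11 (p : nat * 'rV[R]_n) : 0 < (1 : R) <= 1 by rewrite ltr01 lexx.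
have ci : continuous (idfun : 'rV[R]_n -> 'rV[R]_n) by move=> z; exact: cvg_id.
have A1 := @amp_pullback R 'rV[R]_n 'rV[R]_n unit (nat * 'rV[R]_n)%type (fun _ _ => 1) k
  (fun=> chi1) idfun (fun=> 0) (fun p => harmonic p.1) (fun=> tt) ci (fun _ _ => ler01) e01
  (schwartz_amp1 k Schi).
have A2 := @amp_pullback R 'rV[R]_n 'rV[R]_n (phase R n) (nat * 'rV[R]_n)%type
  (fun _ s => wt s) k (fun p => weyl_amp p.1 p.2) idfun (fun=> 0) (fun=> 1)
  (fun p => (x, p.2)) ci (fun _ x => ltW (wt_gt0 x)) e11 (weyl_amp_amp k).
apply: (amp_ext _ (amp_weight (C := 1) _ _ (amp_mul (fun _ _ => ler01) A1 A2))).
- by move=> p s; rewrite !add0r !scale1r.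
- by move=> p s; rewrite mul1r; exact/ltW/wt_gt0.
- by move=> p s; rewrite add0r scale1r !mul1r.
Qed.

Let A k (x : 'rV[R]_n) := cintegral dX (fun z : phase R n =>
  (chi1 (harmonic k *: z.1) * chi1 (harmonic k *: z.2)) *
  (cis (dotp (x - z.1) z.2) * g (2^-1 *: (x + z.1), z.2) * u z.1)).

Let fiber k x eta := chi1 (harmonic k *: eta) * (cis (dotp x eta) *
  fourier (fun s => chi1 (harmonic k *: s) * weyl_amp x eta s) eta).

Let schwartz_dilate k : cintegrable dx (fun s => chi1 (harmonic k *: s)).
Proof.
have hk : 0 < (harmonic k : R) by exact: harmonic_gt0.
have := cintegrable_affine 0 hk (schwartz_cintegrable Schi).
by under eq_fun do rewrite add0r.
Qed.

Let measurable_dilate k d (T : measurableType d) (a : T -> 'rV[R]_n) :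
  measurable_fun setT a -> cmeasurable (fun t => chi1 (harmonic k *: a t)).
Proof.
move=> ma; apply: (cmeasurable_comp _ (schwartz_cmeasurable Schi)).
exact: measurable_rVZ.
Qed.

Let fiber_measurable k x : cmeasurable (fiber k x).
Proof.
apply: cmeasurableM; first exact: measurable_dilate.
apply: cmeasurableM.
  by apply: cmeasurable_cis; apply: measurable_dotp => //; exact: measurable_cst.
apply: (@cmeasurable_cintegral R _ _ _ _ (@dx R n)
  (fun z : phase R n => cis (- dotp z.2 z.1) * (chi1 (harmonic k *: z.2) * weyl_amp x z.1 z.2))).
have m1 : measurable_fun setT (fun z : phase R n => z.1) by exact: measurable_fst.
have m2 : measurable_fun setT (fun z : phase R n => z.2) by exact: measurable_snd.
apply: cmeasurableM.
  by apply: cmeasurable_cis; apply: measurable_funN; exact: measurable_dotp.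
apply: cmeasurableM; first exact: measurable_dilate.
by apply: cmeasurable_weyl_amp => //; exact: measurable_cst.
Qed.

Let fiber_bound x : exists C : R, forall k eta, nrm (fiber k x eta) <= C * wt eta.
Proof.
have [C hC] := amp_fourier_decay (scaled_amp x (2 * n)).
have [D hD] := schwartz_bounded Schi.
exists (D * `|C|) => k eta; rewrite !nrmM nrm_cis mul1r -mulrA.
rewrite ler_pM ?nrm_ge0//; apply: (le_trans (hC (k, eta) eta)).
by rewrite ler_wpM2r ?ler_norm// ltW// wt_gt0.
Qed.

(** At fixed [k] the two cutoffs make the double integral absolutely convergent, so Fubini applies;
    the constant is the normalization of [dxi]. *)
Let AE k x : A k x = ((2 * pi) ^- n)%:C * cintegral dx (fiber k x).
Proof.
have m1 : measurable_fun setT (fun z : phase R n => z.1) by exact: measurable_fst.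
have m2 : measurable_fun setT (fun z : phase R n => z.2) by exact: measurable_snd.
have [C gC] := symbol_bounded.
have [D uD] := schwartz_bounded Su.
pose F (z : phase R n) := (chi1 (harmonic k *: z.1) * chi1 (harmonic k *: z.2)) *
  (cis (dotp (x - z.1) z.2) * g (2^-1 *: (x + z.1), z.2) * u z.1).
have mF : cmeasurable F.
  apply: cmeasurableM; first by apply: cmeasurableM; exact: measurable_dilate.
  apply: cmeasurableM; last exact: (cmeasurable_comp m1 (schwartz_cmeasurable Su)).
  apply: cmeasurableM.
    apply: cmeasurable_cis; apply: measurable_dotp => //.
    by apply: measurable_rVB.
  by apply: cmeasurable_symbol_pair => //; apply: measurable_rVZ; apply: measurable_rVD.
have iF : cintegrable dX F.
  apply: (@cintegrable_tensor R _ _ _ _ dx dxi F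
    (fun s => (C * D)%:C * chi1 (harmonic k *: s)) (fun s => chi1 (harmonic k *: s))).
  - exact: mF.
  - exact: cintegrableZ.
  - exact/cintegrable_dxi.
  - move=> s eta; rewrite /F /= !nrmM nrm_cis mul1r nrm_real.
    have -> : `|C * D| * nrm (chi1 (harmonic k *: s)) * nrm (chi1 (harmonic k *: eta)) =
      nrm (chi1 (harmonic k *: s)) * nrm (chi1 (harmonic k *: eta)) * `|C * D| by ring.
    rewrite ler_wpM2l ?mulr_ge0 ?nrm_ge0//; apply: le_trans (ler_norm _).
    by rewrite ler_pM ?nrm_ge0.
rewrite /A -(cfubini1 iF) (cfubini iF).
have fE eta : cintegral dx (fun s => F (s, eta)) = fiber k x eta.
  rewrite /fiber /fourier mulrA -cintegralZ; last first.
    have [C' hC'] := amp_bounded (scaled_amp x 0).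
    apply: cintegrable_fourier; apply: (cintegrable_wt (C := C')).
      apply: cmeasurableM; first exact: measurable_dilate.
      by apply: cmeasurable_weyl_amp => //; exact: measurable_cst.
    by move=> s; exact: (hC' (k, eta)).
  congr cintegral; apply/funext => s; rewrite /F/= dotpBl cisD /weyl_amp; ring.
under eq_fun do rewrite fE.
have [C' hC'] := fiber_bound x.
by rewrite cintegral_dxi//; exact: (cintegrable_wt (fiber_measurable k x) (hC' k)).
Qed.

Let cvg_chi (s : 'rV[R]_n) : chi1 (harmonic k *: s) @[k --> \oo] --> (1 : R[i]).
Proof.
rewrite -chi0.
exact: (cvg_comp (fun k => harmonic k *: s) chi1 (cvg_harmonicZ s) (schwartz_continuous Schi (x := 0))).
Qed.

Let cvg_fiber x eta : fiber k x eta @[k --> \oo] --> weyl_fiber x eta.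
Proof.
rewrite -[X in _ --> X]mul1r.
apply: (ccvgM _ (cvg_chi eta)); apply: ccvgMl.
have [C hC] := weyl_amp_wt.
have [D hD] := schwartz_bounded Schi.
apply: (@cintegral_dominated R _ _ (@dx R n) _ _ (fun s => (D * `|C|) * wt s)).
- move=> k; apply: cmeasurableM.
    apply: cmeasurable_cis; apply: measurable_funN; exact: measurable_dotp.
  apply: cmeasurableM; first exact: measurable_dilate.
  by apply: cmeasurable_weyl_amp => //; exact: measurable_cst.
- apply: cmeasurableM.
    apply: cmeasurable_cis; apply: measurable_funN; exact: measurable_dotp.
  by apply: cmeasurable_weyl_amp => //; exact: measurable_cst.
- move=> s; apply: ccvgMl; rewrite -[X in _ --> X]mul1r.
  by apply: (ccvgM _ (cvg_chi s)); exact: cvg_cst.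
- exact: integrable_cwt.
- move=> k s; rewrite nrmM nrm_cis mul1r nrmM -mulrA.
  rewrite ler_pM ?nrm_ge0//; apply: (le_trans (hC _ _ _)).
  by rewrite ler_wpM2r ?ler_norm// ltW// wt_gt0.
Qed.

Lemma cvg_oscillatory x : A k x @[k --> \oo] -->
  ((2 * pi) ^- n)%:C * cintegral dx (weyl_fiber x).
Proof.
under eq_fun do rewrite AE.
apply: ccvgMl; have [C hC] := fiber_bound x.
apply: (@cintegral_dominated R _ _ (@dx R n) _ _ (fun s => C * wt s)).
- by move=> k; exact: fiber_measurable.
- exact: (cmeasurable_pair1 x cmeasurable_weyl_fiber).
- exact: cvg_fiber.
- exact: integrable_cwt.
- exact: hC.
Qed.

Lemma weyl_repr (S : L2op (@dx R n) (@dx R n)) : is_weyl g S ->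
  {ae dx, forall x, S u x = ((2 * pi) ^- n)%:C * cintegral dx (weyl_fiber x)}.
Proof.
move=> /(_ u Su); apply: filterS => x osc.
pose chi (z : phase R n) := chi1 z.1 * chi1 z.2.
have chi00 : chi 0 = 1 by rewrite /chi /= chi0 mulr1.
have h0 : harmonic k @[k --> \oo] --> (0 : R)^'+.
  move=> B [r /= r0 rB].
  have /cvgrPdist_lt/(_ r r0) := @cvg_harmonic R.
  by apply: filterS => k hk; apply: rB => //=; exact: harmonic_gt0.
have := cvg_comp (@harmonic R) _ h0 (osc chi (schwartz_tensor Schi Schi) chi00).
move=> H; apply: (cvg_unique (@norm_hausdorff _ R[i]) H).
exact: cvg_oscillatory.
Qed.

End oscillatory.

End weyl.

(** * Matrix elements of Weyl operators *)

Section cross_wigner.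
Context (R : realType) (n : nat).
Implicit Types (w u : 'rV[R]_n -> R[i]).

Definition cross_wigner w u (X : phase R n) : R[i] :=
  cintegral dx (fun y => cis (dotp y X.2) * conjc (w (X.1 + 2^-1 *: y)) * u (X.1 - 2^-1 *: y)).

Lemma schwartz_L2 u : schwartz u -> L2 dx u.
Proof.
move=> Su; have [mr mi] := schwartz_cmeasurable Su; split => //.
have [C uC] := schwartz_bounded Su.
have [mu foo] : cintegrable dx (fun x => C%:C * u x).
  by apply: cintegrableZ; exact: schwartz_cintegrable.
apply: le_lt_trans foo; apply: ge0_le_integral => //.
- by move=> x _; rewrite lee_fin sqr_ge0.
- apply/measurable_EFinP; apply: measurable_funX; exact: measurable_nrm.
- by apply/measurable_EFinP; exact: measurable_nrm.
- move=> x _; rewrite lee_fin nrmM nrm_real expr2 ler_wpM2r ?nrm_ge0//.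
  exact: le_trans (uC x) (ler_norm _).
Qed.

Lemma cintegrable_half_shift u (m : 'rV[R]_n) : schwartz u ->
  cintegrable dx (fun y => u (m + 2^-1 *: y)).
Proof.
move=> Su; have h : 0 < (2^-1 : R) by rewrite invr_gt0.
exact: (cintegrable_affine m h (schwartz_cintegrable Su)).
Qed.

Lemma cintegrable_cross_wigner w u (X : phase R n) : schwartz w -> schwartz u ->
  cintegrable dx (fun y => cis (dotp y X.2) * conjc (w (X.1 + 2^-1 *: y)) * u (X.1 - 2^-1 *: y)).
Proof.
move=> Sw Su; have [C uC] := schwartz_bounded Su.
under eq_fun do rewrite mulrAC.
apply: (cintegrableMb (C := C)).
- by apply: cintegrable_conj; exact: cintegrable_half_shift.
- apply: cmeasurableM; first by apply: cmeasurable_cis; exact: measurable_dotp.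
  apply: (cmeasurable_comp _ (schwartz_cmeasurable Su)).
  by apply: measurable_rVB => //; exact: measurable_rVZ.
- by move=> y; rewrite nrmM nrm_cis mul1r.
Qed.

Variables (g : phase R n -> R[i]) (w u : 'rV[R]_n -> R[i]) (chi1 : 'rV[R]_n -> R[i]).
Hypotheses (gA : forall k, amp (fun (_ : unit) _ => 1) k (fun=> g))
  (Su : schwartz u) (Sw : schwartz w) (Schi : schwartz chi1) (chi0 : chi1 0 = 1).

Let integrable_pair_fiber :
  cintegrable (prod_measure dx dx) (fun z : phase R n => conjc (w z.1) * weyl_fiber g u z.1 z.2).
Proof.
have [C hC] := weyl_fiber_wt gA Su.
have mw := schwartz_cmeasurable Sw.
apply: (@cintegrable_tensor R _ _ _ _ dx dx _ w (fun eta => (C * wt eta)%:C)).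
- apply: cmeasurableM; last exact: cmeasurable_weyl_fiber.
  by apply: cmeasurable_conj; apply: (cmeasurable_comp _ mw); exact: measurable_fst.
- exact: schwartz_cintegrable.
- apply: (@cintegrable_wt _ _ _ `|C|).
    by apply: cmeasurable_real; apply: measurable_funM => //; exact: measurable_wt.
  by move=> x; rewrite nrm_real normrM (gtr0_norm (wt_gt0 x)).
- move=> x y /=; rewrite nrmM nrm_conjc ler_wpM2l ?nrm_ge0//.
  by apply: (le_trans (hC x y)); rewrite nrm_real ler_norm.
Qed.

(** With x = m + y / 2 and s = m - y / 2, the symbol at the midpoint depends on m alone and leaves
    the integral over y. *)
Let midpoint_fiber eta :
  cintegral dx (fun x => conjc (w x) * weyl_fiber g u x eta) =
  cintegral dx (fun m => g (m, eta) * cross_wigner w u (m, eta)).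
Proof.
have [C gC] := symbol_bounded gA.
have mw := schwartz_cmeasurable Sw.
have mu := schwartz_cmeasurable Su.
pose G (z : phase R n) := conjc (w z.1) * (cis (dotp z.1 eta) *
  (cis (- dotp z.2 eta) * weyl_amp g u z.1 eta z.2)).
have m1 : measurable_fun setT (fun z : phase R n => z.1) by exact: measurable_fst.
have m2 : measurable_fun setT (fun z : phase R n => z.2) by exact: measurable_snd.
have mG : cmeasurable G.
  apply: cmeasurableM.
    by apply: cmeasurable_conj; exact: (cmeasurable_comp m1 mw).
  apply: cmeasurableM; first by apply: cmeasurable_cis; exact: measurable_dotp.
  apply: cmeasurableM.
    by apply: cmeasurable_cis; apply: measurable_funN; exact: measurable_dotp.
  by apply: cmeasurable_weyl_amp.
have iG : cintegrable (prod_measure dx dx) G.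
  apply: (@cintegrable_tensor R _ _ _ _ dx dx G w (fun s => C%:C * u s)) => //.
  - exact: schwartz_cintegrable.
  - by apply: cintegrableZ; exact: schwartz_cintegrable.
  - move=> x s; rewrite /G /weyl_amp/= !nrmM nrm_conjc !nrm_cis !mul1r nrm_real.
    rewrite ler_wpM2l ?nrm_ge0// ler_wpM2r ?nrm_ge0//.
    exact: le_trans (gC _) (ler_norm _).
transitivity (cintegral dx (fun x => cintegral dx (fun s => G (x, s)))).
  congr cintegral; apply/funext => x; rewrite /G/= [RHS]cintegralZ.
    congr (_ * _); rewrite /weyl_fiber [RHS]cintegralZ//.
    have [C' hC'] := weyl_amp_wt gA Su.
    apply: cintegrable_fourier; apply: (cintegrable_wt (C := C')) => //.
    by apply: cmeasurable_weyl_amp.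
  have [C' hC'] := weyl_amp_wt gA Su.
  apply: cintegrableZ; apply: cintegrable_fourier; apply: (cintegrable_wt (C := C')) => //.
  by apply: cmeasurable_weyl_amp.
rewrite (cintegral_midpoint iG); congr cintegral; apply/funext => m.
rewrite /cross_wigner -cintegralZ; last exact: cintegrable_cross_wigner.
congr cintegral; apply/funext => y; rewrite /G /weyl_amp/=.
have -> : 2^-1 *: (m + 2^-1 *: y + (m - 2^-1 *: y)) = m.
  by apply/rowP => i; rewrite !mxE; field.
have -> : cis (dotp y eta) = cis (dotp (m + 2^-1 *: y) eta) * cis (- dotp (m - 2^-1 *: y) eta).
  by rewrite -cisD !dotpDl dotpNl dotpZl; congr cis; field.
ring.
Qed.

(** The right-hand side stays an iterated integral: the bounds at hand control the inner integral as
    a function of eta, while joint integrability on phase space is supplied later, in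
    [packet_kernel]. *)
Lemma weyl_pairing (S : L2op (@dx R n) (@dx R n)) : is_weyl g S ->
  L2dot dx w (S u) =
  cintegral dxi (fun eta => cintegral dx (fun m => g (m, eta) * cross_wigner w u (m, eta))).
Proof.
move=> gS.
have mw := schwartz_cmeasurable Sw.
have [C hC] := weyl_fiber_wt gA Su.
have mf := cmeasurable_weyl_fiber gA Su.
have [mSr mSi _] := bounded_linear_L2 (op_funP S) (schwartz_L2 Su).
pose c : R[i] := ((2 * pi : R) ^- n)%:C.
transitivity (cintegral dx (fun x => c * cintegral dx (fun eta =>
    conjc (w x) * weyl_fiber g u x eta))).
  apply: cintegral_ae.
  - by apply: cmeasurableM => //; exact: cmeasurable_conj.
  - apply: cmeasurableM; first exact: cmeasurable_cst.
    exact: (cmeasurable_cintegral dx integrable_pair_fiber.1).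
  - have := weyl_repr gA Su Schi chi0 gS; apply: filterS => x /= SE _.
    rewrite SE -/c mulrCA; congr (_ * _); rewrite -cintegralZ//.
    exact: (cintegrable_wt (cmeasurable_pair1 x mf) (hC x)).
have [D hD] : exists D : R, forall eta,
    nrm (cintegral dx (fun x => conjc (w x) * weyl_fiber g u x eta)) <= D * wt eta.
  exists (2 * (C * Rintegral dx setT (fun x => nrm (w x)))) => eta.
  have iw := integrable_nrm (schwartz_cintegrable Sw).
  apply: le_trans (nrm_cintegral_le (g := fun x => (C * wt eta) * nrm (w x)) _ _ _) _.
  - apply: cmeasurableM; first exact: cmeasurable_conj.
    exact: (cmeasurable_pair2 eta mf).
  - by apply: (integrableZl _ _ iw).
  - by move=> x; rewrite nrmM nrm_conjc mulrC ler_wpM2r ?nrm_ge0.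
  - by rewrite RintegralZl//; lra.
rewrite cintegralZ; last first.
  have iw := integrable_nrm (schwartz_cintegrable Sw).
  pose K := 2 * Rintegral dx setT (fun eta : 'rV[R]_n => C * wt eta).
  apply: (@cintegrable_le _ _ _ _ _ (fun x => K * nrm (w x))).
  - exact: (cmeasurable_cintegral dx integrable_pair_fiber.1).
  - by apply: (integrableZl _ _ iw).
  - move=> x /=; rewrite cintegralZ; last first.
      exact: (cintegrable_wt (cmeasurable_pair1 x mf) (hC x)).
    rewrite nrmM nrm_conjc mulrC ler_wpM2r ?nrm_ge0//.
    apply: nrm_cintegral_le (hC x); first exact: (cmeasurable_pair1 x mf).
    exact: integrable_cwt.
rewrite (cfubini integrable_pair_fiber)/=.
under eq_fun do rewrite midpoint_fiber.
rewrite cintegral_dxi//.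
under eq_fun do rewrite -midpoint_fiber.
apply: (cintegrable_wt _ hD).
exact: (cmeasurable_cintegral dx (cintegrable_swap integrable_pair_fiber).1).
Qed.

End cross_wigner.

(** * Phase-space translations and wave packets *)

Section phase_translations.
Context (R : realType) (n : nat).
Implicit Types (X Y Z W : phase R n).

Definition symplr X Y : R := sympl X Y.

Lemma symplr_is_linear X : linear (symplr X).
Proof.
move=> c Y Z; rewrite /symplr /sympl /= dotpDr dotpZr dotpDl dotpZl /GRing.scale/=; ring.
Qed.

HB.instance Definition _ X :=
  GRing.isLinear.Build R (phase R n) R _ (symplr X) (symplr_is_linear X).

Lemma continuous_symplr X : continuous (symplr X).
Proof.
have c1 : continuous (fun Y : phase R n => dotp X.1 Y.2).
  move=> Y; under eq_fun do rewrite dotpC.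
  exact: (cvg_comp snd (dotr X.1) (@cvg_snd _ _ _ _ _) (@continuous_dotr R n X.1 Y.2)).
have c2 : continuous (fun Y : phase R n => dotp Y.1 X.2).
  move=> Y.
  exact: (cvg_comp fst (dotr X.2) (@cvg_fst _ _ _ _ _) (@continuous_dotr R n X.2 Y.1)).
by move=> Y; apply: cvgB; [exact: c1|exact: c2].
Qed.

Lemma cis_sympl_amp X k : amp (fun (_ : unit) _ => 1) k (fun=> fun Y => cis (sympl X Y)).
Proof.
have A1 := @amp_cis R (phase R n) unit (symplr X) (fun=> 0) k (@continuous_symplr X).
by apply: (amp_ext _ A1) => p Y; rewrite add0r.
Qed.

Lemma schwartz_modulate (u : 'rV[R]_n -> R[i]) (c : R) (d : 'rV[R]_n) : schwartz u ->
  schwartz (fun s => cis (c + dotp s d) * u s).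
Proof. by move=> Su; apply: (@schwartz_cis_mul R _ (dotr d) c u) => //; exact: continuous_dotr. Qed.

Variables (op : phase R n -> L2op (@dx R n) (@dx R n)) (chi1 : 'rV[R]_n -> R[i]).
Hypotheses (op_weyl : is_phase_translation op) (Schi : schwartz chi1) (chi0 : chi1 0 = 1).

(** For a plane wave the fibre is a phase times the transform of a modulated [u], so integrating
    over eta is Fourier inversion at x + X.1. *)
Lemma phase_translationE X (u : 'rV[R]_n -> R[i]) : schwartz u ->
  {ae dx, forall x, op X u x = cis (- dotp (x + 2^-1 *: X.1) X.2) * u (x + X.1)}.
Proof.
move=> Su.
have := weyl_repr (cis_sympl_amp X) Su Schi chi0 (op_weyl X).
apply: filterS => x ->.
pose phi s := cis (0 + dotp s (- (2^-1 *: X.2))) * u s.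
have Sphi : schwartz phi by exact: schwartz_modulate.
have [C hC] := schwartz_wt Sphi.
have [D hD] := amp_fourier_decay (schwartz_amp_wt (2 * n) Sphi).
have E eta : weyl_fiber (fun Y => cis (sympl X Y)) u x eta =
    cis (- dotp (2^-1 *: x) X.2) * (cis (dotp (x + X.1) eta) * fourier phi eta).
  rewrite /weyl_fiber.
  have -> : weyl_amp (fun Y => cis (sympl X Y)) u x eta =
      fun s => cis (dotp X.1 eta - dotp (2^-1 *: x) X.2) * phi s.
    apply/funext => s; rewrite /weyl_amp /phi mulrA -cisD; congr (cis _ * _).
    rewrite /sympl /= !dotpZl dotpNr dotpDl dotpZr; ring.
  rewrite /fourier.
  under eq_fun do rewrite mulrCA.
  rewrite cintegralZ; last first.
    by apply: cintegrable_fourier; exact: schwartz_cintegrable.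
  rewrite !mulrA -!cisD; congr (cis _ * _); rewrite dotpDl; ring.
rewrite (funext E) cintegralZ; last first.
  apply: (cintegrable_wt (C := D)).
    apply: cmeasurableM; first by apply: cmeasurable_cis; exact: measurable_dotp.
    by apply: cmeasurable_fourier; exact: schwartz_cmeasurable.
  by move=> eta; rewrite nrmM nrm_cis mul1r; exact: (hD tt eta).
rewrite (fourier_inversion _ (schwartz_continuous Sphi) hC (hD tt)).
rewrite mulrCA (mulrA _ _ (phi _)) -rmorphM/= mulVf; last first.
  by rewrite expf_neq0// mulf_neq0// gt_eqF// pi_gt0.
rewrite mul1r /phi mulrA -cisD; congr (cis _ * _).
by rewrite !(dotpDl, dotpDr, dotpNl, dotpNr, dotpZl, dotpZr); field.
Qed.

Variable v : 'rV[R]_n -> R[i].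
Hypothesis Sv : schwartz v.

(* The representative of v(Z) = op(- Z) v that is a Schwartz function. *)
Definition packet Z (t : 'rV[R]_n) : R[i] := cis (dotp (t - 2^-1 *: Z.1) Z.2) * v (t - Z.1).

Lemma schwartz_packet Z : schwartz (packet Z).
Proof.
have := schwartz_modulate (- dotp (2^-1 *: Z.1) Z.2) Z.2 (schwartz_shift (- Z.1) Sv).
congr schwartz; apply/funext => t; rewrite /packet dotpBl (addrC t (- _)).
by rewrite (addrC (- dotp _ _)).
Qed.

Lemma op_packet Z : op (- Z) v = packet Z %[ae dx].
Proof.
have := phase_translationE (- Z) Sv; apply: filterS => t -> _.
by rewrite /packet /= dotpNr opprK scalerN.
Qed.

(** Replacing y by W.1 - Z.1 + y in the Wigner function of [v] aligns the arguments of [v] on both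
    sides; what remains is an identity between phases. *)
Lemma cross_wigner_packet Z W Y :
  cross_wigner (packet Z) (packet W) (2^-1 *: (Z + W) + Y) =
  kappa W Z * (cis (- sympl (W - Z) Y) * wigner v Y).
Proof.
rewrite mulrA -cisD /wigner.
have iP := cintegrable_cross_wigner Y Sv Sv.
rewrite -(cintegral_shift (W.1 - Z.1) iP) -cintegralZ; last exact: (cintegrable_shift (W.1 - Z.1) iP).
congr cintegral; apply/funext => y.
rewrite /packet.
have rc (r : R) (z : R[i]) : conjc (cis r * z) = cis (- r) * conjc z.
  apply: complex_eq; rewrite ?Re_conjE ?Im_conjE ?Re_mulE ?Im_mulE ?Re_conjE ?Im_conjE/=;
    by rewrite cosN sinN; ring.
rewrite rc.
set a1 := conjc _; set b1 := v _; set a2 := conjc _; set b2 := v _.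
have -> : a2 = a1.
  by rewrite /a1 /a2; congr (conjc (v _)); apply/rowP => i; rewrite !mxE; field.
have -> : b2 = b1.
  by rewrite /b1 /b2; congr (v _); apply/rowP => i; rewrite !mxE; field.
transitivity ((cis (dotp y (2^-1 *: (Z + W) + Y).2) *
   cis (- dotp ((2^-1 *: (Z + W) + Y).1 + 2^-1 *: y - 2^-1 *: Z.1) Z.2) *
   cis (dotp ((2^-1 *: (Z + W) + Y).1 - 2^-1 *: y - 2^-1 *: W.1) W.2)) * (a1 * b1)).
  by ring.
transitivity ((cis (- (sympl W Z / 2) - sympl (W - Z) Y) *
   cis (dotp (W.1 - Z.1 + y) Y.2)) * (a1 * b1)); last by ring.
congr (_ * _); rewrite -!cisD; congr cis.
by rewrite /sympl/= !(dotpDl, dotpDr, dotpNl, dotpNr, dotpZl, dotpZr); field.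
Qed.

Lemma L2dot_ae d (T : measurableType d) (mu : {measure set T -> \bar R}) (f f' g g' : T -> R[i]) :
  L2 mu f -> L2 mu f' -> L2 mu g -> L2 mu g' -> f = f' %[ae mu] -> g = g' %[ae mu] ->
  L2dot mu f g = L2dot mu f' g'.
Proof.
move=> [fr fi _] [fr' fi' _] [gr gi _] [gr' gi' _] ff' gg'; apply: cintegral_ae.
- by apply: cmeasurableM => //; exact: cmeasurable_conj.
- by apply: cmeasurableM => //; exact: cmeasurable_conj.
- by apply: filterS2 ff' gg' => x fx gx _; rewrite fx// gx.
Qed.

Variable g : phase R n -> R[i].
Hypothesis gA : forall k, amp (fun (_ : unit) _ => 1) k (fun=> g).

Lemma packet_kernel (S : L2op (@dx R n) (@dx R n)) Z W : is_weyl g S ->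
  cintegrable dX (fun Y => cis (- sympl (W - Z) Y) * wigner v Y * g (2^-1 *: (Z + W) + Y)) ->
  L2dot dx (op (- Z) v) (S (op (- W) v)) = kappa W Z *
    cintegral dX (fun Y => cis (- sympl (W - Z) Y) * wigner v Y * g (2^-1 *: (Z + W) + Y)).
Proof.
move=> gS iP; set P := (fun Y => _) in iP *.
have Lv := schwartz_L2 Sv.
have LZ := bounded_linear_L2 (op_funP (op (- Z))) Lv.
have LW := bounded_linear_L2 (op_funP (op (- W))) Lv.
have LpZ := schwartz_L2 (schwartz_packet Z).
have LpW := schwartz_L2 (schwartz_packet W).
(* The pairing formula is for Schwartz functions, so both vectors are first replaced by their
   Schwartz representatives. *)
rewrite (L2dot_ae LZ LpZ (bounded_linear_L2 (op_funP S) LW)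
  (bounded_linear_L2 (op_funP S) LpW) (op_packet Z)); last first.
  exact: (bounded_linear_ae (op_funP S) LW LpW (op_packet W)).
rewrite (weyl_pairing gA (schwartz_packet W) (schwartz_packet Z) Schi chi0 gS).
pose C := 2^-1 *: (Z + W).
pose Q X := g X * cross_wigner (packet Z) (packet W) X.
have QE Y : Q (C + Y) = kappa W Z * P Y.
  by rewrite /Q cross_wigner_packet /P -/C; ring.
have QE' : Q = fun X => kappa W Z * P (- C + X).
  by apply/funext => X; rewrite -QE addrA subrr add0r.
have iQ : cintegrable dX Q.
  by rewrite QE'; apply: cintegrableZ; exact: cintegrable_phase_shift.
transitivity (cintegral dX Q).
  by rewrite -(cfubini1 iQ) (cfubini iQ).
by rewrite -(cintegral_phase_shift C iQ) (funext QE) cintegralZ.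
Qed.

End phase_translations.

(** * Evaluation of the twisted crossed product *)

(* Monotonicity of the integral without measurability: [nrm \o F] need not be
   known to be measurable for a Bochner integrable [F]. *)
Lemma ge0_integral_mono d (T : measurableType d) (R : realType)
    (mu : {measure set T -> \bar R}) (f h : T -> \bar R) :
  (forall x, (0 <= f x)%E) -> (forall x, (f x <= h x)%E) ->
  (\int[mu]_x f x <= \int[mu]_x h x)%E.
Proof.
move=> f0 fh; have h0 x : (0 <= h x)%E := le_trans (f0 x) (fh x).
rewrite !ge0_integralTE//; apply: ereal_sup_le => _ [s sf <-].
by exists s => // x; exact: le_trans (sf x) (fh x).
Qed.

Section bochner_evaluation.
Context (R : realType) (Sigma : topologicalType) d (T : measurableType d)
  (mu : {measure set T -> \bar R}).
Local Notation A := (C0 R Sigma).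

Lemma C0_nrm_eval (f : A) s : nrm (f s) <= nrm f.
Proof. exact: sup_norm_ub. Qed.

Lemma C0_sum_eval (I : Type) (r : seq I) (F : I -> A) s :
  (\sum_(i <- r) F i) s = \sum_(i <- r) F i s.
Proof. by elim/big_ind2: _ => // x1 x2 y1 y2 <- <-. Qed.

Lemma cvg_C0_eval (U : Type) (F : set_system U) (FF : Filter F) (f : U -> A) (l : A) s :
  f x @[x --> F] --> l -> f x s @[x --> F] --> l s.
Proof.
move=> /cvg_nrm fl; apply/cvg_nrm.
apply: (@squeeze_cvgr _ _ _ _ (fun=> 0) (fun x => nrm (f x - l))) => //.
- by apply: nearW => x; rewrite nrm_ge0 (C0_nrm_eval (f x - l) s).
- exact: cvg_cst.
Qed.

Lemma simple_eval (h : T -> A) s : bochner_simple mu h ->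
  cintegrable mu (fun x => h x s) /\ cintegral mu (fun x => h x s) = simple_integral mu h s.
Proof.
move=> [fh mh].
pose r : seq A := finmap.enum_fset (fset_set (range h)).
have ur : uniq r by exact: finmap.fset_uniq.
have hr x : h x \in r by rewrite [_ \in r]in_fset_set// inE; exists x.
have hE x : h x s = \sum_(w <- r) (\1_(h @^-1` [set w]) x)%:C * w s.
  rewrite (bigD1_seq (h x))//= indicE mem_set//= mul1r big1 ?addr0// => w wx.
  rewrite indicE memNset ?mul0r//= => hw.
  by move: wx; rewrite hw eqxx.
have iw w : cintegrable mu (fun x => (\1_(h @^-1` [set w]) x)%:C * w s) /\
    cintegral mu (fun x => (\1_(h @^-1` [set w]) x)%:C * w s) =
    (fine (mu (h @^-1` [set w])))%:C * w s.
  have [mw foo] := mh w.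
  (* The value 0 is treated apart because its fibre may have infinite measure. *)
  have [->|w0] := eqVneq w 0.
    split; last first.
      rewrite (_ : (0 : A) s = 0)// mulr0.
      under eq_fun do rewrite mulr0.
      by apply: complex_eq; rewrite /cintegral/= /Rintegral integral0.
    under eq_fun do rewrite (_ : (0 : A) s = 0)// mulr0.
    split; first exact: cmeasurable_cst.
    by under eq_integral do rewrite nrm0; rewrite integral0.
  have iI : mu.-integrable setT (EFin \o (\1_(h @^-1` [set w]) : T -> R)).
    apply/integrableP; split.
      by apply/measurable_EFinP; exact: measurable_indic.
    under eq_integral do rewrite /= ger0_norm//.
    by rewrite integral_indic// setIT; exact: foo.
  have i1 : cintegrable mu (fun x => (\1_(h @^-1` [set w]) x : R)%:C).
    apply: (cintegrable_le _ iI) => [|x].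
      by apply: cmeasurable_real; exact: measurable_indic.
    by rewrite nrm_real ger0_norm.
  split.
    by under eq_fun do rewrite mulrC; exact: cintegrableZ.
  rewrite cintegralZr//; congr (_ * _); apply: complex_eq => /=; last first.
    by rewrite /Rintegral integral0.
  by rewrite /Rintegral integral_indic// setIT.
have S r' : cintegrable mu (fun x => \sum_(w <- r') (\1_(h @^-1` [set w]) x)%:C * w s) /\
    cintegral mu (fun x => \sum_(w <- r') (\1_(h @^-1` [set w]) x)%:C * w s) =
    \sum_(w <- r') (fine (mu (h @^-1` [set w])))%:C * w s.
  elim: r' => [|w r' [IH1 IH2]].
    under eq_fun do rewrite big_nil; rewrite big_nil; split.
      split; first exact: cmeasurable_cst.
      by under eq_integral do rewrite nrm0; rewrite integral0.
    by apply: complex_eq; rewrite /cintegral/= /Rintegral integral0.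
  under eq_fun do rewrite big_cons; rewrite big_cons; have [w1 w2] := iw w; split.
    exact: cintegrableD.
  by rewrite cintegralD// IH2 w2.
have [S1 S2] := S r.
under eq_fun do rewrite hE; split => //.
by rewrite S2 /simple_integral fsbig_finite//= C0_sum_eval.
Qed.

(** Evaluation at a point is a contraction for the sup norm, so the simple approximations of [G]
    evaluate to approximations in mean of the scalar function. Measurability of the latter is asked
    for separately, since it is known directly in the application. *)
Lemma bochner_eval (G : T -> A) (a : A) s : cmeasurable (fun x => G x s) ->
  is_bochner mu G a ->
  cintegrable mu (fun x => G x s) /\ cintegral mu (fun x => G x s) = a s.
Proof.
move=> mG [h [sh _ hG ha]].
have hs k := simple_eval s (sh k).
have le k : (\int[mu]_x (nrm (G x s - h k x s))%:E <= \int[mu]_x (nrm (G x - h k x))%:E)%E.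
  apply: ge0_integral_mono => x; rewrite lee_fin ?nrm_ge0//.
  exact: (C0_nrm_eval (G x - h k x) s).
have I0 k : (0 <= \int[mu]_x (nrm (G x - h k x))%:E)%E.
  by apply: integral_ge0 => x _; rewrite lee_fin nrm_ge0.
(* From [k0] on the approximation error is finite; the scalar function is then integrable as the sum
   of this error and a simple function. *)
have [[k0 _ hk0] _] := (fine_cvgP _ _).1 hG.
have md k : cmeasurable (fun x => G x s - h k x s).
  by apply: cmeasurableD => //; apply: cmeasurableN; exact: (hs k).1.1.
have id k : (k0 <= k)%N -> cintegrable mu (fun x => G x s - h k x s).
  by move=> kk; split => //; apply: (le_lt_trans (le k)); rewrite -ge0_fin_numE//; exact: hk0.
have iG : cintegrable mu (fun x => G x s).
  have := cintegrableD (id k0 (leqnn _)) (hs k0).1.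
  by under eq_fun do rewrite subrK.
split=> //.
have lim1 : simple_integral mu (h k) s @[k --> \oo] --> a s.
  by apply: cvg_C0_eval; exact: ha.
have lim2 : simple_integral mu (h k) s @[k --> \oo] --> cintegral mu (fun x => G x s).
  apply/cvg_nrm.
  have ub k : (k0 <= k)%N -> nrm (simple_integral mu (h k) s - cintegral mu (fun x => G x s)) <=
      2 * fine (\int[mu]_x (nrm (G x - h k x))%:E)%E.
    move=> kk; rewrite -(hs k).2 -nrmN opprB -cintegralB//; last exact: (hs k).1.
    apply: (le_trans (nrm_cintegral (id k kk))); rewrite ler_pM2l// fine_le//.
    - by have := integrable_fin_num measurableT (integrable_nrm (id k kk)).
    - exact: hk0.
  apply: (@squeeze_cvgr _ _ _ _ (fun=> 0)
    (fun k => 2 * fine (\int[mu]_x (nrm (G x - h k x))%:E)%E)).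
  - by exists k0 => // k /= kk; rewrite nrm_ge0 ub.
  - exact: cvg_cst.
  - rewrite -(mulr0 (2 : R)); apply: cvgMr; exact: (fine_cvg hG).
exact: (cvg_unique (@norm_hausdorff _ R[i]) lim2 lim1).
Qed.

End bochner_evaluation.

(** * Smooth vectors give bounded smooth symbols along orbits *)

Section smooth_vectors.
Context (R : realType) (n : nat) (Sigma : topologicalType)
  (Theta : phase_action R n Sigma).
Local Notation A := (C0 R Sigma).

Lemma translate_addE X Y (f : A) :
  translate Theta (X + Y) f = translate Theta X (translate Theta Y f).
Proof. by apply: val_inj; apply: funext => s /=; rewrite addrC actD. Qed.

Lemma nrm_translate_le X (f : A) : nrm (translate Theta X f) <= nrm f.
Proof.
apply: sup_norm_le => [|s]; first exact: sup_norm_ge0.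
exact: (sup_norm_ub f (Theta X s)).
Qed.

(** By the group law a quotient at any point is a translate of the quotient at the origin, so all
    directional derivatives are determined there. *)
Lemma rquot_translate d x t (f : A) :
  rquot (fun X => translate Theta X f) d x t =
  translate Theta x (rquot (fun X => translate Theta X f) d 0 t).
Proof.
rewrite /rquot add0r !translate_addE.
have t0 : translate Theta 0 f = f.
  by apply: val_inj; apply: funext => s /=; rewrite act0.
by rewrite t0; exact: val_inj.
Qed.

Lemma cvg_translate (T : Type) (FF : set_system T) (FFF : Filter FF) X (h : T -> A) (l : A) :
  h t @[t --> FF] --> l -> translate Theta X (h t) @[t --> FF] --> translate Theta X l.
Proof.
move=> /cvg_nrm hl; apply/cvg_nrm.
apply: (@squeeze_cvgr _ _ _ _ (fun=> 0) (fun t => nrm (h t - l))) => //.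
- apply: nearW => t; rewrite nrm_ge0 /= -[X in X - _]scale1r.
  have -> : 1 *: translate Theta X (h t) - translate Theta X l =
    translate Theta X (h t - l) by rewrite scale1r; exact: val_inj.
  exact: nrm_translate_le.
- exact: cvg_cst.
Qed.

Lemma continuous_orbit (s : Sigma) (f : A) :
  continuous (fun X => translate Theta X f) -> continuous (fun Y => f (Theta Y s)).
Proof.
move=> cf Y.
exact: (@cvg_C0_eval R Sigma _ (nbhs Y) _ (fun X => translate Theta X f)
  (translate Theta Y f) s (cf Y)).
Qed.

(** The derivative of an orbit map is the orbit map of its derivative at the origin, again an
    element of C_0. The induction therefore runs over [f], and each derivative is bounded by a sup
    norm. *)
Lemma class_C_orbit_amp (s : Sigma) k (f : A) :
  class_C k (fun X => translate Theta X f) ->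
  amp (fun (_ : unit) (_ : phase R n) => 1) k (fun=> fun Y => f (Theta Y s)).
Proof.
elim: k f => [|k IH] f [cf df].
  split=> //.
  - by move=> _; exact: continuous_orbit.
  - by exists (nrm f) => _ Y; rewrite mulr1; exact: C0_nrm_eval.
split=> //.
- by move=> _; exact: continuous_orbit.
- by exists (nrm f) => _ Y; rewrite mulr1; exact: C0_nrm_eval.
move=> d; have [dd ck] := df d.
pose f' := rderive d (fun X => translate Theta X f) 0.
have q0 : rquot (fun X => translate Theta X f) d 0 t @[t --> (0 : R)^'] --> f' := dd 0.
have q x : rquot (fun X => translate Theta X f) d x t @[t --> (0 : R)^'] --> translate Theta x f'.
  under eq_fun do rewrite rquot_translate.
  by apply: cvg_translate; exact: q0.
have E : rderive d (fun X => translate Theta X f) = fun X => translate Theta X f'.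
  by apply: funext => x; apply: cvg_lim; [exact: norm_hausdorff|exact: q].
rewrite E in ck.
exists (fun=> fun Y => f' (Theta Y s)); last exact: IH.
move=> _ x; apply: (@cvg_C0_eval _ _ _ _ _ _ _ s (q x)).
Qed.

End smooth_vectors.

(** * Square-integrable functions and weak equality *)

Section L2_facts.
Context (R : realType) d (T : measurableType d) (mu : {measure set T -> \bar R}).
Implicit Types f g : T -> R[i].

Lemma L2_cmeasurable f : L2 mu f -> cmeasurable f.
Proof. by case. Qed.

Lemma L2_integrable f : L2 mu f -> mu.-integrable setT (EFin \o (fun x => nrm (f x) ^+ 2)).
Proof.
move=> Lf; have [_ _ foo] := Lf; apply/integrableP; split.
  apply/measurable_EFinP; apply: measurable_funX.
  by apply: measurable_nrm; exact: L2_cmeasurable.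
by under eq_integral do rewrite /= ger0_norm ?sqr_ge0//.
Qed.

Lemma cintegrable_L2 f g : L2 mu f -> L2 mu g -> cintegrable mu (fun x => conjc (f x) * g x).
Proof.
move=> Lf Lg; apply: (@cintegrable_le _ _ _ _ _ (fun x => nrm (f x) ^+ 2 + nrm (g x) ^+ 2)).
- by apply: cmeasurableM; [apply: cmeasurable_conj|]; exact: L2_cmeasurable.
- exact: (integrableD measurableT (L2_integrable Lf) (L2_integrable Lg)).
- move=> x; rewrite nrmM nrm_conjc.
  have := sqr_ge0 (nrm (f x) - nrm (g x)).
  have := mulr_ge0 (nrm_ge0 (f x)) (nrm_ge0 (g x)).
  lra.
Qed.

Lemma L2dotDr f g h : L2 mu f -> L2 mu g -> L2 mu h ->
  L2dot mu f (fun x => g x - h x) = L2dot mu f g - L2dot mu f h.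
Proof.
move=> Lf Lg Lh; rewrite /L2dot -cintegralB; [|exact: cintegrable_L2..].
by congr cintegral; apply: funext => x; rewrite mulrBr.
Qed.

Lemma L2B f g : L2 mu f -> L2 mu g -> L2 mu (fun x => f x - g x).
Proof.
move=> Lf Lg; have := L2_linear (-1) Lg Lf; congr L2; apply: funext => x.
by rewrite mulN1r addrC.
Qed.

Lemma L2norm_eq0 f : L2 mu f -> L2norm mu f = 0 -> f = (fun=> 0) %[ae mu].
Proof.
move=> Lf /eqP; rewrite sqrtr_eq0 => I0.
have iL := L2_integrable Lf; have mf := measurable_nrm (L2_cmeasurable Lf).
have I00 : (\int[mu]_(x in setT) `|(EFin \o (fun x => nrm (f x) ^+ 2)%R) x|)%E = 0%E.
  under eq_integral do rewrite /= ger0_norm ?sqr_ge0//.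
  rewrite -[LHS]fineK; last exact: integrable_fin_num iL.
  by congr EFin; apply/eqP; rewrite eq_le I0 fine_ge0// integral_ge0// => x _; rewrite lee_fin sqr_ge0.
move/(ae_eq_integral_abs mu measurableT): I00 => /(_ _).
have mf2 : measurable_fun setT (EFin \o (fun x => nrm (f x) ^+ 2)).
  by apply/measurable_EFinP; exact: measurable_funX.
move=> /(_ mf2); apply: filterS => x /(_ I) /= [] /eqP; rewrite sqrf_eq0 nrm_eq0 => /eqP -> //.
Qed.

Lemma L2dot_self f : L2 mu f -> L2dot mu f f = (Rintegral mu setT (fun x => nrm (f x) ^+ 2))%:C.
Proof.
move=> Lf; rewrite /L2dot /cintegral; congr (_ +i* _).
  by apply: eq_Rintegral => x _; rewrite nrm_sqr Re_mulE Re_conjE Im_conjE; ring.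
rewrite /Rintegral (_ : (fun x => _) = cst 0%E) ?integral0//; apply: funext => x.
by congr EFin; rewrite Im_mulE Re_conjE Im_conjE; ring.
Qed.

Lemma L2_eq_weak f g : L2 mu f -> L2 mu g ->
  (forall h, L2 mu h -> L2dot mu h f = L2dot mu h g) -> f = g %[ae mu].
Proof.
move=> Lf Lg fg; have Lfg := L2B Lf Lg.
have : L2norm mu (fun x => f x - g x) = 0.
  have := L2dot_self Lfg; rewrite L2dotDr// fg// subrr => /(@complexI R 0) E.
  by rewrite /L2norm -E sqrtr0.
move=> /(L2norm_eq0 Lfg); apply: filterS => x /(_ I) /eqP.
by rewrite subr_eq0 => /eqP ->.
Qed.

Lemma L2norm_ge0 f : 0 <= L2norm mu f.
Proof. exact: sqrtr_ge0. Qed.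

(* A crude form of the triangle inequality; any constant would do. *)
Lemma L2normB f g : L2 mu f -> L2 mu g ->
  L2norm mu (fun x => f x - g x) <= 2 * (L2norm mu f + L2norm mu g).
Proof.
move=> Lf Lg; have Lfg := L2B Lf Lg.
set a := L2norm mu f; set b := L2norm mu g.
have J0 h : 0 <= Rintegral mu setT (fun x => nrm (h x : R[i]) ^+ 2).
  by apply: Rintegral_ge0 => x _; exact: sqr_ge0.
have a2 : a ^+ 2 = Rintegral mu setT (fun x => nrm (f x) ^+ 2) by rewrite sqr_sqrtr.
have b2 : b ^+ 2 = Rintegral mu setT (fun x => nrm (g x) ^+ 2) by rewrite sqr_sqrtr.
have a0 : 0 <= a := L2norm_ge0 f.
have b0 : 0 <= b := L2norm_ge0 g.
rewrite -ler_sqr ?nnegrE ?L2norm_ge0 ?mulr_ge0 ?addr_ge0//.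
rewrite sqr_sqrtr//; apply: (@le_trans _ _ (2 * (a ^+ 2 + b ^+ 2))).
  rewrite a2 b2 -RintegralD; [|exact: measurableT|exact: L2_integrable..].
  rewrite -RintegralZl; [|exact: measurableT|
    exact: (integrableD measurableT (L2_integrable Lf) (L2_integrable Lg))].
  apply: le_Rintegral; [exact: measurableT|exact: L2_integrable| |].
    apply: (@integrableZl _ _ _ mu _ measurableT 2 (EFin \o (fun x => nrm (f x) ^+ 2 + nrm (g x) ^+ 2))).
    exact: (integrableD measurableT (L2_integrable Lf) (L2_integrable Lg)).
  move=> x _; apply: (@le_trans _ _ ((nrm (f x) + nrm (g x)) ^+ 2)).
    by rewrite ler_sqr ?nnegrE ?addr_ge0 ?nrm_ge0// -(nrmN (g x)) nrmD.
  by have := sqr_ge0 (nrm (f x) - nrm (g x)); lra.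
by have := mulr_ge0 a0 b0; have := sqr_ge0 a; have := sqr_ge0 b; lra.
Qed.

Lemma L2norm_ae f g : L2 mu f -> L2 mu g -> f = g %[ae mu] -> L2norm mu f = L2norm mu g.
Proof.
move=> Lf Lg fg; rewrite /L2norm /Rintegral; congr (Num.sqrt (fine _)).
apply: ae_eq_integral => //.
- exact: measurable_int (L2_integrable Lf).
- exact: measurable_int (L2_integrable Lg).
- by apply: filterS fg => x /(_ I) E _; rewrite E.
Qed.

End L2_facts.

(** The regularizing function is [v] itself, recentred at a point where it does not vanish and
    normalized there; such a point exists because the norm is nonzero. *)
Lemma schwartz_normalized_cutoff (R : realType) (n : nat) (v : 'rV[R]_n -> R[i]) :
  schwartz v -> L2norm dx v = 1 ->
  exists2 chi : 'rV[R]_n -> R[i], schwartz chi & chi 0 = 1.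
Proof.
move=> Sv nv; have [a va] : exists a, v a != 0.
  apply: contrapT => /forallNP v0; have : L2norm dx v = 0.
    rewrite /L2norm; under eq_Rintegral => x _.
      have /negP := v0 x; rewrite negbK => /eqP ->.
      rewrite nrm0 expr0n /=; over.
    by rewrite /Rintegral integral0 sqrtr0.
  by rewrite nv => /eqP; rewrite oner_eq0.
exists (fun x => (v a)^-1 * v (a + x)).
  by apply: schwartz_scale; exact: schwartz_shift.
by rewrite addr0 mulVf.
Qed.

Section phase_measurability.
Context (R : realType) (n : nat) d (T : measurableType d).
Implicit Types a b : T -> phase R n.

Lemma measurable_phaseD a b : measurable_fun setT a -> measurable_fun setT b ->
  measurable_fun setT (fun t => a t + b t).
Proof.
move=> /measurable_fun_pairP[a1 a2] /measurable_fun_pairP[b1 b2].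
by apply/measurable_fun_pairP; split; exact: measurable_rVD.
Qed.

Lemma measurable_phaseZ (c : R) a : measurable_fun setT a ->
  measurable_fun setT (fun t => c *: a t).
Proof.
move=> /measurable_fun_pairP[a1 a2].
by apply/measurable_fun_pairP; split; exact: measurable_rVZ.
Qed.

Lemma measurable_sympl a b : measurable_fun setT a -> measurable_fun setT b ->
  measurable_fun setT (fun t => sympl (a t) (b t)).
Proof.
move=> /measurable_fun_pairP[a1 a2] /measurable_fun_pairP[b1 b2].
by apply: measurable_funB; exact: measurable_dotp.
Qed.

Lemma cmeasurable_kappa a b : measurable_fun setT a -> measurable_fun setT b ->
  cmeasurable (fun t => kappa (a t) (b t)).
Proof.
move=> ma mb; apply: cmeasurable_cis; apply: measurable_funN.
by apply: measurable_funM; [exact: measurable_sympl|exact: measurable_cst].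
Qed.

End phase_measurability.

Section phase_shift_L2.
Context (R : realType) (n : nat).
Implicit Types (Phi : phase R n -> R[i]) (X : phase R n).

Let sqr Phi (X : phase R n) : R[i] := (nrm (Phi X) ^+ 2)%:C.

Let cintegrable_sqr Phi : L2 dX Phi -> cintegrable dX (sqr Phi).
Proof.
move=> LP; apply: (cintegrable_le _ (L2_integrable LP)) => [|X].
  apply: cmeasurable_real; apply: measurable_funX.
  exact: (measurable_nrm (L2_cmeasurable LP)).
by rewrite nrm_real ger0_norm ?sqr_ge0.
Qed.

Lemma L2_phase_shift Phi X : L2 dX Phi -> L2 dX (fun Z => Phi (X + Z)).
Proof.
move=> LP; have := cintegrable_phase_shift X (cintegrable_sqr LP).
have [mr mi _] := LP; have mX : measurable_fun setT (fun Z : phase R n => X + Z).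
  by apply: measurable_phaseD; [exact: measurable_cst|exact: measurable_id].
move=> [_]; under eq_integral do rewrite nrm_real ger0_norm ?sqr_ge0//.
by split; [exact: (measurableT_comp mr)|exact: (measurableT_comp mi)|].
Qed.

Lemma L2norm_phase_shift Phi X : L2 dX Phi ->
  Rintegral dX setT (fun Z => nrm (Phi (X + Z)) ^+ 2) =
  Rintegral dX setT (fun Z => nrm (Phi Z) ^+ 2).
Proof.
by move=> LP; have := congr1 (@complex.Re R) (cintegral_phase_shift X (cintegrable_sqr LP)).
Qed.

(** In the application [b] is the sup norm of an element of L1, whose measurability is not at hand;
    the estimates on [b] therefore use only monotonicity of the integral. *)
Lemma cintegrable_twisted (k : phase R n -> phase R n -> R[i]) (b : phase R n -> R) Psi Phi :
  cmeasurable (fun p : phase R n * phase R n => k p.1 p.2) ->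
  (forall X Z, nrm (k X Z) <= b X) -> (\int[dX]_X (b X)%:E < +oo)%E ->
  L2 dX Psi -> L2 dX Phi ->
  cintegrable dXdX (fun p =>
    conjc (Psi p.2) * (k p.1 p.2 * (kappa p.1 p.2 * Phi (p.1 + p.2)))).
Proof.
move=> mk kb bfin LPsi LPhi.
set N := (fun p => _).
have m1 : measurable_fun setT (fun p : phase R n * phase R n => p.1) by exact: measurable_fst.
have m2 : measurable_fun setT (fun p : phase R n * phase R n => p.2) by exact: measurable_snd.
have mN : cmeasurable N.
  apply: cmeasurableM.
    by apply: cmeasurable_conj; exact: (cmeasurable_comp m2 (L2_cmeasurable LPsi)).
  apply: cmeasurableM => //; apply: cmeasurableM; first exact: cmeasurable_kappa.
  by apply: (cmeasurable_comp _ (L2_cmeasurable LPhi)); exact: measurable_phaseD.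
(* The two integrals come from |Psi| |Phi| <= |Psi|^2 + |Phi|^2 and translation invariance; the 1
   makes [c] invertible. *)
pose c := Rintegral dX setT (fun Z => nrm (Psi Z) ^+ 2) +
  Rintegral dX setT (fun Z => nrm (Phi Z) ^+ 2) + 1.
have c0 : 0 < c.
  by rewrite ltr_wpDl// addr_ge0//; apply: Rintegral_ge0 => Z _; exact: sqr_ge0.
pose I X := (\int[dX]_Z (nrm (N (X, Z)))%:E)%E.
have I0 X : (0 <= I X)%E by apply: integral_ge0 => Z _; rewrite lee_fin nrm_ge0.
have Ib X : (I X <= (b X * c)%:E)%E.
  have b0 : 0 <= b X := le_trans (nrm_ge0 _) (kb X 0).
  have LX := L2_phase_shift X LPhi.
  have iS := integrableD measurableT (L2_integrable LPsi) (L2_integrable LX).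
  have iS' := integrableZl measurableT (b X) iS.
  apply: (@le_trans _ _ (\int[dX]_Z (b X * (nrm (Psi Z) ^+ 2 + nrm (Phi (X + Z)) ^+ 2))%:E)%E).
    apply: ge0_integral_mono => Z; first by rewrite lee_fin nrm_ge0.
    rewrite lee_fin /N/= !nrmM nrm_conjc nrm_cis mul1r mulrCA.
    apply: ler_pM => //; rewrite ?nrm_ge0 ?mulr_ge0 ?nrm_ge0//.
    have := sqr_ge0 (nrm (Psi Z) - nrm (Phi (X + Z))).
    have := mulr_ge0 (nrm_ge0 (Psi Z)) (nrm_ge0 (Phi (X + Z))).
    lra.
  rewrite -[leLHS]fineK; last exact: (integrable_fin_num measurableT iS').
  rewrite lee_fin.
  rewrite [leLHS](RintegralZl _ measurableT iS) (RintegralD measurableT (L2_integrable LPsi) (L2_integrable LX)).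
  rewrite L2norm_phase_shift// ler_wpM2l// /c lerDl//.
have mI : measurable_fun setT I.
  exact: (@measurable_fun_integral_section R _ _ _ _ dX (fun p => nrm (N p)) (measurable_nrm mN)).
apply: cintegrable_prod => //.
rewrite -/(I _).
(* The constant is carried by the measurable function [I]: extracting it from an integral involving
   [b] would require measurability of [b]. *)
have : (\int[dX]_X ((c^-1)%:E * I X) < +oo)%E.
  apply: le_lt_trans bfin; apply: ge0_integral_mono => X.
    by rewrite mule_ge0// lee_fin invr_ge0 ltW.
  rewrite muleC lee_pdivrMr// -EFinM; exact: Ib.
rewrite ge0_integralZl//; last by rewrite lee_fin invr_ge0 ltW.
move=> h; rewrite ltNge leye_eq; apply/negP => /eqP E; move: h.
by rewrite /I in E *; rewrite E mulry gtr0_sg ?invr_gt0// mul1e ltxx.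
Qed.

End phase_shift_L2.

Section kernel.
Context (R : realType) (n : nat) (h g : phase R n -> R[i]).
Hypotheses (mh : cmeasurable h)
  (gA : forall k, amp (fun (_ : unit) _ => 1) k (fun=> g)).

Definition window_integrand (X Z Y : phase R n) : R[i] :=
  cis (- sympl X Y) * h Y * g (2^-1 *: X + Z + Y).

(* The value of M_h(f)(X) at Theta_{X/2} Theta_Z sigma when g = f o Theta_sigma. *)
Definition window_kernel X Z : R[i] := cintegral dX (window_integrand X Z).

Lemma cmeasurable_symbol d (T : measurableType d) (a : T -> phase R n) :
  measurable_fun setT a -> cmeasurable (fun t => g (a t)).
Proof.
move=> /measurable_fun_pairP[a1 a2].
have := cmeasurable_symbol_pair gA a1 a2; congr cmeasurable; apply: funext => t /=.
by congr g; case: (a t).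
Qed.

Lemma cmeasurable_window_integrand :
  cmeasurable (fun p : (phase R n * phase R n) * phase R n => window_integrand p.1.1 p.1.2 p.2).
Proof.
have m11 : measurable_fun setT (fun p : (phase R n * phase R n) * phase R n => p.1.1).
  by apply: measurableT_comp => //; exact: measurable_fst.
have m12 : measurable_fun setT (fun p : (phase R n * phase R n) * phase R n => p.1.2).
  by apply: measurableT_comp => //; exact: measurable_fst.
have m2 : measurable_fun setT (fun p : (phase R n * phase R n) * phase R n => p.2).
  exact: measurable_snd.
apply: cmeasurableM.
  apply: cmeasurableM; last exact: (cmeasurable_comp m2 mh).
  by apply: cmeasurable_cis; apply: measurable_funN; exact: measurable_sympl.
apply: cmeasurable_symbol; apply: measurable_phaseD => //; apply: measurable_phaseD => //.
exact: measurable_phaseZ.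
Qed.

Lemma cmeasurable_window_kernel :
  cmeasurable (fun p : phase R n * phase R n => window_kernel p.1 p.2).
Proof.
exact: (@cmeasurable_cintegral R _ _ _ _ (@dX R n) _ cmeasurable_window_integrand).
Qed.

End kernel.

Lemma cmeasurable_wigner (R : realType) (n : nat) (v : 'rV[R]_n -> R[i]) :
  schwartz v -> cmeasurable (wigner v).
Proof.
move=> Sv; have mv := schwartz_cmeasurable Sv.
apply: (@cmeasurable_cintegral R _ _ _ _ (@dx R n)
  (fun z : phase R n * 'rV[R]_n => cis (dotp z.2 z.1.2) *
    conjc (v (z.1.1 + 2^-1 *: z.2)) * v (z.1.1 - 2^-1 *: z.2))).
have m11 : measurable_fun setT (fun z : phase R n * 'rV[R]_n => z.1.1).
  by apply: measurableT_comp => //; exact: measurable_fst.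
have m12 : measurable_fun setT (fun z : phase R n * 'rV[R]_n => z.1.2).
  by apply: measurableT_comp => //; exact: measurable_fst.
have m2 : measurable_fun setT (fun z : phase R n * 'rV[R]_n => z.2) by exact: measurable_snd.
apply: cmeasurableM; first apply: cmeasurableM.
- by apply: cmeasurable_cis; exact: measurable_dotp.
- apply: cmeasurable_conj; apply: (cmeasurable_comp _ mv).
  by apply: measurable_rVD => //; exact: measurable_rVZ.
- apply: (cmeasurable_comp _ mv).
  by apply: measurable_rVB => //; exact: measurable_rVZ.
Qed.

(** * Comparison of the kernels *)

Section bargmann_kernel.
Context (R : realType) (n : nat) (op : phase R n -> L2op (@dx R n) (@dx R n))
  (v chi : 'rV[R]_n -> R[i]) (U : L2op (@dx R n) (@dX R n)) (g : phase R n -> R[i])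
  (S : L2op (@dx R n) (@dx R n)).

(** The hypothesis on [U] gives pointwise values of U, not of its adjoint. Hence S and the adjoint
    of U are moved to the left: the pairing becomes that of U(w) with Phi, where w is the adjoint of
    S applied to v(Z), and U(w) at W is the conjugate of the kernel. *)
Lemma bargmann_conj_kernel (Phi : phase R n -> R[i]) (Z : phase R n) :
  is_phase_translation op -> schwartz chi -> chi 0 = 1 -> schwartz v ->
  is_bargmann op v U -> (forall k, amp (fun (_ : unit) _ => 1) k (fun=> g)) ->
  is_weyl g S ->
  (forall X, cintegrable dX (window_integrand (wigner v) g X Z)) -> L2 dX Phi ->
  L2dot dx (op (- Z) v) (S (op_adj U Phi)) =
  cintegral dX (fun X => window_kernel (wigner v) g X Z * (kappa X Z * Phi (X + Z))).
Proof.
move=> op_weyl Schi chi0 Sv UB gA Sg iW LPhi.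
have Lv : L2 dx v := schwartz_L2 Sv.
have Lop W : L2 dx (op W v) := bounded_linear_L2 (op_funP (op W)) Lv.
have LU : L2 dx (op_adj U Phi) := bounded_linear_L2 (op_adjP U) LPhi.
set w := op_adj S (op (- Z) v).
have Lw : L2 dx w := bounded_linear_L2 (op_adjP S) (Lop _).
have LUw : L2 dX (U w) := bounded_linear_L2 (op_funP U) Lw.
rewrite (op_adjE S)// (op_star_adjE U)//.
pose K (W : phase R n) := window_kernel (wigner v) g (W - Z) Z * (kappa W Z * Phi W).
have half W : 2^-1 *: (W - Z) + Z = 2^-1 *: (Z + W).
  have Z2 : Z = 2^-1 *: (Z + Z).
    rewrite scalerDr -scalerDl (_ : 2^-1 + 2^-1 = 1 :> R) ?scale1r//; lra.
  by rewrite [X in _ + X]Z2 -scalerDr addrA subrK addrC.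
have kE W : window_kernel (wigner v) g (W - Z) Z * kappa W Z = conjc (L2dot dx (op (- W) v) w).
  rewrite -L2dotC -(op_adjE S)//.
  have E : window_integrand (wigner v) g (W - Z) Z =
      fun Y => cis (- sympl (W - Z) Y) * wigner v Y * g (2^-1 *: (Z + W) + Y).
    by apply: funext => Y; rewrite /window_integrand half.
  have iE := iW (W - Z); rewrite E in iE.
  by rewrite (packet_kernel op_weyl Schi chi0 Sv gA Sg iE) mulrC /window_kernel E.
have aeK : (fun W => conjc (U w W) * Phi W) = K %[ae dX].
  by apply: filterS (UB w Lw) => W /(_ I) E _; rewrite /K mulrA kE E.
have mK : cmeasurable K.
  apply: cmeasurableM.
    have mp : measurable_fun setT (fun W : phase R n => (W - Z, Z)).
      apply/measurable_fun_pairP; split; last exact: measurable_cst.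
      by apply: measurable_phaseD; [exact: measurable_id|exact: measurable_cst].
    exact: (cmeasurable_comp mp (cmeasurable_window_kernel (cmeasurable_wigner Sv) gA)).
  apply: cmeasurableM; last exact: (L2_cmeasurable LPhi).
  by apply: cmeasurable_kappa; [exact: measurable_id|exact: measurable_cst].
have iL := cintegrable_L2 LUw LPhi.
(* [K] agrees almost everywhere with a product of two square-integrable functions, and inherits its
   integrability from there. *)
have iK : cintegrable dX K := cintegrable_ae mK aeK iL.
apply: (etrans (cintegral_ae iL.1 mK aeK)).
apply: (etrans (esym (cintegral_phase_shift Z iK))).
have KE (X : phase R n) : K (Z + X) =
    window_kernel (wigner v) g X Z * (kappa X Z * Phi (X + Z)).
  have e1 : Z + X - Z = X by rewrite addrAC subrr add0r.
  have e2 : kappa (Z + X) Z = kappa X Z.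
    by congr (cis (- (_ / 2))); rewrite /sympl /= !dotpDl !dotpDr; ring.
  by rewrite /K e1 e2 [Z + X]addrC.
exact (f_equal (cintegral dX) (funext KE)).
Qed.

End bargmann_kernel.

(** * Equality of both operators on smooth vectors *)

Section smooth_case.
Context (R : realType) (n : nat) (Sigma : topologicalType)
  (Theta : phase_action R n Sigma) (Q B : cstar_algebra R) (iota : C0 R Sigma -> Q)
  (j : (phase R n -> C0 R Sigma) -> B) (op : phase R n -> L2op (@dx R n) (@dx R n))
  (sigma : Sigma) (v : 'rV[R]_n -> R[i]) (M : Q -> B)
  (rT : B -> L2op (@dX R n) (@dX R n)) (Op : Q -> L2op (@dx R n) (@dx R n))
  (U : L2op (@dx R n) (@dX R n)).

Lemma op_eq_smooth (f : C0 R Sigma) : is_phase_translation op ->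
  schwartz v -> L2norm dx v = 1 -> extends_window Theta (wigner v) iota j M ->
  is_integrated_form Theta sigma j rT -> extends_weyl Theta sigma iota Op ->
  is_bargmann op v U -> smooth_vector Theta f ->
  op_eq (rT (M (iota f))) (op_conj U (Op (iota f))).
Proof.
move=> op_weyl Sv nv [_ window] [_ integrated] [_ weyl] UB Sf Phi LPhi.
have [chi Schi chi0] := schwartz_normalized_cutoff Sv nv.
pose g (Y : phase R n) := f (Theta Y sigma).
have gA k : amp (fun (_ : unit) _ => 1) k (fun=> g) by exact: class_C_orbit_amp (Sf k).
have Sg : is_weyl g (Op (iota f)) := weyl f Sf.
have [F [LF boch ->]] := window f Sf.
have mW := cmeasurable_window_integrand (cmeasurable_wigner Sv) gA.
(* Besides the value of [F X], evaluation yields the integrability of the window times the symbol,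
   which stands in for decay of the Wigner function. *)
have ev X Z : cintegrable dX (window_integrand (wigner v) g X Z) /\
    window_kernel (wigner v) g X Z = F X (Theta (2^-1 *: X) (Theta Z sigma)).
  have E : (fun Y => ((cis (- sympl X Y) * wigner v Y) *: translate Theta Y f)
      (Theta (2^-1 *: X) (Theta Z sigma))) = window_integrand (wigner v) g X Z.
    by apply: funext => Y; rewrite /window_integrand /g [_ + Y]addrC !actD.
  have := bochner_eval (s := Theta (2^-1 *: X) (Theta Z sigma)) _ (boch X).
  rewrite E; apply.
  exact: (cmeasurable_pair1 (X, Z) mW).
have LS : L2 dX (rT (j F) Phi) := bounded_linear_L2 (op_funP _) LPhi.
have LT : L2 dX (op_conj U (Op (iota f)) Phi) := bounded_linear_L2 (op_funP _) LPhi.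
apply: L2_eq_weak => // Psi LPsi.
rewrite integrated//.
pose N (p : phase R n * phase R n) :=
  conjc (Psi p.2) * (window_kernel (wigner v) g p.1 p.2 * (kappa p.1 p.2 * Phi (p.1 + p.2))).
have iN : cintegrable dXdX N.
  apply: (@cintegrable_twisted R n (window_kernel (wigner v) g) (fun X => nrm (F X))) => //.
  - exact: cmeasurable_window_kernel (cmeasurable_wigner Sv) gA.
  - by move=> X Z; rewrite (ev X Z).2; exact: C0_nrm_eval.
  - exact: LF.2.
transitivity (cintegral dX (fun X => cintegral dX (fun Z => N (X, Z)))).
  congr cintegral; apply: funext => X; congr cintegral; apply: funext => Z.
  by rewrite /N /= (ev X Z).2 /r_rep /T_rep [Z + X]addrC.
rewrite (cfubini iN).
have LU : L2 dx (op_adj U Phi) := bounded_linear_L2 (op_adjP U) LPhi.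
pose w := Op (iota f) (op_adj U Phi).
have Lw : L2 dx w := bounded_linear_L2 (op_funP _) LU.
have iL := cintegrable_L2 LPsi LT.
have iN' := cintegrable_swap iN.
have mN : cmeasurable (fun Z => cintegral dX (fun X => N (X, Z))).
  exact: (@cmeasurable_cintegral R _ _ _ _ (@dX R n) _ iN'.1).
apply/esym; apply: (cintegral_ae iL.1 mN).
have aeU := UB w Lw.
have aeN := cintegrable_section iN'.
apply: filterS2 aeU aeN => Z /(_ I) EU iZ _.
have -> : op_conj U (Op (iota f)) Phi Z = L2dot dx (op (- Z) v) w by rewrite -EU.
rewrite (bargmann_conj_kernel op_weyl Schi chi0 Sv UB gA Sg (fun X => (ev X Z).1) LPhi).
(* Fubini only gives integrability of the section with the factor conj(Psi Z) included, so this
   factor can be cancelled when it is nonzero; otherwise both sides vanish. *)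
have [P0|P0] := eqVneq (Psi Z) 0.
  rewrite /N /= P0 conjc0 mul0r; under eq_fun do rewrite mul0r.
  by apply: complex_eq; rewrite /cintegral/= /Rintegral integral0.
rewrite -cintegralZ //.
have := cintegrableZ (conjc (Psi Z))^-1 iZ; congr cintegrable; apply: funext => X.
by rewrite /N /= mulrA mulVf ?mul1r// conjc_eq0.
Qed.

End smooth_case.

(** * Extension from smooth vectors to the whole quantization *)

Theorem theorem4p2 (R : realType) (n : nat)
  (Sigma : topologicalType)
  (Sigma_hausdorff : hausdorff_space Sigma)
  (Sigma_locally_compact : locally_compact [set: Sigma])
  (Theta : phase_action R n Sigma)
  (Theta_continuous : strongly_continuous Theta)
  (Q : cstar_algebra R) (iota : C0 R Sigma -> Q)
  (Q_quantization : is_rieffel_quantization Theta iota)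
  (B : cstar_algebra R) (j : (phase R n -> C0 R Sigma) -> B)
  (B_crossed_product : is_crossed_product Theta j)
  (op : phase R n -> L2op (@dx R n) (@dx R n))
  (op_weyl : is_phase_translation op)
  (sigma : Sigma)
  (v : 'rV[R]_n -> R[i]) (v_schwartz : schwartz v) (v_norm : L2norm dx v = 1)
  (M : Q -> B) (M_window : extends_window Theta (wigner v) iota j M)
  (rT : B -> L2op (@dX R n) (@dX R n))
  (rT_integrated : is_integrated_form Theta sigma j rT)
  (Op : Q -> L2op (@dx R n) (@dx R n))
  (Op_weyl : extends_weyl Theta sigma iota Op)
  (U : L2op (@dx R n) (@dX R n)) (U_bargmann : is_bargmann op v U) :
  forall F : Q, op_eq (rT (M F)) (op_conj U (Op F)).
Proof.
move=> F Phi LPhi.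
pose w := op_adj U Phi.
have Lw : L2 dx w := bounded_linear_L2 (op_adjP U) LPhi.
have LrT b : L2 dX (rT b Phi) := bounded_linear_L2 (op_funP _) LPhi.
have LOp a : L2 dx (Op a w) := bounded_linear_L2 (op_funP _) Lw.
have LU u : L2 dx u -> L2 dX (U u) := bounded_linear_L2 (op_funP U) (u := u).
have [m Um] := bounded_linear_bounded (op_funP U).
(* This collects the factor 2 of [L2normB] and the bound of [U] for the splitting D = U D2 - D1
   below; the absolute value is there because [m] has no prescribed sign. *)
pose c := 2 * (L2norm dX Phi + `|m| * L2norm dx w).
have c0 : 0 <= c by rewrite mulr_ge0// addr_ge0 ?mulr_ge0 ?L2norm_ge0.
pose D X := rT (M F) Phi X - U (Op F w) X.
have LD : L2 dX D by exact: L2B (LrT _) (LU _ (LOp _)).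
have D0 : L2norm dX D <= 0.
  apply/ler_addgt0Pl => e e0; rewrite addr0.
  (* Dividing by c + 1 rather than c covers the case c = 0. *)
  pose e' := e / (c + 1).
  have c1 : 0 < c + 1 by rewrite ltr_wpDl.
  have e'0 : 0 < e' by rewrite divr_gt0.
  have nT : \forall a \near F, forall u, L2 dX u ->
      L2norm dX (fun x => rT (M a) u x - rT (M F) u x) <= e' * L2norm dX u.
    exact: (M_window.1 F _ (rT_integrated.1 (M F) e' e'0)).
  have nO := Op_weyl.1 F e' e'0.
  have cF : closure (iota @` smooth_vector Theta) F by rewrite (rieffel_dense Q_quantization).
  have [_ [[f Sf <-] [hT hO]]] := cF _ (filterI nT nO).
  have smooth_eq := op_eq_smooth op_weyl v_schwartz v_norm M_window
    rT_integrated Op_weyl U_bargmann Sf LPhi.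
  pose a := iota f.
  pose D1 X := rT (M a) Phi X - rT (M F) Phi X.
  pose D2 x := Op a w x - Op F w x.
  have LD1 : L2 dX D1 := L2B (LrT _) (LrT _).
  have LD2 : L2 dx D2 := L2B (LOp _) (LOp _).
  have UD2 : U D2 = (fun X => U (Op a w) X - U (Op F w) X) %[ae dX].
    have := bounded_linear_linear (op_funP U) (-1) (LOp F) (LOp a).
    have -> : (fun x => -1 * Op F w x + Op a w x) = D2.
      by apply: funext => x; rewrite mulN1r addrC.
    by apply: filterS => X /(_ I) -> _; rewrite mulN1r addrC.
  (* The two terms at the smooth vector [a] are equal by the smooth case and cancel. *)
  have DE : (fun X => U D2 X - D1 X) = D %[ae dX].
    apply: filterS2 UD2 smooth_eq => X /(_ I) E1 /(_ I) E2 _.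
    by rewrite E1 /D1 E2 /D /op_conj /=; ring.
  rewrite -(L2norm_ae (L2B (LU _ LD2) LD1) LD DE).
  apply: (le_trans (L2normB (LU _ LD2) LD1)).
  have h1 := hT Phi LPhi; have h2 := hO w Lw.
  have h3 : L2norm dX (U D2) <= `|m| * (e' * L2norm dx w).
    apply: (le_trans (Um D2 LD2)).
    apply: (@le_trans _ _ (`|m| * L2norm dx D2)).
      by rewrite ler_wpM2r ?L2norm_ge0// ler_norm.
    by rewrite ler_wpM2l.
  have h4 : e' * c <= e.
    rewrite /e' mulrAC ler_pdivrMr// ler_pM2l//; lra.
  apply: le_trans h4; rewrite /c mulrCA ler_pM2l//.
  by rewrite mulrDr addrC lerD// mulrCA.
have {}D0 : L2norm dX D = 0 by apply/eqP; rewrite eq_le D0 L2norm_ge0.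
apply: filterS (L2norm_eq0 LD D0) => X /(_ I) /eqP; rewrite subr_eq0 => /eqP E _.
exact: E.
Qed.
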